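(* Let $X,Y\subset\mathbb{R}^N$ be closed semialgebraic sets. Put $r=r(X)+r(Y)$ and $d=\max\{\kappa(X),\kappa(Y)\}$, and assume $d\ge1$. Then there exists a positive constant $C$ such that $$\operatorname{dist}(x,X)+\operatorname{dist}(x,Y)\ge C\left(\frac{\operatorname{dist}(x,X\cap Y)}{1+|x|^d}\right)^{d(6d-3)^{N+r-1}}\quad\text{for } x\in\mathbb{R}^N.$$
   Context: $|\cdot|$ is the Euclidean norm, $\operatorname{dist}$ the Euclidean distance to a set, with the convention $\operatorname{dist}(x,\emptyset)=1$. Complexity numbers. Every closed semialgebraic set $X\subset\mathbb{R}^N$ has a decomposition $X=X_1\cup\dots\cup X_k$ into closed basic semialgebraic sets $$X_i=\{x\in\mathbb{R}^N: g_{i,1}(x)\ge 0,\dots,g_{i,r_i}(x)\ge 0,\ h_{i,1}(x)=\dots=h_{i,l_i}(x)=0\},\quad i=1,\dots,k,$$ with $g_{i,j},h_{i,s}\in\mathbb{R}[x_1,\dots,x_N]$, where $r_i$ is taken to be the smallest possible number of inequalities in the definition of $X_i$. The number $r(X)$ is the minimum of $\max\{r_1,\dots,r_k\}$ over all such decompositions of $X$ (so $r(X)=0$ if and only if $X$ is algebraic). The number $\kappa(X)$ is the minimum of the maximal degree of all the polynomials $g_{i,j},h_{i,s}$ over all such decompositions (descriptions) of $X$ that satisfy $r_i\le r(X)$ for all $i$. *)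

(* Defs.v *)
From mathcomp Require Import all_boot all_order all_algebra.
From mathcomp Require Import all_classical all_reals all_analysis.
(* The notations of mpoly clash with those of analysis. *)
From mathcomp Require Import -(notations) mpoly.

Set Implicit Arguments.
Unset Strict Implicit.
Unset Printing Implicit Defensive.

Import Order.TTheory GRing.Theory Num.Theory.
Import numFieldNormedType.Exports.

Local Open Scope classical_set_scope.
Local Open Scope ring_scope.

(* The library norm on row vectors is the sup norm, hence [eucl_norm]. *)
Definition eucl_norm (R : realType) (N : nat) (x : 'rV[R]_N) : R :=
  Num.sqrt (\sum_(i < N) x ord0 i ^+ 2).

Definition eucl_dist (R : realType) (N : nat) (x : 'rV[R]_N) (A : set 'rV[R]_N)
    : R :=
  if A == set0 then 1 else inf [set eucl_norm (x - y) | y in A].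

Definition peval (R : realType) (N : nat) (p : mpoly.mpoly N R)
    (x : 'rV[R]_N) : R :=
  mpoly.meval (fun i => x ord0 i) p.

(* Total degree; [msize] is the degree plus one, and the zero polynomial gets
   degree 0. *)
Definition pdeg (R : realType) (N : nat) (p : mpoly.mpoly N R) : nat :=
  (mpoly.msize p).-1.

Record system (R : realType) (N : nat) := System {
  ineqs : seq (mpoly.mpoly N R);
  eqns : seq (mpoly.mpoly N R) }.

Definition closed_basic (R : realType) (N : nat) (s : system R N)
    : set 'rV[R]_N :=
  [set x | all (fun g => 0 <= peval g x) (ineqs s) &&
           all (fun h => peval h x == 0) (eqns s)].

Definition strict_basic (R : realType) (N : nat) (s : system R N)
    : set 'rV[R]_N :=
  [set x | all (fun g => 0 < peval g x) (ineqs s) &&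
           all (fun h => peval h x == 0) (eqns s)].

Definition semialgebraic (R : realType) (N : nat) (X : set 'rV[R]_N) : Prop :=
  exists (k : nat) (D : 'I_k -> system R N),
    X = \bigcup_(i in [set: 'I_k]) strict_basic (D i).

(* The number of inequalities of [s] is the smallest possible one among all
   descriptions of the same closed basic set. *)
Definition fewest_ineqs (R : realType) (N : nat) (s : system R N) : Prop :=
  forall s' : system R N, closed_basic s' = closed_basic s ->
    (size (ineqs s) <= size (ineqs s'))%N.

Definition decomposition (R : realType) (N : nat) (X : set 'rV[R]_N)
    (k : nat) (D : 'I_k.+1 -> system R N) : Prop :=
  X = \bigcup_(i in [set: 'I_k.+1]) closed_basic (D i) /\
  forall i, fewest_ineqs (D i).

Definition system_deg (R : realType) (N : nat) (s : system R N) : nat :=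
  maxn (\max_(g <- ineqs s) pdeg g) (\max_(h <- eqns s) pdeg h).

Definition is_minimum (P : nat -> Prop) (m : nat) : Prop :=
  P m /\ forall n, P n -> (m <= n)%N.

(* [is_rnum X r] means r = r(X). *)
Definition is_rnum (R : realType) (N : nat) (X : set 'rV[R]_N) (r : nat)
    : Prop :=
  is_minimum (fun m => exists (k : nat) (D : 'I_k.+1 -> system R N),
    decomposition X D /\ m = \max_i size (ineqs (D i))) r.

(* [is_kappa X kap] means kap = kappa(X). *)
Definition is_kappa (R : realType) (N : nat) (X : set 'rV[R]_N) (kap : nat)
    : Prop :=
  exists2 r : nat, is_rnum X r &
  is_minimum (fun m => exists (k : nat) (D : 'I_k.+1 -> system R N),
    [/\ decomposition X D,
        forall i, (size (ineqs (D i)) <= r)%N &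
        m = \max_i system_deg (D i)]) kap.

(* Main.v *)
(* For d >= 2, turning each inequality g >= 0 into g = t^2 encodes the points
   common to two basic sets as the zeros of one nonnegative polynomial f of
   degree D = 2d in n = N + r variables.  The points of least gradient on the
   level sets of f in a box satisfy Lagrange equations.  After a generic
   perturbation of these, comparing the dimensions of spaces of polynomials
   restricted to their solutions gives, for each coordinate, a nonzero
   polynomial relation with the level t, of degree K = D (3D - 3)^(n - 1) in
   the coordinate.  So the points of least gradient lie on finitely many
   branches, whose distance to their limits at t = 0 is O(t^(1/K)), and the
   chain rule along the branches gives |grad f| V'(f) >= 2 for some increasing
   V(t) = O(t^(1/K)).  A minimiser of V(f(y)) + |y - x| over the sublevel set of
   x is then a zero of f, at distance at most V(f(x)) from x.  Since f is
   quadratic in the violation of the constraints, this is the exponent K/2.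
   Charts of projective space extend the bound from the cube to R^N.

   For d = 1 the charts would lose a factor 1 + |x|; but then the sets are unions
   of polyhedra, and Hoffman's linear error bound for the homogenised constraints
   applies. *)
Require Import Defs.
From mathcomp Require Import all_boot all_order all_algebra.
From mathcomp Require Import all_classical all_reals all_analysis.
From mathcomp Require Import -(notations) mpoly.
From mathcomp Require Import polyrcf.
From mathcomp Require Import ring lra zify.

Set Implicit Arguments.
Unset Strict Implicit.
Unset Printing Implicit Defensive.

Import Order.TTheory GRing.Theory Num.Theory.
Import numFieldNormedType.Exports.

Local Open Scope classical_set_scope.
Local Open Scope ring_scope.

Local Notation msize p := (mmeasure mdeg p).

(** * Polynomial relations by counting dimensions *)

(** The base [3 * D - 3] is a Bezout number. Eliminating the multiplier from the Lagrange equations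
    leaves minors of degree [2 * (D - 1) + (D - 1)], and [n - 1] of these would cut out a curve of
    degree [(3 * D - 3) ^ (n - 1)]; the factor [D] counts its points on a level of [f]. The proof
    needs no elimination theory: perturbing the [i]-th equation by [s * x_i ^ (2 * (D - 1))] gives
    it a leading term, so functions on the critical points reduce to normal forms that can be
    counted. Unperturbed, the critical points may fill sets of large dimension, where no relation
    need hold. The relations have to survive the limit [s -> 0], so their degrees are fixed before
    [s]; and they must not depend on the level, so that finitely many plane curves serve all levels.
    Critical points are obtained as minimisers of a penalised function on a box, which asks for no
    regularity of the level sets and costs one system per face. No Puiseux series occur: a branch is
    a monotone function, and its exponent [1 / K] comes from the multiplicity, at most [K], of a
    root of P(0, x). *)

Lemma lin_dep (F : fieldType) p q (A : 'M[F]_(p, q)) : (q < p)%N ->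
  exists2 v : 'rV[F]_p, v != 0 & v *m A = 0.
Proof.
move=> qp; have : kermx A != 0.
  rewrite -mxrank_eq0 mxrank_ker subn_eq0 -ltnNge.
  by rewrite (leq_ltn_trans (rank_leq_col A)).
move=> /rowV0Pn[v vA v0]; exists v => //.
by apply/eqP; rewrite -sub_kermx.
Qed.

(** Functions compared on [S] only stand for classes of polynomials modulo the ideal of [S], so that
    no quotient ring has to be formed. *)
Definition spanned (F : fieldType) (T : Type) (S : T -> Prop) (J : finType)
    (e : J -> T -> F) (g : T -> F) :=
  exists a : J -> F, forall x, S x -> g x = \sum_k a k * e k x.

Section Spanned.
Variables (F : fieldType) (T : Type) (S : T -> Prop) (J : finType).
Variable e : J -> T -> F.
Implicit Types g h : T -> F.

Lemma spanned_ext g h : (forall x, S x -> g x = h x) ->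
  spanned S e h -> spanned S e g.
Proof. by move=> gh [a ha]; exists a => x Sx; rewrite gh // ha. Qed.

Lemma spanned_sum (I : Type) (r : seq I) (P : pred I) (c : I -> F)
    (g : I -> T -> F) :
  (forall i, P i -> spanned S e (g i)) ->
  spanned S e (fun x => \sum_(i <- r | P i) c i * g i x).
Proof.
move=> H; elim: r => [|i r [a ha]].
  by exists (fun=> 0) => x _; rewrite big_nil big1// => k _; rewrite mul0r.
case: (boolP (P i)) => Pi; last first.
  by exists a => x Sx; rewrite big_cons (negPf Pi) ha.
have [b hb] := H i Pi; exists (fun k => c i * b k + a k) => x Sx.
rewrite big_cons Pi ha // hb // mulr_sumr -big_split /=.
by apply: eq_bigr => k _; rewrite mulrDl mulrA.
Qed.

Lemma spannedZ c g : spanned S e g -> spanned S e (fun x => c * g x).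
Proof.
move=> [a ha]; exists (fun k => c * a k) => x Sx.
by rewrite ha // mulr_sumr; apply: eq_bigr => k _; rewrite mulrA.
Qed.

Lemma spannedD g h : spanned S e g -> spanned S e h ->
  spanned S e (fun x => g x + h x).
Proof.
move=> [a ha] [b hb]; exists (fun k => a k + b k) => x Sx.
by rewrite ha // hb // -big_split; apply: eq_bigr => k _; rewrite mulrDl.
Qed.

Lemma spanned_basis k : spanned S e (e k).
Proof.
exists (fun j => (j == k)%:R) => x _.
rewrite (bigD1 k) //= eqxx mul1r big1 ?addr0 // => j /negPf ->.
by rewrite mul0r.
Qed.

Lemma relation_of_span (I : finType) (u : I -> T -> F) :
  (#|J| < #|I|)%N -> (forall i, spanned S e (u i)) ->
  exists c : I -> F, (exists i, c i != 0) /\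
    forall x, S x -> \sum_i c i * u i x = 0.
Proof.
move=> JI /fin_all_exists [a ha].
pose A : 'M[F]_(#|I|, #|J|) := \matrix_(i, j) a (enum_val i) (enum_val j).
have [v v0 vA] := lin_dep A JI.
exists (fun i => v ord0 (enum_rank i)); split.
  have /rV0Pn [i vi] := v0; exists (enum_val i).
  by rewrite enum_valK.
move=> x Sx.
transitivity (\sum_j (\sum_i v ord0 (enum_rank i) * a i j) * e j x).
  under eq_bigr do rewrite ha // mulr_sumr.
  rewrite exchange_big /=; apply: eq_bigr => j _.
  by rewrite mulr_suml; apply: eq_bigr => i _; rewrite mulrA.
apply: big1 => j _; apply/eqP; rewrite mulf_eq0; apply/orP; left; apply/eqP.
have /matrixP /(_ ord0 (enum_rank j)) := vA; rewrite !mxE => vA0.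
rewrite -[RHS]vA0 [RHS](reindex (@enum_rank I)) /=; last first.
  by exists enum_val => i _; rewrite ?enum_rankK ?enum_valK.
by apply: eq_bigr => i _; rewrite !mxE !enum_rankK.
Qed.

End Spanned.

(* The span of the polynomials of degree at most [M] grows like [c * M], while
   there are about [M' * K] monomials in [f], [g] of degree at most
   [D * M' + K]. *)
Lemma relation_count (F : fieldType) (T : Type) (S : T -> Prop)
    (f g : T -> F) (D K c c0 : nat) : (c * D <= K)%N ->
  (forall M, exists (J : finType) (e : J -> T -> F), (#|J| <= c * M + c0)%N /\
    forall i l, (D * i + l <= M)%N -> spanned S e (fun x => f x ^+ i * g x ^+ l))
  -> exists co : 'I_(c * K + c0).+1 -> 'I_K.+1 -> F,
    (exists i l, co i l != 0) /\
    forall x, S x -> \sum_i \sum_l co i l * (f x ^+ i * g x ^+ l) = 0.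
Proof.
(* With this [M'] the dimension is at most [c * (D * M' + K) + c0 <= K * M' + M'], less than the
   number [M'.+1 * K.+1] of monomials. *)
move=> cDK H; set M' := (c * K + c0)%N.
have [J [e [Jle span]]] := H (D * M' + K)%N.
pose u (p : 'I_M'.+1 * 'I_K.+1) (x : T) := f x ^+ p.1 * g x ^+ p.2.
have [||co [[[i l] /= nz] Hco]] := @relation_of_span _ _ S _ e _ u.
- rewrite card_prod !card_ord; apply: leq_ltn_trans Jle _; rewrite /M'; nia.
- move=> [i l]; apply: span => /=; have := ltn_ord i; have := ltn_ord l; nia.
exists (fun i l => co (i, l)); split; first by exists i, l.
move=> x Sx; rewrite -[RHS](Hco x Sx) pair_bigA /=.
by apply: eq_big => [|[i' l']].
Qed.

Section Degree.
Variables (F : fieldType) (n : nat).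
Implicit Types p q : mpoly n F.

Lemma msizeM_leS p q a b : (msize p <= a.+1)%N -> (msize q <= b.+1)%N ->
  (msize (p * q) <= (a + b).+1)%N.
Proof.
move=> pa qb; have [->|p0] := eqVneq p 0; first by rewrite mul0r msize0.
have [->|q0] := eqVneq q 0; first by rewrite mulr0 msize0.
rewrite msizeM // (leq_trans (_ : _ <= (a.+1 + b.+1).-1)%N) //.
  by rewrite -!subn1 leq_sub2r // leq_add.
by rewrite addSn addnS.
Qed.

Lemma msizeX_leS p a k : (msize p <= a.+1)%N ->
  (msize (p ^+ k) <= (a * k).+1)%N.
Proof.
move=> pa; elim: k => [|k IH]; first by rewrite expr0 msize1.
by rewrite exprS mulnS; exact: msizeM_leS.
Qed.

Lemma msizeD_leS p q a : (msize p <= a)%N -> (msize q <= a)%N ->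
  (msize (p + q) <= a)%N.
Proof.
by move=> pa qa; rewrite (leq_trans (msizeD_le _ _)) // geq_max pa.
Qed.

Lemma msize_sum_le (I : Type) (r : seq I) (P : pred I) (f : I -> mpoly n F) a :
  (forall i, P i -> (msize (f i) <= a)%N) ->
  (msize (\sum_(i <- r | P i) f i) <= a)%N.
Proof.
move=> H; elim/big_rec: _ => [|i p Pi pa]; first by rewrite msize0.
by rewrite msizeD_leS // H.
Qed.

Lemma msizeU (i : 'I_n) : msize (mpolyX F (mnm1 i)) = 2.
Proof. by rewrite msizeX mdeg1. Qed.

Lemma msize_le_supp p a : (forall m, m \in msupp p -> (mdeg m < a)%N) ->
  (msize p <= a)%N.
Proof.
move=> H; rewrite mmeasureE big_seq_cond; elim/big_ind: _ => //.
  by move=> x y xa ya; rewrite geq_max xa.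
by move=> m /andP[] /H.
Qed.

Lemma msize_mderiv p i : (msize (mderiv i p) <= (msize p).-1)%N.
Proof.
rewrite /mderiv big_seq_cond; apply: msize_sum_le => m /andP[mp _].
have [->|mi] := eqVneq (m i) 0%N; first by rewrite mul0r scale0r msize0.
apply: leq_trans (msizeZ_le _ _) _; rewrite msizeX.
have := msize_mdeg_lt mp.
suff : mdeg m = (mdeg (mnm_sub m (mnm1 i))).+1 by lia.
rewrite -[in LHS](@submK _ (mnm1 i) m) ?mdegD ?mdeg1 ?addn1 //.
by apply/mnm_lepP => j; rewrite mnm1E; case: eqP => // <-; rewrite lt0n.
Qed.

End Degree.

Section Monomials.
Variables (F : fieldType) (n : nat) (T : Type) (S : T -> Prop).
Variables (X : T -> 'I_n -> F) (J : finType) (e : J -> T -> F).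

Lemma spanned_mpoly M (p : mpoly n F) :
  (forall m : multinom n, (mdeg m <= M)%N ->
     spanned S e (fun x => meval (X x) (mpolyX F m))) ->
  (msize p <= M.+1)%N -> spanned S e (fun x => meval (X x) p).
Proof.
move=> H pM; apply: (@spanned_ext _ _ _ _ _ _ (fun x => \sum_(m <- msupp p |
  (mdeg m <= M)%N) mcoeff m p * meval (X x) (mpolyX F m))); last first.
  by apply: spanned_sum => m; apply: H.
move=> x _; rewrite {1}[p]mpolyE raddf_sum /= [LHS]big_seq [RHS]big_seq_cond.
apply: eq_big => m; last by rewrite mevalZ.
case: (boolP (m \in msupp p)) => //= /msize_mdeg_lt mp.
by apply/esym; rewrite -ltnS (leq_trans mp).
Qed.

Lemma spanned_pow M D (f : mpoly n F) j i l :
  (forall m : multinom n, (mdeg m <= M)%N ->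
     spanned S e (fun x => meval (X x) (mpolyX F m))) ->
  (msize f <= D.+1)%N -> (D * i + l <= M)%N ->
  spanned S e (fun x => meval (X x) f ^+ i * X x j ^+ l).
Proof.
move=> H fD ilM.
apply: (@spanned_ext _ _ _ _ _ _
  (fun x => meval (X x) (f ^+ i * mpolyX F (mnm1 j) ^+ l))).
  by move=> x _; rewrite mevalM !rmorphXn /= mevalXU.
apply: spanned_mpoly H _; apply: leq_trans (_ : (D * i + 1 * l).+1 <= _)%N.
  by apply: msizeM_leS; apply: msizeX_leS; rewrite ?msizeU.
by rewrite mul1n.
Qed.

End Monomials.

Section Relations.
Variables (F : fieldType) (n : nat) (T : Type) (S : T -> Prop).
Variables (X : T -> 'I_n -> F).

(** Only [K], the degree in [v], enters the final exponent; [M'] merely has to be the same for all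
    perturbations. *)
Definition relation_at (u v : T -> F) (M' K : nat) :=
  exists co : 'I_M'.+1 -> 'I_K.+1 -> F, (exists i l, co i l != 0) /\
    forall x, S x -> \sum_i \sum_l co i l * (u x ^+ i * v x ^+ l) = 0.

(* If [x_i ^ (2 * w)] can be traded for polynomials of lower degree in [x], at
   the price of a multiplier [lam] of weight [w], then monomials reduce to those
   with all exponents below [2 * w]. *)
Lemma relation_multiplier (lam : T -> F) w f D K j :
  (0 < w)%N -> (0 < n)%N ->
  (forall i, (exists c, forall x, S x -> X x i = c) \/
     exists p q : mpoly n F, [/\ (msize p <= 2 * w)%N, (msize q <= w.+1)%N &
       forall x, S x -> X x i ^+ (2 * w) =
                        meval (X x) p + lam x * meval (X x) q]) ->
  (msize f <= D.+1)%N -> (2 ^ n * w ^ n.-1 * D <= K)%N ->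
  relation_at (fun x => meval (X x) f) (fun x => X x j)
    (2 ^ n * w ^ n.-1 * K + (2 * w) ^ n) K.
Proof.
move=> w0 n0 H fD DK; apply: relation_count DK _ => M.
(* Normal forms: exponents of [x] below [2 * w], and powers of [lam] of weight at most [M]. *)
pose J : finType := ({ffun 'I_n -> 'I_(2 * w)} * 'I_(M %/ w).+1)%type.
pose e (k : J) x := (\prod_i X x i ^+ k.1 i) * lam x ^+ k.2.
exists J, e; split.
  rewrite card_prod card_ffun !card_ord.
  have -> : ((2 * w) ^ n = 2 ^ n * w ^ n.-1 * w)%N.
    by case: (n) n0 => // m _; rewrite /= expnMn [(w ^ m.+1)%N]expnSr mulnA.
  by rewrite mulnSr leq_add2r -mulnA leq_mul2l [(w * _)%N]mulnC leq_trunc_div orbT.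
(* The induction is on the degree in [x] alone: trading [x_i ^ (2 * w)] lowers it, while the total
   weight [mdeg m + w * b] stays at most [M]. *)
suff mon : forall N (m : multinom n) b, (mdeg m < N)%N -> (mdeg m + w * b <= M)%N ->
    spanned S e (fun x => meval (X x) (mpolyX F m) * lam x ^+ b).
  move=> i l ilM; apply: spanned_pow fD ilM => m mM.
  apply: (@spanned_ext _ _ _ _ _ _
    (fun x => meval (X x) (mpolyX F m) * lam x ^+ 0)).
    by move=> x _; rewrite expr0 mulr1.
  by apply: (mon (mdeg m).+1) => //; rewrite muln0 addn0.
elim=> // N IH m b mN mM.
case: (boolP [forall i, m i < 2 * w]%N) => [/forallP mw|/forallPn[i]].
  have bM : (b < (M %/ w).+1)%N by rewrite ltnS leq_divRL // mulnC; lia.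
  pose k : J := ([ffun i => Ordinal (mw i)], Ordinal bM).
  apply: spanned_ext (spanned_basis S e k) => x _ /=.
  rewrite /e /= mevalX; congr (_ * _).
  by apply: eq_bigr => i _; rewrite ffunE.
rewrite -leqNgt => wi.
have low (c : nat) : (0 < c <= m i)%N -> exists m' : multinom n,
    (mdeg m = mdeg m' + c)%N /\
    forall x, meval (X x) (mpolyX F m) = meval (X x) (mpolyX F m') * X x i ^+ c.
  move=> /andP[c0 ci]; exists (mnm_sub m (mnm_muln (mnm1 i) c)).
  have mE : m = mnm_add (mnm_sub m (mnm_muln (mnm1 i) c)) (mnm_muln (mnm1 i) c).
    rewrite submK //; apply/mnm_lepP => k; rewrite mulmnE mnm1E.
    by case: eqP => [<-|_]; rewrite ?mul1n ?mul0n.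
  split; first by rewrite {1}mE mdegD mdegMn mdeg1 mul1n.
  by move=> x; rewrite {1}mE mpolyXD mevalM -mpolyXn rmorphXn /= mevalXU.
case: (H i) => [[c Hc]|[p [q [pw qw Hpq]]]].
  have [|m' [mm' Hm']] := low 1%N; first by lia.
  apply: (@spanned_ext _ _ _ _ _ _
    (fun x => c * (meval (X x) (mpolyX F m') * lam x ^+ b))).
    by move=> x Sx; rewrite Hm' expr1 Hc //; ring.
  by apply/spannedZ/IH; lia.
have [|m' [mm' Hm']] := low (2 * w)%N; first by lia.
have mul (h : mpoly n F) (c : nat) :
    (forall m, m \in msupp h -> (mdeg m + mdeg m' < N)%N) ->
    (forall m, m \in msupp h -> (mdeg m + mdeg m' + w * c <= M)%N) ->
    spanned S e (fun x => meval (X x) h * (meval (X x) (mpolyX F m') * lam x ^+ c)).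
  move=> hN hM; apply: (@spanned_ext _ _ _ _ _ _ (fun x => \sum_(mu <- msupp h |
     mu \in msupp h) mcoeff mu h * (meval (X x) (mpolyX F (mnm_add mu m')) * lam x ^+ c))).
    move=> x _; rewrite -big_seq {1}[h]mpolyE raddf_sum /= mulr_suml.
    by apply: eq_bigr => mu _; rewrite mevalZ mpolyXD mevalM !mulrA.
  by apply: spanned_sum => mu hmu; apply: IH; rewrite mdegD ?hN ?hM.
apply: (@spanned_ext _ _ _ _ _ _ (fun x =>
  meval (X x) p * (meval (X x) (mpolyX F m') * lam x ^+ b) +
  meval (X x) q * (meval (X x) (mpolyX F m') * lam x ^+ b.+1))).
  by move=> x Sx; rewrite Hm' Hpq // exprS; ring.
apply: spannedD; apply: mul => mu /msize_mdeg_lt; nia.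
Qed.

(** In one variable the powers up to [M] span all polynomials of degree [M], whatever [S] is: the
    growth rate is 1. *)
Lemma relation_univariate f D K j : (n = 1)%N ->
  (msize f <= D.+1)%N -> (D <= K)%N ->
  relation_at (fun x => meval (X x) f) (fun x => X x j) (K + 1) K.
Proof.
move=> n1 fD DK; rewrite -{1}[K]mul1n; apply: relation_count (_ : 1 * D <= K)%N _.
  by rewrite mul1n.
move=> M; exists 'I_M.+1, (fun (k : 'I_M.+1) x => X x j ^+ k); split.
  by rewrite card_ord mul1n addn1.
move=> i l ilM; apply: spanned_pow fD ilM => m mM.
have jm : (m j < M.+1)%N by move: mM; rewrite mdegE (bigD1 j) //=; lia.
apply: spanned_ext (spanned_basis S _ (Ordinal jm)) => x _ /=.
rewrite mevalX (bigD1 j) //= big1 ?mulr1 // => k kj.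
by case/negP: kj; apply/eqP/val_inj; move: (ltn_ord j) (ltn_ord k) => /=; lia.
Qed.

End Relations.

(** Modulo [G], the monomials not divisible by its leading monomial [mu] span. Those of degree at
    most [M] lie on [mu ord0 + mu ord_max <= W] lines with at most [M + 1] monomials each, so a
    curve of degree [W] has growth rate [W]. *)
Lemma relation_plane (F : fieldType) (T : Type) (S : T -> Prop)
    (X : T -> 'I_2 -> F) (G f : mpoly 2 F) D K W j :
  G != 0 -> (msize G <= W.+1)%N ->
  (forall x, S x -> meval (X x) G = 0) ->
  (msize f <= D.+1)%N -> (W * D <= K)%N ->
  relation_at S (fun x => meval (X x) f) (fun x => X x j) (W * K + W) K.
Proof.
move=> G0 GW HG fD DK; apply: relation_count DK _ => M.
set mu := mlead G.
have muW : (mu ord0 + mu ord_max <= W)%N.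
  move: GW; rewrite -mlead_deg // ltnS mdegE -/mu.
  by rewrite big_ord_recl big_ord1 /= (_ : lift _ _ = ord_max) //; apply/val_inj.
pose J : finType := ('I_W * 'I_M.+1)%type.
(* First indices below [mu ord0] fix the exponent of the first variable; the others, shifted by
   [mu ord0], fix that of the second. *)
pose e (k : J) x := if (k.1 < mu ord0)%N then X x ord0 ^+ k.1 * X x ord_max ^+ k.2
  else X x ord0 ^+ k.2 * X x ord_max ^+ (k.1 - mu ord0).
exists J, e; split; first by rewrite card_prod !card_ord mulnS addnC.
move=> i l ilM; apply: spanned_pow fD ilM => m mM.
have : (msize (mpolyX F m) <= M.+1)%N by rewrite msizeX ltnS.
elim/mleadrect: (mpolyX F m) => {m mM} p IH pM.
have [->|p0] := eqVneq p 0.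
  by exists (fun=> 0) => x _; rewrite meval0 big1 // => k _; rewrite mul0r.
set m := mlead p.
have mM : (mdeg m <= M)%N by rewrite -ltnS mlead_deg.
(* Cancelling the leading term of [p] by a multiple of [q] leaves a smaller leading monomial; the
   order refines the degree, so the bound [M] persists. *)
have key (q : mpoly 2 F) (g : T -> F) : q != 0 -> mlead q = m ->
    (forall x, S x -> meval (X x) q = g x) -> spanned S e g ->
    spanned S e (fun x => meval (X x) p).
  move=> q0 qm qg sg.
  set r := p - (mleadc p / mleadc q) *: q.
  have rM : r = 0 \/ (mlead r < m)%O.
    have [r0|r0] := eqVneq r 0; [by left|right].
    have le : (mlead r <= m)%O.
      rewrite (le_trans (mleadB_le _ _)) // leUx /m lexx /=.
      by rewrite (le_trans (mleadZ_le _ _)) // qm.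
    rewrite lt_neqAle le andbT; apply/eqP => rm.
    have := mlead_supp r0; rewrite rm mcoeff_msupp mcoeffB mcoeffZ.
    by rewrite -{2}qm divfK ?subrr ?eqxx // mleadc_eq0.
  have sr : spanned S e (fun x => meval (X x) r).
    case: rM => [->|rm].
      by exists (fun=> 0) => x _; rewrite meval0 big1 // => k _; rewrite mul0r.
    apply: IH => //; have [->|r0] := eqVneq r 0; first by rewrite msize0.
    by rewrite -mlead_deg // ltnS (leq_trans (lemc_mdeg (ltW rm))).
  apply: (@spanned_ext _ _ _ _ _ _ (fun x => meval (X x) r +
     (mleadc p / mleadc q) * g x)).
    by move=> x Sx; rewrite mevalB mevalZ qg //; ring.
  by apply: spannedD => //; apply: spannedZ.
have m01 : mdeg m = (m ord0 + m ord_max)%N.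
  rewrite mdegE big_ord_recl big_ord1 /= (_ : lift _ _ = ord_max) //.
  exact/val_inj.
have Xm x : meval (X x) (mpolyX F m) = X x ord0 ^+ m ord0 * X x ord_max ^+ m ord_max.
  rewrite mevalX big_ord_recl big_ord1 /= (_ : lift _ _ = ord_max) //.
  exact/val_inj.
have Xm0 : mpolyX F m != 0 by rewrite -msize_poly_eq0 msizeX.
case: (ltnP (m ord0) (mu ord0)) => m0.
  have k1 : (m ord0 < W)%N by lia.
  have k2 : (m ord_max < M.+1)%N by lia.
  apply: (key (mpolyX F m) _ Xm0 (mleadXm _ _)) => [x _|]; first exact: Xm.
  apply: spanned_ext (spanned_basis S e (Ordinal k1, Ordinal k2)) => x _.
  by rewrite /e /= m0.
case: (ltnP (m ord_max) (mu ord_max)) => m1.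
  have k1 : (m ord_max + mu ord0 < W)%N by lia.
  have k2 : (m ord0 < M.+1)%N by lia.
  apply: (key (mpolyX F m) _ Xm0 (mleadXm _ _)) => [x _|]; first exact: Xm.
  apply: spanned_ext (spanned_basis S e (Ordinal k1, Ordinal k2)) => x _.
  by rewrite /e /= ltnNge leq_addl /= addnK.
have mum : mnm_add (mnm_sub m mu) mu = m.
  rewrite submK //; apply/mnm_lepP => k.
  case: k => [[|[|//]] k]; first by rewrite (_ : Ordinal k = ord0) //; apply/val_inj.
  by rewrite (_ : Ordinal k = ord_max) //; apply/val_inj.
(* Now [mu] divides [m], and the multiple of [G] with leading monomial [m] vanishes on [S]. *)
apply: (key (mpolyX F (mnm_sub m mu) * G) (fun=> 0)).
- by rewrite mulf_neq0 // -msize_poly_eq0 msizeX.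
- by rewrite mleadM ?mleadXm // -msize_poly_eq0 msizeX.
- by move=> x Sx; rewrite mevalM HG // mulr0.
- by exists (fun=> 0) => x _; rewrite big1 // => k _; rewrite mul0r.
Qed.

(** * Perturbed Lagrange equations for the squared gradient *)

Definition sqgrad (F : fieldType) n (f : mpoly n F) : mpoly n F :=
  \sum_k mderiv k f ^+ 2.

(* The equations satisfied in the relative interior of the face of a box,
   described by [sigma] (fixed coordinates), by the critical points of
   [sqgrad f + s * \sum_i x_i ^ (2w+1) / (2w+1)] on level sets of [f]. *)
Definition critical (F : fieldType) n (f : mpoly n F) (w : nat) (s : F)
    (sigma : 'I_n -> option F) (xl : ('I_n -> F) * F) : Prop :=
  forall i, if sigma i is Some c then xl.1 i = c else
    meval xl.1 (mderiv i (sqgrad f)) + s * xl.1 i ^+ (2 * w) =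
    xl.2 * meval xl.1 (mderiv i f).

Section GenericRelation.
Variable F : realFieldType.

Lemma msize_mderivS n (f : mpoly n F) i w : (msize f <= w.+1)%N ->
  (msize (mderiv i f) <= w)%N.
Proof.
by move=> fw; apply: leq_trans (msize_mderiv _ _) _; case: (msize f) fw.
Qed.

Lemma msize_sqgrad n (f : mpoly n F) w : (msize f <= w.+2)%N ->
  (msize (sqgrad f) <= (2 * w).+1)%N.
Proof.
move=> fw; apply: msize_sum_le => k _; rewrite mulnC; apply: msizeX_leS.
exact: msize_mderivS.
Qed.

Lemma mderiv_eq0_const n (f : mpoly n F) :
  (forall i, mderiv i f = 0) -> (msize f <= 1)%N.
Proof.
move=> H; apply: msize_le_supp => m mf; rewrite ltnS leqn0 mdeg_eq0.
apply: contraLR mf => m0; rewrite -mcoeff_eq0.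
have [i mi] : exists i, m i != 0%N.
  apply/existsP; apply: contraR m0 => /existsPn mi.
  by apply/eqP/mnmP => i; rewrite mnm0E; apply/eqP; have := mi i; rewrite negbK.
have mE : mnm_add (mnm_sub m (mnm1 i)) (mnm1 i) = m.
  rewrite submK //; apply/mnm_lepP => j; rewrite mnm1E.
  by case: eqP => // <-; rewrite lt0n.
have := mcoeff_deriv i (mnm_sub m (mnm1 i)) f.
by rewrite mE H mcoeff0 => /esym/eqP; rewrite mulrn_eq0.
Qed.

(** Some monomial on the left has exponent at least [a] in the [i]-th variable, whereas on the right
    this variable occurs only in [q], of degree below [a]. *)
Lemma monomial_multiples_differ n (p q : mpoly n F) (i j : 'I_n) a :
  i != j -> p != 0 -> (msize q <= a)%N ->
  mpolyX F (mnm1 i) ^+ a * p <> mpolyX F (mnm1 j) ^+ a * q.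
Proof.
move=> ij p0 qa E.
pose mu := mnm_add (mnm_muln (mnm1 i) a) (mlead p).
have : mcoeff mu (mpolyX F (mnm1 i) ^+ a * p) != 0.
  by rewrite /mu mpolyXn mulrC mcoeffMX mleadc_eq0.
rewrite E mpolyXn mulrC -mcoeff_msupp (perm_mem (msuppMX _ _)).
move=> /mapP[m mq /mnmP /(_ i)]; rewrite !mnmDE !mulmnE !mnm1E eqxx.
rewrite eq_sym (negPf ij) mul0n add0n mul1n => mi.
have := leq_trans (msize_mdeg_lt mq) qa.
by rewrite mdegE (bigD1 i) //= -mi; lia.
Qed.

(** [M'] comes before [eta], so that the relations for all [s] have coefficients in one
    finite-dimensional space, where limits can be taken. With [W = D - 1], the growth rate is 1 for
    [n = 1], [3 * W] for [n = 2] and [2 ^ n * W ^ (n - 1)] beyond; times [D] it has to be at most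
    [K]. *)
Lemma generic_relation n (f : mpoly n F) D : (0 < n)%N -> (1 < D)%N ->
  (1 < msize f)%N -> (msize f <= D.+1)%N ->
  let K := (D * (3 * D - 3) ^ (n - 1))%N in
  exists M', forall eta : F, 0 < eta -> exists2 s, 0 < s < eta &
    forall sigma j, relation_at (critical f D.-1 s sigma)
      (fun xl => meval xl.1 f) (fun xl => xl.1 j) M' K.
Proof.
case: D => [|[|w]] // n0 _ f1 fD; set D := w.+2; set K := (_ * _)%N.
rewrite /= -/D; pose W := w.+1.
have half (eta : F) k : 0 < eta -> 0 < eta / k.+2%:R < eta.
  move=> eta0; rewrite divr_gt0 // ltr_pdivrMr //.
  by rewrite ltr_pMr // ltr1n.
have fW : (msize f <= W.+2)%N by [].
have gradW k : (msize (mderiv k f) <= W.+1)%N.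
  exact: msize_mderivS.
have phiW k : (msize (mderiv k (sqgrad f)) <= 2 * W)%N.
  exact/msize_mderivS/msize_sqgrad.
have [n1|n1] := eqVneq n 1%N.
  exists (K + 1)%N => eta eta0; exists (eta / 2%:R); first exact: (half _ 0%N).
  move=> sigma j; apply: (@relation_univariate _ _ _ _ (fun xl => xl.1) _ _ _ _ n1 fD).
  by rewrite /K n1 subnn expn0 muln1.
(* The last case needs [2 ^ n <= 3 ^ (n - 1)], which fails for [n = 2]; there
   the critical points lie on a curve of degree [3 * W]. *)
have [n2|n2] := eqVneq n 2%N.
  clear n0 n1; subst n; exists ((3 * W) * K + 3 * W)%N => eta eta0.
  pose i0 : 'I_2 := ord0; pose i1 : 'I_2 := ord_max.
  (* [G s] below is the minor that eliminates the multiplier. It is affine in [s] with slope [H],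
     so, [H] being nonzero, it vanishes for at most one [s]. *)
  pose H := mpolyX F (mnm1 i0) ^+ (2 * W) * mderiv i1 f -
            mpolyX F (mnm1 i1) ^+ (2 * W) * mderiv i0 f.
  have H0 : H != 0.
    rewrite subr_eq0; apply/eqP; have [d1|d1] := eqVneq (mderiv i1 f) 0.
      have d0 : mderiv i0 f != 0.
        apply/eqP => d0; move: f1; rewrite ltnNge mderiv_eq0_const // => -[[|[|//]] k].
          by rewrite (_ : Ordinal k = i0) //; apply/val_inj.
        by rewrite (_ : Ordinal k = i1) //; apply/val_inj.
      by move/esym; apply: monomial_multiples_differ => //; rewrite d1 msize0.
    apply: monomial_multiples_differ => //.
    by apply: leq_trans (gradW _) _; rewrite /W; lia.
  pose G s := (mderiv i0 (sqgrad f) + s *: mpolyX F (mnm1 i0) ^+ (2 * W)) * mderiv i1 f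
    - (mderiv i1 (sqgrad f) + s *: mpolyX F (mnm1 i1) ^+ (2 * W)) * mderiv i0 f.
  have [s s0 Gs] : exists2 s, 0 < s < eta & G s != 0.
    have [G0|] := eqVneq (G (eta / 2%:R)) 0; last first.
      by exists (eta / 2%:R) => //; exact: (half _ 0%N).
    exists (eta / 3%:R); first exact: (half _ 1%N).
    apply/eqP => G1.
    have diff (p q a b u v : mpoly _ F) (c d : F) : (c - d) *: (u * p - v * q) =
        (a + c *: u) * p - (b + c *: v) * q - ((a + d *: u) * p - (b + d *: v) * q).
      by rewrite -!mul_mpolyC mpolyCB; ring.
    have : (eta / 2%:R - eta / 3%:R) *: H = G (eta / 2%:R) - G (eta / 3%:R).
      exact: diff.
    rewrite G0 G1 subrr => /eqP; rewrite scaler_eq0 (negPf H0) orbF.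
    by apply/negP; lra.
  exists s => // sigma j.
  have Kle : (3 * W * D <= K)%N.
    by rewrite /K /D /W (_ : (2 - 1 = 1)%N) // expn1; lia.
  (* When a coordinate is fixed, the line [x_i = c] takes the place of the curve; its degree 1 is at
     most [3 * W]. *)
  have face i c : sigma i = Some c -> relation_at (critical f W s sigma)
      (fun xl => meval xl.1 f) (fun xl => xl.1 j) (3 * W * K + 3 * W) K.
    move=> sc.
    apply: (@relation_plane _ _ _ (fun xl => xl.1) (mpolyX F (mnm1 i) - mpolyC _ c)) fD Kle.
    - rewrite -msize_poly_eq0; apply/eqP => E.
      have : mcoeff (mnm1 i) (mpolyX F (mnm1 i) - mpolyC _ c) = 0.
        by apply/eqP; rewrite mcoeff_eq0; move/eqP: E; rewrite msize_msupp0 => /eqP ->.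
      rewrite mcoeffB mcoeffX eqxx mcoeffC mnm1_eq0 mulr0 subr0.
      by apply/eqP; rewrite oner_eq0.
    - apply: msizeD_leS; first by rewrite msizeU /W; lia.
      rewrite msizeN msizeC; case: eqP => // _; rewrite /W; lia.
    - by move=> xl /(_ i); rewrite sc mevalB mevalXU mevalC => ->; rewrite subrr.
  case E0: (sigma i0) => [c|]; first exact: face E0.
  case E1: (sigma i1) => [c|]; first exact: face E1.
  apply: (@relation_plane _ _ _ (fun xl => xl.1) (G s)) fD Kle => //.
    have term i k : (msize ((mderiv i (sqgrad f) + s *: mpolyX F (mnm1 i) ^+ (2 * W)) *
        mderiv k f) <= (3 * W).+1)%N.
      apply: leq_trans (_ : (2 * W + W).+1 <= _)%N; last by lia.
      apply: msizeM_leS (gradW _); apply: msizeD_leS.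
        by rewrite (leq_trans (phiW _)).
      apply: leq_trans (msizeZ_le _ _) _; rewrite -{2}[(2 * W)%N]mul1n.
      by apply: msizeX_leS; rewrite msizeU.
    by rewrite msizeD_leS // msizeN term.
  move=> xl xlc; have := xlc i0; have := xlc i1; rewrite E0 E1 /G.
  have eval (p q : mpoly _ F) i : meval xl.1 ((p + s *: mpolyX F (mnm1 i) ^+ (2 * W)) * q)
      = (meval xl.1 p + s * xl.1 i ^+ (2 * W)) * meval xl.1 q.
    by rewrite mevalM mevalD mevalZ rmorphXn /= mevalXU.
  by rewrite mevalB 2!eval => -> ->; rewrite mulrAC subrr.
have n3 : (2 < n)%N by case: (n) n0 n1 n2 => [|[|[|]]].
exists (2 ^ n * W ^ n.-1 * K + (2 * W) ^ n)%N => eta eta0.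
exists (eta / 2%:R); first exact: (half _ 0%N).
have := half _ 0%N eta0; set s := eta / _ => /andP[s0 _] sigma j.
apply: (@relation_multiplier _ _ _ _ (fun xl => xl.1) snd) fD _ => //.
  move=> i; case E: (sigma i) => [c|].
    by left; exists c => xl /(_ i); rewrite E.
  (* The perturbed equation is solved for [x_i ^ (2 * W)], whose exponent is one more than the
     degree bound for the derivatives of [sqgrad f]. *)
  right; exists (- s^-1 *: mderiv i (sqgrad f)), (s^-1 *: mderiv i f).
  split; rewrite ?(leq_trans (msizeZ_le _ _)) //.
  move=> xl /(_ i); rewrite E !mevalZ => /(congr1 (fun y => s^-1 * y)) H.
  rewrite mulrDr mulrA mulVf ?gt_eqF // mul1r in H.
  by rewrite mulNr addrC mulrCA -H addrAC subrr add0r.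
rewrite /K mulnC leq_pmul2l // (_ : 3 * D - 3 = 3 * W)%N; last by rewrite /D /W; lia.
rewrite subn1 expnMn leq_mul2r; apply/orP; right.
case: (n) n3 => [|[|[|m]]] // _ /=; elim: m => // m IH.
rewrite expnS [(3 ^ _)%N]expnS; move: IH; lia.
Qed.

End GenericRelation.

(** * Sup norm, limits and Taylor bounds for polynomials *)

Section SupNorm.
Variables (R : realType) (n : nat).
Implicit Types x y : 'rV[R]_n.

Lemma sup_norm_ge x i : `|x ord0 i| <= `|x|.
Proof.
rewrite [leRHS]mx_normrE.
exact: (le_bigmax 0 (fun ij : 'I_1 * 'I_n => `|x ij.1 ij.2|) (ord0, i)).
Qed.

Lemma sup_norm_le x c : 0 <= c -> (forall i, `|x ord0 i| <= c) -> `|x| <= c.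
Proof.
move=> c0 H; rewrite [leLHS]mx_normrE; apply: bigmax_le => // -[i j] _ /=.
by rewrite [i]ord1.
Qed.

End SupNorm.

Lemma cvg_sumr (R : realType) (T : Type) (F : set_system T) (FF : Filter F)
    (I : Type) (r : seq I) (u : I -> T -> R) (l : I -> R) :
  (forall i, u i t @[t --> F] --> l i) ->
  \sum_(i <- r) u i t @[t --> F] --> \sum_(i <- r) l i.
Proof.
move=> ul; elim: r => [|i r IH].
  by rewrite big_nil; under eq_fun do rewrite big_nil; exact: cvg_cst.
by rewrite big_cons; under eq_fun do rewrite big_cons; exact: cvgD.
Qed.

Lemma cvg_expr (R : realType) (T : Type) (F : set_system T) (FF : Filter F)
    (u : T -> R) (l : R) k :
  u t @[t --> F] --> l -> u t ^+ k @[t --> F] --> l ^+ k.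
Proof.
move=> ul; elim: k => [|k IH].
  by rewrite expr0; under eq_fun do rewrite expr0; exact: cvg_cst.
by rewrite exprS; under eq_fun do rewrite exprS; exact: cvgM.
Qed.

Section Evaluation.
Variables (R : realType) (n : nat).
Implicit Types (p q : mpoly n R) (x y : 'rV[R]_n).

Lemma mpoly_algebra_ind (P : mpoly n R -> Prop) :
  (forall c, P (mpolyC n c)) -> (forall i, P (mpolyX R (mnm1 i))) ->
  (forall p q, P p -> P q -> P (p + q)) ->
  (forall p q, P p -> P q -> P (p * q)) -> forall p, P p.
Proof.
move=> PC PX PD PM; elim/mpolyind => [|c m p _ _ Pp].
  by rewrite -[0](mpolyC0 n R); exact: PC.
apply: (PD) => //; rewrite -mul_mpolyC; apply: (PM) => //.
rewrite mpolyXE_id; apply: (big_ind P) => [||i _]; [|exact: PM|].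
  by rewrite -[1](mpolyC1 n R); exact: PC.
elim: (m i) => [|k IH].
  by rewrite expr0 -[1](mpolyC1 n R); exact: PC.
by rewrite exprS; apply: PM.
Qed.

Lemma pevalC c x : peval (mpolyC n c) x = c. Proof. exact: mevalC. Qed.
Lemma pevalX i x : peval (mpolyX R (mnm1 i)) x = x ord0 i.
Proof. exact: mevalXU. Qed.
Lemma pevalD p q x : peval (p + q) x = peval p x + peval q x.
Proof. exact: mevalD. Qed.
Lemma pevalM p q x : peval (p * q) x = peval p x * peval q x.
Proof. exact: mevalM. Qed.

Lemma meval_cvg (T : Type) (F : set_system T) (FF : Filter F) p
    (u : T -> 'I_n -> R) (l : 'I_n -> R) :
  (forall i, u t i @[t --> F] --> l i) ->
  meval (u t) p @[t --> F] --> meval l p.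
Proof.
move=> ul; elim/mpoly_algebra_ind: p => [c|i|p q pl ql|p q pl ql].
- by rewrite mevalC; under eq_fun do rewrite mevalC; exact: cvg_cst.
- by rewrite mevalXU; under eq_fun do rewrite mevalXU; exact: ul.
- by rewrite mevalD; under eq_fun do rewrite mevalD; exact: cvgD.
- by rewrite mevalM; under eq_fun do rewrite mevalM; exact: cvgM.
Qed.

Lemma coord_cvg (T : Type) (F : set_system T) (FF : Filter F)
    (u : T -> 'rV[R]_n) (l : 'rV[R]_n) i :
  u t @[t --> F] --> l -> u t ord0 i @[t --> F] --> l ord0 i.
Proof.
move=> ul; apply: (@cvg_comp _ _ _ u (fun M : 'rV[R]_n => M ord0 i) _ _ _ ul).
exact: coord_continuous.
Qed.

Lemma peval_cvg (T : Type) (F : set_system T) (FF : Filter F) p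
    (u : T -> 'rV[R]_n) (l : 'rV[R]_n) :
  u t @[t --> F] --> l -> peval p (u t) @[t --> F] --> peval p l.
Proof. by move=> ul; apply: meval_cvg => i; exact: coord_cvg. Qed.

Lemma peval_continuous p : continuous (peval p).
Proof. by move=> x; exact: (@peval_cvg _ (nbhs x) _ p id x (@cvg_id _ _)). Qed.

Definition gradient_form p x y := \sum_i peval (mderiv i p) x * y ord0 i.

Lemma peval_taylor p (rho : R) : exists2 B : R, 0 <= B & forall x y,
  (forall i, `|x ord0 i| <= rho) -> (forall i, `|y ord0 i| <= rho) ->
  [/\ `|peval p x| <= B, `|peval p y - peval p x| <= B * `|y - x| &
  `|peval p y - peval p x - gradient_form p x (y - x)| <= B * `|y - x| ^+ 2].
Proof.
(* The bound on the gradient form is added for the sake of the product case of the induction. *)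
suff [B B0 HB] : exists2 B : R, 0 <= B & forall x y,
    (forall i, `|x ord0 i| <= rho) -> (forall i, `|y ord0 i| <= rho) ->
    [/\ `|peval p x| <= B, `|peval p y - peval p x| <= B * `|y - x|,
    `|gradient_form p x (y - x)| <= B * `|y - x| &
    `|peval p y - peval p x - gradient_form p x (y - x)| <= B * `|y - x| ^+ 2].
  by exists B => // x y /HB{}HB /HB[].
elim/mpoly_algebra_ind: p => [c|i|p q [B B0 HB] [C C0 HC]|p q [B B0 HB] [C C0 HC]].
- exists `|c| => // x y _ _; rewrite !pevalC subrr /gradient_form.
  by rewrite big1 ?subrr ?normr0 ?mulr_ge0 // => i _; rewrite mderivC /peval meval0 mul0r.
- have g x h : gradient_form (mpolyX R (mnm1 i)) x h = h ord0 i.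
    rewrite /gradient_form (bigD1 i) //= big1 => [|j ji];
      rewrite mderivX mnm1E ?eqxx ?[i == j]eq_sym ?(negPf ji) /peval ?scale0r ?meval0 ?mul0r //.
    rewrite scale1r (_ : mnm_sub _ _ = mnm0) ?mpolyX0 ?meval1 ?mul1r ?addr0 //.
    by apply/mnmP => k; rewrite mnmBE mnm0E subnn.
  exists (`|rho| + 1); first by rewrite addr_ge0.
  move=> x y xr yr; rewrite !pevalX g !mxE subrr normr0.
  have := sup_norm_ge (y - x) i; rewrite !mxE => h.
  have h1 : `|y ord0 i - x ord0 i| <= (`|rho| + 1) * `|y - x|.
    by rewrite (le_trans h) // ler_peMl // lerDr.
  split=> //; by rewrite (le_trans (xr i)) // (le_trans (ler_norm _)) // lerDl.
- exists (B + C) => [|x y xr yr]; first exact: addr_ge0.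
  have [b1 b2 b3 b4] := HB x y xr yr; have [c1 c2 c3 c4] := HC x y xr yr.
  have gD h : gradient_form (p + q) x h = gradient_form p x h + gradient_form q x h.
    by rewrite -big_split; apply: eq_bigr => i _; rewrite mderivD pevalD mulrDl.
  rewrite !pevalD gD !mulrDl; split.
  + exact: le_trans (ler_normD _ _) (lerD _ _).
  + by rewrite opprD addrACA (le_trans (ler_normD _ _)) // lerD.
  + exact: le_trans (ler_normD _ _) (lerD _ _).
    rewrite (_ : _ + _ = (peval p y - peval p x - gradient_form p x (y - x)) +
      (peval q y - peval q x - gradient_form q x (y - x))); last by ring.
    exact: le_trans (ler_normD _ _) (lerD _ _).
- have [B1 C1] : 0 <= B * C /\ 0 <= 3 * (B * C).
    by rewrite !mulr_ge0.
  exists (3 * (B * C)) => // x y xr yr.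
  have [b1 b2 b3 b4] := HB x y xr yr; have [c1 c2 c3 c4] := HC x y xr yr.
  have [c1' _ _ _] := HC y x yr xr.
  have gM h : gradient_form (p * q) x h =
      peval p x * gradient_form q x h + gradient_form p x h * peval q x.
    rewrite /gradient_form mulr_sumr mulr_suml -big_split; apply: eq_bigr => i _.
    by rewrite mderivM pevalD !pevalM /=; ring.
  have nn := normr_ge0 (y - x).
  have mm (a b A D : R) : `|a| <= A -> `|b| <= D -> `|a * b| <= A * D.
    by move=> aA bD; rewrite normrM ler_pM.
  rewrite !pevalM gM; move: b1 b2 b3 b4 c1 c2 c3 c4 c1' nn.
  move: (peval p x) (peval q x) (peval p y) (peval q y) (gradient_form p x (y - x))
    (gradient_form q x (y - x)) `|y - x| => P Q P' Q' G H h b1 b2 b3 b4 c1 c2 c3 c4 c1' nn.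
  have BCh : 0 <= B * C * h by rewrite mulr_ge0.
  have BChh : 0 <= B * C * h ^+ 2 by rewrite mulr_ge0 ?sqr_ge0.
  split.
  + have := mm _ _ _ _ b1 c1; lra.
  + rewrite (_ : _ - _ = P * (Q' - Q) + (P' - P) * Q'); last by ring.
    apply: le_trans (ler_normD _ _) _.
    have := mm _ _ _ _ b1 c2; have := mm _ _ _ _ b2 c1'; lra.
  + apply: le_trans (ler_normD _ _) _.
    have := mm _ _ _ _ b1 c3; have := mm _ _ _ _ b3 c1; lra.
  + rewrite (_ : _ - _ = P * (Q' - Q - H) + (P' - P - G) * Q' + G * (Q' - Q)); last by ring.
    apply: le_trans (ler_normD _ _) _.
    have := ler_normD (P * (Q' - Q - H)) ((P' - P - G) * Q').
    have := mm _ _ _ _ b1 c4; have := mm _ _ _ _ b4 c1'; have := mm _ _ _ _ b3 c2.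
    rewrite (_ : B * h * (C * h) = B * C * h ^+ 2); last by ring.
    lra.
Qed.

End Evaluation.

(** * Points of least gradient *)

(** Dividing by the lowest power of [t] that occurs keeps the section at [t = 0] nonzero, at the
    price of assuming [t != 0]. The outer variable of [P] is the coordinate [x], the inner one the
    level [t]. *)
Lemma bipoly_of_relation (R : realType) M K (c : 'I_M.+1 -> 'I_K.+1 -> R) :
  (exists i l, c i l != 0) ->
  exists P : {poly {poly R}}, [/\ (size P <= K.+1)%N,
    map_poly (horner_eval 0) P != 0 &
    forall t x, t != 0 -> \sum_i \sum_l c i l * (t ^+ i * x ^+ l) = 0 ->
      P.[x%:P].[t] = 0].
Proof.
move=> [i1 [l1 c1]].
have [i0 /existsP[l0 c0] imin] := @arg_minnP _ i1
  (fun i => [exists l, c i l != 0]) (fun i => i : nat)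
  (introT existsP (ex_intro _ l1 c1)).
pose Q l : {poly R} := \sum_(i : 'I_M.+1 | (i0 <= i)%N) (c i l)%:P * 'X^(i - i0).
exists (\poly_(l < K.+1) Q (inord l)); split; first exact: size_poly.
  have Q0 : (Q l0).[0] = c i0 l0.
    rewrite /Q horner_sum (bigD1 i0) //= subnn expr0 mulr1 hornerC big1 ?addr0 //.
    move=> i /andP[ii0 ne]; rewrite hornerM hornerXn expr0n subn_eq0 leqNgt.
    by rewrite ltn_neqAle ii0 andbT eq_sym ne mulr0.
  apply/eqP => /(congr1 (fun p : {poly R} => p`_l0)).
  rewrite coef_map coef_poly ltn_ord inord_val coef0 => E.
  by move/eqP: c0; apply; rewrite -Q0.
move=> t x t0 H; apply/eqP; rewrite -(mulrI_eq0 _ (mulfI (expf_neq0 i0 t0))) -[X in _ == X]H.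
rewrite horner_poly horner_sum mulr_sumr exchange_big /=.
apply/eqP; apply: eq_bigr => l _.
rewrite inord_val hornerM -rmorphXn /= hornerC /Q horner_sum mulr_suml mulr_sumr.
rewrite [RHS](bigID (fun i : 'I_M.+1 => (i0 <= i)%N)) /= [X in _ = _ + X]big1 ?addr0.
  apply: eq_bigr => i ii0; rewrite hornerM hornerC hornerXn -{2}(subnKC ii0) exprD.
  by ring.
move=> i ii0; have [|ci] := eqVneq (c i l) 0; first by move=> ->; rewrite mul0r.
by rewrite (imin i) // in ii0; apply/existsP; exists l.
Qed.

(** * Limits along ultrafilters and minima on boxes *)

Section Ultrafilter.
Variables (T : Type) (U : set_system T).
Hypothesis UU : UltraFilter U.

(** Ultrafilters replace passing to subsequences: they freeze data with finitely many values, such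
    as a face or a branch, and make all bounded quantities converge at once. *)
Lemma ultra_finite (I : finType) (g : T -> I) : exists i, U [set k | g k = i].
Proof.
apply: contrapT => /forallNP H.
have : U [set k | forall i, g k <> i].
  apply: filter_forall => i.
  by have [/H//|] := in_ultra_setVsetC [set k | g k = i] UU.
by move=> /filter_ex[k /(_ (g k))].
Qed.

Lemma ultra_bounded_cvg (R : realType) (u : T -> R) (B : R) :
  U [set k | `|u k| <= B] -> exists l : R, u k @[k --> U] --> l.
Proof.
move=> uB; have cB := @segment_compact R (- B) B.
have [|l [_ lc]] := cB (u @ U) _.
  by move: uB; apply: (@filterS _ U) => k /=; rewrite in_itv /= -ler_norml.
exists l => V lV; rewrite /fmap /=.
have [//|UV] := in_ultra_setVsetC (u @^-1` V) UU.
by have [y []] := lc (~` V) V UV lV.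
Qed.

End Ultrafilter.

Lemma box_compact (R : realType) n (rho : R) :
  compact [set x : 'rV[R]_n | forall i, `|x ord0 i| <= rho].
Proof.
have := @rV_compact R n (fun=> `[- rho, rho]%classic) (fun=> @segment_compact R _ _).
by congr compact; apply/seteqP; split=> x /= H i; have := H i; rewrite /= in_itv /= -ler_norml.
Qed.

Lemma box_minimum (R : realType) n (rho : R) (p : mpoly n R) : 0 <= rho ->
  exists2 x : 'rV[R]_n, forall i, `|x ord0 i| <= rho &
    forall y : 'rV[R]_n, (forall i, `|y ord0 i| <= rho) -> peval p x <= peval p y.
Proof.
move=> rho0; have [||x xB H] := @EVT_min_rV R n (peval p) _ _ (@box_compact R n rho).
- by exists 0 => i /=; rewrite mxE normr0.
- exact/continuous_subspaceT/peval_continuous.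
by exists x => [|y yB]; [move/set_mem: xB|apply: H; apply/mem_set].
Qed.

Lemma box_minimum_mderiv (R : realType) n (rho : R) (p : mpoly n R) (x : 'rV[R]_n) i :
  (forall i, `|x ord0 i| <= rho) ->
  (forall y : 'rV[R]_n, (forall i, `|y ord0 i| <= rho) -> peval p x <= peval p y) ->
  `|x ord0 i| < rho -> peval (mderiv i p) x = 0.
Proof.
move=> xB xmin xi; have [B B0 HB] := peval_taylor p rho.
set g := peval _ x; apply/eqP/negPn/negP => g0.
have gg : 0 < `|g| by rewrite normr_gt0.
(* The first bound keeps the step inside the box, the second makes the quadratic remainder at most
   half of the first-order gain. *)
pose h := Num.min (rho - `|x ord0 i|) (`|g| / (2 * (B + 1))).
have h0 : 0 < h by rewrite lt_min subr_gt0 xi divr_gt0 // mulr_gt0 // ltr_wpDl.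
pose y := x + (- Num.sg g * h) *: delta_mx ord0 i.
have yB k : `|y ord0 k| <= rho.
  rewrite !mxE eqxx /=; case: eqP => [->|_]; last by rewrite mulr0 addr0.
  rewrite mulr1 (le_trans (ler_normD _ _)) // normrM normrN normr_sg g0 mul1r.
  by rewrite (gtr0_norm h0) -lerBrDl ge_min lexx.
have [_ _] := HB x y xB yB.
have -> : y - x = (- Num.sg g * h) *: delta_mx ord0 i by rewrite /y addrC addKr.
have -> : gradient_form p x ((- Num.sg g * h) *: delta_mx ord0 i) = - `|g| * h.
  rewrite /gradient_form (bigD1 i) //= big1 => [|k ki]; last first.
    by rewrite !mxE (negPf ki) andbF !mulr0.
  by rewrite !mxE !eqxx addr0 mulr1 -/g [`|g|]normrEsg; ring.
rewrite normrZ normrM normrN normr_sg g0 mul1r (gtr0_norm h0) exprMn.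
have : `|delta_mx ord0 i : 'rV[R]_n| <= 1.
  by apply: sup_norm_le => // k; rewrite mxE eqxx /=; case: eqP => _; rewrite ?normr1 ?normr0.
move=> d1 E; have d2 : `|delta_mx ord0 i : 'rV[R]_n| ^+ 2 <= 1 by rewrite expr_le1.
have := xmin y yB; rewrite leNgt => /negP; apply.
have hB : h * (B + 1) <= `|g| / 2.
  have : h <= `|g| / (2 * (B + 1)) by rewrite ge_min lexx orbT.
  rewrite invfM mulrA ler_pdivlMr //; lra.
have : B * (h ^+ 2 * `|delta_mx ord0 i : 'rV[R]_n| ^+ 2) <= h * (`|g| / 2).
  rewrite (le_trans (_ : _ <= B * (h ^+ 2 * 1))) //.
    by rewrite ler_wpM2l // ler_wpM2l // sqr_ge0.
  rewrite mulr1 expr2 mulrCA ler_pM2l // mulrC; lra.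
move=> rle; move: E => /ler_normlP[_ /le_trans /(_ rle) E].
have : 0 < h * `|g| by rewrite mulr_gt0.
lra.
Qed.

(** Faces are indexed by a finite type so that an ultrafilter can select one; [None] marks a free
    coordinate. *)
Definition face_values (R : realType) n (rho : R) (sigma : {ffun 'I_n -> option bool})
    (i : 'I_n) : option R :=
  omap (fun b : bool => if b then rho else - rho) (sigma i).

(* The least gradient on a level set in a box is attained at a point satisfying
   finitely many fixed equations relating each coordinate to the level. *)
Lemma talweg (R : realType) n (f : mpoly n R) D (rho : R) : 0 < rho ->
  (0 < n)%N -> (1 < D)%N -> (1 < msize f)%N -> (msize f <= D.+1)%N ->
  let K := (D * (3 * D - 3) ^ (n - 1))%N in
  exists P : {ffun 'I_n -> option bool} -> 'I_n -> {poly {poly R}},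
    (forall sigma j, (size (P sigma j) <= K.+1)%N /\
        map_poly (horner_eval 0) (P sigma j) != 0) /\
    forall y : 'rV[R]_n, (forall i, `|y ord0 i| <= rho) -> peval f y != 0 ->
      exists x : 'rV[R]_n, [/\ forall i, `|x ord0 i| <= rho, peval f x = peval f y,
        peval (sqgrad f) x <= peval (sqgrad f) y &
        exists sigma, forall j, (P sigma j).[(x ord0 j)%:P].[peval f y] = 0].
Proof.
move=> rho0 n0 D1 f1 fD K; have [M' gen] := generic_relation n0 D1 f1 fD.
pose face := {ffun 'I_n -> option bool}.
have /choice[s /all_and2[sk]] : forall k : nat, exists s : R, 0 < s < k.+1%:R^-1 /\
    forall sigma j, relation_at (critical f D.-1 s sigma)
      (fun xl => meval xl.1 f) (fun xl => xl.1 j) M' K.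
  by move=> k; have [|s s0 H] := gen k.+1%:R^-1; rewrite ?invr_gt0 //; exists s.
move=> rel.
(* The coefficients depend on the perturbation, the face and the coordinate but not on [y]; hence
   their limits serve all levels. *)
have /choice[co co_rel] : forall kfj : nat * face * 'I_n,
    exists co : 'I_M'.+1 -> 'I_K.+1 -> R, \sum_i \sum_l `|co i l| = 1 /\
    forall xl, critical f D.-1 (s kfj.1.1) (face_values rho kfj.1.2) xl ->
      \sum_i \sum_l co i l * (meval xl.1 f ^+ i * xl.1 kfj.2 ^+ l) = 0.
  move=> [[k sigma] j] /=; have [c [[i [l ci]] Hc]] := rel k (face_values rho sigma) j.
  pose N := \sum_i \sum_l `|c i l|.
  have N0 : 0 < N.
    rewrite /N (bigD1 i) //= (bigD1 l) //=; apply: ltr_wpDr; last first.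
      by apply: ltr_wpDr; rewrite ?normr_gt0 // sumr_ge0.
    by rewrite sumr_ge0 // => *; rewrite sumr_ge0.
  exists (fun i l => N^-1 * c i l); split.
    under eq_bigr do (under eq_bigr do rewrite normrM; rewrite -mulr_sumr).
    by rewrite -mulr_sumr -/N gtr0_norm ?invr_gt0 // mulVf // gt_eqF.
  move=> xl /Hc E; under eq_bigr do under eq_bigr do rewrite -mulrA.
  by under eq_bigr do rewrite -mulr_sumr; rewrite -mulr_sumr E mulr0.
(* Since the coefficients are normalised, their limits as the perturbation [s k]
   tends to 0 do not all vanish; an ultrafilter makes all of them converge. *)
have [U [UU Uoo]] := ultraFilterLemma (@eventually_filter : ProperFilter \oo).
have co1 kfj i l : `|co kfj i l| <= 1.
  rewrite -(co_rel kfj).1 (bigD1 i) //= (bigD1 l) //= -addrA lerDl addr_ge0 //.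
    by rewrite sumr_ge0.
  by rewrite sumr_ge0 // => *; rewrite sumr_ge0.
have /choice[c c_lim] : forall fjil : face * 'I_n * 'I_M'.+1 * 'I_K.+1, exists l : R,
    co (k, fjil.1.1.1, fjil.1.1.2) fjil.1.2 fjil.2 @[k --> U] --> l.
  by move=> fjil; apply: (ultra_bounded_cvg UU (B := 1)); apply: (@filterE _ U) => k; exact: co1.
have /choice[P HP] : forall fj : face * 'I_n, exists P : {poly {poly R}},
    [/\ (size P <= K.+1)%N, map_poly (horner_eval 0) P != 0 &
    forall t x, t != 0 -> \sum_i \sum_l c (fj, i, l) * (t ^+ i * x ^+ l) = 0 ->
      P.[x%:P].[t] = 0].
  move=> [sigma j]; apply: bipoly_of_relation; apply: contrapT => H.
  have c0 i l : c (sigma, j, i, l) = 0.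
    by apply/eqP/negPn/negP => cn; apply: H; exists i, l.
  have : \sum_i \sum_l `|co (k, sigma, j) i l| @[k --> U] --> (0 : R).
    rewrite [X in _ --> X](_ : _ = \sum_(i < M'.+1) \sum_(l < K.+1) (0:R)); last first.
      by rewrite big1 // => i _; rewrite big1.
    apply: cvg_sumr => i; apply: cvg_sumr => l.
    have := c_lim (sigma, j, i, l); rewrite c0 /= => /(@cvg_norm _ _ _).
    by rewrite normr0.
  under eq_fun do rewrite (co_rel (_, sigma, j)).1.
  move/(cvg_unique (@Rhausdorff R) (cvg_cst (1 : R))) /eqP.
  by rewrite oner_eq0.
exists (fun sigma j => P (sigma, j)); split.
  by move=> sigma j; have [] := HP (sigma, j).
move=> y yB fy0; set t := peval f y.
have [w wE] : exists w, D.-1 = w by exists D.-1.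
pose psi : mpoly n R := \sum_i (2 * w).+1%:R^-1 *: mpolyX R (mnm1 i) ^+ (2 * w).+1.
(* Penalising [f - t], rather than imposing [f = t], yields the multiplier equation even where the
   level set is singular; [psi] has the partial derivatives [x_i ^ (2 * w)]. *)
pose Phi k : mpoly n R := sqgrad f + s k *: psi + k.+1%:R *: (f - mpolyC n t) ^+ 2.
have /choice[x /all_and2[xB xmin]] : forall k, exists x : 'rV[R]_n,
    (forall i, `|x ord0 i| <= rho) /\
    forall z : 'rV[R]_n, (forall i, `|z ord0 i| <= rho) ->
      peval (Phi k) x <= peval (Phi k) z.
  by move=> k; have [x xB xm] := box_minimum (Phi k) (ltW rho0); exists x.
have PhiE k z : peval (Phi k) z =
    peval (sqgrad f) z + s k * peval psi z + k.+1%:R * (peval f z - t) ^+ 2.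
  by rewrite /peval /Phi !mevalD !mevalZ rmorphXn /= mevalB mevalC.
pose sig k : face := [ffun i => if x k ord0 i == rho then Some true else
  if x k ord0 i == - rho then Some false else None].
(* The multiplier is minus the derivative of the penalty with respect to the value of [f]. *)
have crit k : critical f D.-1 (s k) (face_values rho (sig k))
    (fun i => x k ord0 i, - (k.+1%:R * 2 * (peval f (x k) - t))).
  move=> i; rewrite /face_values ffunE; case: eqP => [E//|x1] /=.
  case: eqP => [E//|x2] /=; rewrite wE.
  have : `|x k ord0 i| < rho.
    rewrite lt_neqAle xB andbT; apply/eqP => E.
    by case: (ger0P (x k ord0 i)) E => _ E; [exact: x1|apply: x2; rewrite -E opprK].
  move/(box_minimum_mderiv (xB k) (xmin k)).
  have -> : mderiv i (Phi k) = mderiv i (sqgrad f) +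
     s k *: mpolyX R (mnm1 i) ^+ (2 * w) +
     k.+1%:R *: (((f - mpolyC n t) * mderiv i f) *+ 2).
    rewrite !mderivD !mderivZ; congr (_ + _ *: _ + _ *: _).
      rewrite /psi raddf_sum /= (bigD1 i) //= big1 ?addr0 => [|j ji].
        rewrite mderivZ mpolyXn mderivX mulmnE mnm1E eqxx mul1n scalerA.
        rewrite mulVf ?pnatr_eq0 // scale1r mpolyXn; congr mpolyX; apply/mnmP => j.
        by rewrite mnmBE !mulmnE; case: (mnm1 i j) => //; lia.
      rewrite mderivZ mpolyXn mderivX mulmnE mnm1E (negPf ji) mul0n.
      by rewrite scale0r scaler0.
    by rewrite expr2 mderivM mderivB mderivC subr0 mulr2n mulrC.
  rewrite /peval !mevalD !mevalZ mevalMn mevalM mevalB mevalC rmorphXn /= mevalXU.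
  by move=> E; apply/eqP; rewrite -subr_eq0 -[X in _ == X]E; apply/eqP; ring.
have [sigma Usig] := ultra_finite UU sig.
have /fin_all_exists[xs xs_lim] : forall i, exists l : R, x k ord0 i @[k --> U] --> l.
  by move=> i; apply: (ultra_bounded_cvg UU (B := rho)); apply: (@filterE _ U) => k; exact: xB.
pose z : 'rV[R]_n := \row_i xs i.
have pl p : peval p (x k) @[k --> U] --> peval p z.
  apply: meval_cvg => i; rewrite mxE; exact: xs_lim.
have zB i : `|z ord0 i| <= rho.
  rewrite mxE; apply: (ler_cvg_to (cvg_norm (xs_lim i)) (cvg_cst rho)).
  by apply: (@filterE _ U) => k; exact: xB.
have [B B0 HB] := peval_taylor psi rho.
have psiB (v : 'rV[R]_n) : (forall i, `|v ord0 i| <= rho) -> `|peval psi v| <= B.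
  by move=> vB; have [] := HB v v vB vB.
have s0 k : 0 < s k by have /andP[] := sk k.
have sle k : s k <= k.+1%:R^-1 by have /andP[_ /ltW] := sk k.
have k0 k : 0 < k.+1%:R^-1 :> R by rewrite invr_gt0.
have klim : k.+1%:R^-1 @[k --> U] --> (0 : R).
  exact: cvg_trans (cvg_app _ Uoo) (@cvg_harmonic R).
have phi0 (v : 'rV[R]_n) : 0 <= peval (sqgrad f) v.
  rewrite /peval /sqgrad raddf_sum sumr_ge0 // => i _.
  by rewrite /= mevalM -expr2 sqr_ge0.
have ineq k (v : 'rV[R]_n) : (forall i, `|v ord0 i| <= rho) -> peval f v = t ->
    peval (sqgrad f) (x k) + k.+1%:R * (peval f (x k) - t) ^+ 2 <=
    peval (sqgrad f) v + 2 * B * k.+1%:R^-1.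
  move=> vB fv; have := xmin k v vB; rewrite !PhiE fv subrr expr0n /= mulr0 addr0.
  have := psiB v vB; have := psiB (x k) (xB k).
  move=> /ler_normlP[a1 a2] /ler_normlP[b1 b2] H.
  have : s k * (peval psi v - peval psi (x k)) <= k.+1%:R^-1 * (2 * B).
    apply: le_trans (_ : s k * (2 * B) <= _).
      by rewrite ler_wpM2l //; [exact: ltW|lra].
    by rewrite ler_wpM2r // mulr_ge0.
  by move: H; move: (k.+1%:R * _) (k.+1%:R^-1) => Q I; lra.
(* The penalty stays bounded while its weight tends to infinity, so the limit point lies on the
   level [t]. *)
have fz : peval f z = t.
  apply/eqP; rewrite -subr_eq0 -sqrf_eq0 eq_le sqr_ge0 andbT.
  pose C := peval (sqgrad f) y + 2 * B.
  have l1 : (peval f (x k) - t) ^+ 2 @[k --> U] --> (peval f z - t) ^+ 2.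
    by rewrite expr2; under eq_fun do rewrite expr2; apply: cvgM; apply: cvgB => //; exact: cvg_cst.
  have l2 : C * k.+1%:R^-1 @[k --> U] --> C * 0 by apply: cvgM => //; exact: cvg_cst.
  rewrite -(mulr0 C); apply: ler_cvg_to l1 l2 _; apply: (@filterE _ U) => k.
  rewrite ler_pdivlMr // mulrC.
  have := ineq k y yB erefl; have := phi0 (x k).
  have : k.+1%:R^-1 <= 1 :> R by rewrite invf_le1 // ler1n.
  rewrite /C => k1; have : 2 * B * k.+1%:R^-1 <= 2 * B by rewrite ler_piMr // mulr_ge0.
  by move: (k.+1%:R * _) (2 * B / _) => Q I; lra.
exists z; split => //.
  have l2 : peval (sqgrad f) y + 2 * B * k.+1%:R^-1 @[k --> U] -->
      peval (sqgrad f) y + 2 * B * 0.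
    by apply: cvgD; [exact: cvg_cst|apply: cvgM => //; exact: cvg_cst].
  rewrite mulr0 addr0 in l2; apply: ler_cvg_to (pl _) l2 _; apply: (@filterE _ U) => k.
  by apply: le_trans (ineq k y yB erefl); rewrite lerDl mulr_ge0 // sqr_ge0.
exists sigma => j; have [_ _ HPz] := HP (sigma, j); apply: HPz => //.
have l1 : \sum_i \sum_l co (k, sigma, j) i l * (peval f (x k) ^+ i * x k ord0 j ^+ l)
    @[k --> U] --> \sum_i \sum_l c (sigma, j, i, l) * (t ^+ i * z ord0 j ^+ l).
  apply: cvg_sumr => i; apply: cvg_sumr => l; apply: cvgM; first exact: c_lim.
  apply: cvgM; first by apply: cvg_expr; rewrite -fz; exact: pl.
  by apply: cvg_expr; rewrite mxE; exact: xs_lim.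
apply: (cvg_unique (@Rhausdorff R) l1).
apply: cvg_near_cst; apply: filterS Usig => k /= sk'.
have [_ Hco] := co_rel (k, sigma, j).
by apply: (Hco (_, _)) (_ : critical _ _ _ _ (_, _)); have := crit k; rewrite sk'; exact.
Qed.

(** * Branches of a plane algebraic curve *)

Section Bipoly.
Variable R : realType.
Implicit Types (P Q : {poly {poly R}}) (t x : R).

Lemma horner_section P t x : (map_poly (horner_eval t) P).[x] = P.[x%:P].[t].
Proof.
by rewrite -{1}[x](_ : horner_eval t x%:P = x) ?horner_map //= /horner_eval hornerC.
Qed.

Lemma section_deriv P t :
  (map_poly (horner_eval t) P)^`() = map_poly (horner_eval t) P^`().
Proof. exact: deriv_map. Qed.

Lemma horner_cvg (T : Type) (F : set_system T) (FF : Filter F) (p : {poly R})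
    (u : T -> R) (t : R) : u k @[k --> F] --> t -> p.[u k] @[k --> F] --> p.[t].
Proof.
move=> ut; apply: (@cvg_comp _ _ _ u (horner p) _ _ _ ut).
exact: continuous_horner.
Qed.

Lemma bipoly_cvg (T : Type) (F : set_system T) (FF : Filter F) P
    (u v : T -> R) (t x : R) : u k @[k --> F] --> t -> v k @[k --> F] --> x ->
  P.[(v k)%:P].[u k] @[k --> F] --> P.[x%:P].[t].
Proof.
move=> ut vx; elim/poly_ind: P => [|P c IH].
  by rewrite !horner0; under eq_fun do rewrite !horner0; exact: cvg_cst.
rewrite hornerMXaddC hornerD hornerM hornerC.
under eq_fun do rewrite hornerMXaddC hornerD hornerM hornerC.
by apply: cvgD; [exact: cvgM|exact: horner_cvg].
Qed.

(** An interval is connected, and the set where [g] takes its value at [t1] is open and closed in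
    it. *)
Lemma locally_constant_itv (T : Type) (g : R -> T) (e : R) :
  (forall t, 0 < t < e -> \forall s \near t, g s = g t) ->
  forall t1 t2, 0 < t1 < e -> 0 < t2 < e -> g t1 = g t2.
Proof.
move=> H t1 t2 h1 h2.
have /connected_intervalP conn : is_interval [set t : R | 0 < t < e].
  by move=> a b /= /andP[a0 ae] /andP[b0 be] c /andP[ac cb]; lra.
have op (p : set T) : open [set t : R | 0 < t < e /\ p (g t)].
  rewrite openE => t /= [te pt].
  have lt0 : \forall s \near t, 0 < s by apply: lt_nbhsr; lra.
  have lte : \forall s \near t, s < e by apply: lt_nbhsl; lra.
  near=> s; split; first by apply/andP; split; near: s.
  by rewrite (_ : g s = g t) //; near: s; exact: H.
have E : [set t : R | 0 < t < e /\ g t = g t1] = [set t : R | 0 < t < e].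
  apply: conn; first by exists t1.
    exists [set t : R | 0 < t < e /\ g t = g t1]; first exact: (op (fun y => y = g t1)).
    by apply/seteqP; split=> t /=; tauto.
  exists (~` [set t : R | 0 < t < e /\ g t <> g t1]).
    by apply: open_closedC; exact: (op (fun y => y <> g t1)).
  apply/seteqP; split=> t /=; first tauto.
  by move=> [te /not_andP[//|/contrapT]].
by have : [set t : R | 0 < t < e] t2 by []; rewrite -E => -[].
Unshelve. all: by end_near. Qed.

Section Roots.
Variables (P : {poly {poly R}}) (e : R).
Hypothesis lcP : forall t, 0 < t < e -> (lead_coef P).[t] != 0.
Hypothesis simpleP : forall t x, 0 < t < e -> P.[x%:P].[t] = 0 ->
  P^`().[x%:P].[t] != 0.

Local Notation sec t := (map_poly (horner_eval t) P).

Lemma section_neq0 t : 0 < t < e -> sec t != 0.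
Proof.
move=> /lcP; apply: contra => /eqP E; have := coef_map (horner_eval t) P (size P).-1.
by rewrite /= E coef0 -lead_coefE /horner_eval => <-.
Qed.

Lemma mem_section_roots t x : 0 < t < e ->
  (x \in rootsR (sec t)) = (P.[x%:P].[t] == 0).
Proof.
move=> /section_neq0/roots_on_rootsR/(_ x) /=.
by rewrite rootE horner_section => <-.
Qed.

(** As the leading coefficient does not vanish, the Cauchy bound of the section is continuous in
    [t]: no root escapes to infinity. *)
Lemma roots_locally_bounded t0 : 0 < t0 < e -> exists M, \forall t \near t0,
  forall x, P.[x%:P].[t] = 0 -> `|x| <= M.
Proof.
move=> t0e; pose b t := cauchy_bound (sec t).
pose B t := 1 + `|(lead_coef P).[t]|^-1 * \sum_(i < size P) `|(P`_i).[t]|.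
have size_sec t : 0 < t < e -> size (sec t) = size P.
  by move=> te; rewrite size_map_poly_id0 // /horner_eval; exact: lcP.
have bB t : 0 < t < e -> b t = B t.
  move=> te; rewrite /b /B /cauchy_bound /lead_coef size_sec // coef_map /=.
  by congr (_ + _ * _); apply: eq_bigr => i _; rewrite coef_map.
have cB : B t @[t --> t0] --> B t0.
  apply: cvgD; first exact: cvg_cst.
  apply: cvgM; first apply: cvgV.
  - by rewrite normr_eq0 lcP.
  - by apply: cvg_norm; apply: horner_cvg; exact: cvg_id.
  - by apply: cvg_sumr => i; apply: cvg_norm; apply: horner_cvg; exact: cvg_id.
exists (B t0 + 1).
have nB : \forall t \near t0, B t < B t0 + 1.
  by apply: (cvgr_lt _ cB); rewrite ltrDl.
have lt0 : \forall s \near t0, 0 < s by apply: lt_nbhsr; lra.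
have lte : \forall s \near t0, s < e by apply: lt_nbhsl; lra.
near=> t; move=> x xt.
have te : 0 < t < e by apply/andP; split; near: t.
have := @cauchy_boundP _ (sec t) x (section_neq0 te); rewrite horner_section => /(_ xt).
rewrite -/(b t) bB // => /ltW/le_trans; apply; apply/ltW; near: t; exact: nB.
Unshelve. all: by end_near. Qed.

(** Otherwise roots staying [eta] away from those at [t0] would, being bounded, accumulate at a
    further root at [t0]. *)
Lemma roots_near t0 (eta : R) : 0 < t0 < e -> 0 < eta ->
  \forall t \near t0, forall x, P.[x%:P].[t] = 0 ->
    exists2 y, P.[y%:P].[t0] = 0 & `|x - y| < eta.
Proof.
move=> t0e eta0; apply: contrapT => H.
pose Bad := [set t | exists x, P.[x%:P].[t] = 0 /\
  forall y, P.[y%:P].[t0] = 0 -> eta <= `|x - y|].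
have Fp : ProperFilter (within Bad (nbhs t0)).
  apply: Build_ProperFilter_ex => A nA; have nA' : nbhs t0 [set t | Bad t -> A t] := nA.
  apply: contrapT => A0; apply: H; apply: (filterS _ nA') => t tA x xt.
  apply: contrapT => K; apply: A0; exists t; apply: tA; exists x; split => // y yt.
  by rewrite leNgt; apply/negP => xy; apply: K; exists y.
have [U [UU FU]] := ultraFilterLemma Fp.
have Ut : t @[t --> U] --> t0.
  by move=> A At; apply: FU; apply: filterS At.
have UB : U Bad by apply: FU; exact: (withinT Bad).
have /choice[x Hx] : forall t, exists x, Bad t -> P.[x%:P].[t] = 0 /\
    forall y, P.[y%:P].[t0] = 0 -> eta <= `|x - y|.
  move=> t; have [[x Hx]|nB] := pselect (Bad t); first by exists x.
  by exists 0.
have [M HM] := roots_locally_bounded t0e.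
have UM : U [set t | `|x t| <= M].
  have : U [set t | forall x, P.[x%:P].[t] = 0 -> `|x| <= M] by exact: (Ut _ HM).
  move: UB; apply: filterS2 => t Bt; apply; exact: (Hx t Bt).1.
have [l xl] := ultra_bounded_cvg UU UM.
have Pl : P.[l%:P].[t0] = 0.
  have Pz : P.[(x t)%:P].[t] @[t --> U] --> (0 : R).
    by apply: cvg_near_cst; apply: filterS UB => t /Hx[].
  exact: (cvg_unique (@Rhausdorff R) (bipoly_cvg _ Ut xl) Pz).
have close : U [set t | `|l - x t| < eta] by apply: cvgr_dist_lt xl _ eta0.
have [t [/= Bt tl]] := filter_ex (filterI UB close).
by have [_ /(_ l Pl)] := Hx t Bt; rewrite leNgt distrC tl.
Qed.

(** Near a simple root the [x]-derivative keeps its sign, so nearby sections are strictly monotone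
    there and change sign. *)
Lemma section_root_unique t0 x0 : 0 < t0 < e -> P.[x0%:P].[t0] = 0 ->
  exists2 d, 0 < d & forall eta, 0 < eta < d -> \forall t \near t0,
    (exists2 x, P.[x%:P].[t] = 0 & `|x - x0| < eta) /\
    forall x y, P.[x%:P].[t] = 0 -> P.[y%:P].[t] = 0 ->
      `|x - x0| < eta -> `|y - x0| < eta -> x = y.
Proof.
move=> t0e Px0; have P'0 := simpleP t0e Px0.
set s := Num.sg (P^`().[x0%:P].[t0]).
have s0 : 0 < s * P^`().[x0%:P].[t0] by rewrite -normrEsg normr_gt0.
have near2 : \forall p \near (t0, x0), 0 < s * P^`().[p.2%:P].[p.1].
  have : s * P^`().[p.2%:P].[p.1] @[p --> (t0, x0)] --> s * P^`().[x0%:P].[t0].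
    apply: cvgM; first exact: cvg_cst.
    by apply: bipoly_cvg; [exact: cvg_fst|exact: cvg_snd].
  by move/cvgr_gt; exact.
have [d d0 Hd] : exists2 d : R, 0 < d & forall t x, `|t - t0| < d -> `|x - x0| < d ->
    0 < s * P^`().[x%:P].[t].
  have /nbhs_ballP[d d0 Hd] := near2; exists d => // t x td xd.
  by apply: (Hd (t, x)); split; rewrite /= /ball /= distrC.
have mono t x y : `|t - t0| < d -> `|x - x0| < d -> `|y - x0| < d -> x < y ->
    s * P.[x%:P].[t] < s * P.[y%:P].[t].
  move=> td xd yd xy.
  have [c] := poly_mvt (s *: sec t) xy.
  rewrite derivZ section_deriv !hornerZ !horner_section => cxy E.
  rewrite -subr_gt0 E; apply: mulr_gt0; last by rewrite subr_gt0.
  apply: Hd => //; move: cxy; rewrite in_itv /= => /andP[xc cy].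
  by move: xd yd; rewrite !ltr_norml; lra.
exists d => // eta /andP[eta0 etad].
have t0d : `|t0 - t0| < d by rewrite subrr normr0.
have x0d : `|x0 - x0| < d by rewrite subrr normr0.
pose h := eta / 2.
have h0 : 0 < h by rewrite /h; lra.
have hp : `|x0 + h - x0| < eta by rewrite addrAC subrr add0r gtr0_norm // /h; lra.
have hm : `|x0 - h - x0| < eta.
  by rewrite addrAC subrr add0r normrN gtr0_norm // /h; lra.
have p1 : 0 < s * P.[(x0 + h)%:P].[t0].
  have := mono t0 x0 (x0 + h) t0d x0d (lt_trans hp etad); rewrite Px0 mulr0.
  by apply; rewrite ltrDl.
have p2 : s * P.[(x0 - h)%:P].[t0] < 0.
  have := mono t0 (x0 - h) x0 t0d (lt_trans hm etad) x0d; rewrite Px0 mulr0.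
  by apply; rewrite gtrDl oppr_lt0.
have cs x : s * P.[x%:P].[t] @[t --> t0] --> s * P.[x%:P].[t0].
  by apply: cvgM; [exact: cvg_cst|apply: horner_cvg; exact: cvg_id].
have n1 : \forall t \near t0, 0 < s * P.[(x0 + h)%:P].[t] by apply: (cvgr_gt _ (cs _)).
have n2 : \forall t \near t0, s * P.[(x0 - h)%:P].[t] < 0 by apply: (cvgr_lt _ (cs _)).
have n3 : \forall t \near t0, `|t - t0| < d.
  by near=> t; rewrite distrC; near: t; exact: nbhsx_ballx.
near=> t.
have td : `|t - t0| < d by near: t.
have t1 : 0 < s * P.[(x0 + h)%:P].[t] by near: t.
have t2 : s * P.[(x0 - h)%:P].[t] < 0 by near: t.
split; last first.
  move=> x y Px Py xe ye; apply/eqP; case: (ltgtP x y) => // xy.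
    have := mono t x y td (lt_trans xe etad) (lt_trans ye etad) xy.
    by rewrite Px Py ltxx.
  have := mono t y x td (lt_trans ye etad) (lt_trans xe etad) xy.
  by rewrite Px Py ltxx.
have [||x] := @polyrcf.poly_ivtoo R (s *: sec t) (x0 - h) (x0 + h).
- lra.
- by rewrite !hornerZ !horner_section pmulr_llt0.
rewrite in_itv /= rootE hornerZ horner_section mulf_eq0 => xin.
have s1 : s == 0 = false by rewrite /s sgr_eq0; exact: (negPf P'0).
rewrite s1 /= => /eqP Px; exists x => //.
by rewrite ltr_norml; move: xin; rewrite /h; lra.
Unshelve. all: by end_near. Qed.

Lemma section_roots_continuous t0 eta : 0 < t0 < e -> 0 < eta ->
  \forall t \near t0, size (rootsR (sec t)) = size (rootsR (sec t0)) /\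
    forall i, (i < size (rootsR (sec t0)))%N ->
      `|nth 0 (rootsR (sec t)) i - nth 0 (rootsR (sec t0)) i| < eta.
Proof.
move=> t0e eta0; set r0 := rootsR (sec t0).
have r0P i : P.[(r0`_i)%:P].[t0] = 0 \/ (size r0 <= i)%N.
  case: (ltnP i (size r0)) => ir; [left|by right].
  by apply/eqP; rewrite -mem_section_roots // mem_nth.
have sort0 : sorted <%R r0 by exact: sorted_roots.
have /choice[d Hd] : forall i, exists d : R, 0 < d /\ ((i < size r0)%N ->
    forall eta, 0 < eta < d -> \forall t \near t0,
    (exists2 x, P.[x%:P].[t] = 0 & `|x - r0`_i| < eta) /\
    forall x y, P.[x%:P].[t] = 0 -> P.[y%:P].[t] = 0 ->
      `|x - r0`_i| < eta -> `|y - r0`_i| < eta -> x = y).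
  move=> i; have [Pi|ri] := r0P i; last by exists 1; split=> //; rewrite ltnNge ri.
  by have [d d0 H] := section_root_unique t0e Pi; exists d.
pose gap i := r0`_i.+1 - r0`_i.
have gap0 i : (i.+1 < size r0)%N -> 0 < gap i.
  by move=> ir; rewrite subr_gt0; apply: (sortedP 0 _) => //.
(* Half of the smallest of these quantities: the intervals of radius [h] around the roots are then
   disjoint, and each contains exactly one root of a nearby section. *)
have [h [h0 heta hd hgap]] : exists h : R, [/\ 0 < h, h <= eta,
    forall i, (i < size r0)%N -> h < d i &
    forall i, (i.+1 < size r0)%N -> 2 * h <= gap i].
  pose m := \big[Num.min/eta]_(i < size r0)
     (if (i.+1 < size r0)%N then Num.min (d i) (gap i) else d i).
  have m0 : 0 < m.
    apply: lt_bigmin => // i _; case: ifP => ir; last by have [] := Hd i.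
    by rewrite lt_min gap0 //; have [-> _] := Hd i.
  have mi (i : 'I_(size r0)) : m <= (if (i.+1 < size r0)%N then Num.min (d i) (gap i) else d i).
    exact: bigmin_le.
  exists (m / 2); split.
  - lra.
  - have : m <= eta by exact: bigmin_le_id.
    lra.
  - move=> i ir; have := mi (Ordinal ir) => /=; case: ifP => _; last lra.
    by rewrite le_min; lra.
  - move=> i ir; have := mi (Ordinal (ltnW ir)) => /=; rewrite ir.
    by rewrite le_min; lra.
have n1 := roots_near t0e h0.
pose near_root (i : 'I_(size r0)) t := (exists2 x, P.[x%:P].[t] = 0 & `|x - r0`_i| < h) /\
    forall x y, P.[x%:P].[t] = 0 -> P.[y%:P].[t] = 0 ->
      `|x - r0`_i| < h -> `|y - r0`_i| < h -> x = y.
have n2 : \forall t \near t0, forall i, near_root i t.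
  apply: (@filter_forall _ _ near_root (nbhs t0) _) => i.
  by have [_ H] := Hd i; apply: (H (ltn_ord i)); rewrite h0 hd.
have lt0 : \forall s \near t0, 0 < s by apply: lt_nbhsr; lra.
have lte : \forall s \near t0, s < e by apply: lt_nbhsl; lra.
near=> t.
have te : 0 < t < e by apply/andP; split; near: t.
have N1 : forall x, P.[x%:P].[t] = 0 -> exists2 y, P.[y%:P].[t0] = 0 & `|x - y| < h.
  by near: t.
have N2 : forall i, near_root i t by near: t.
have /choice[g Hg] : forall i : nat, exists x, (i < size r0)%N ->
    P.[x%:P].[t] = 0 /\ `|x - r0`_i| < h.
  move=> i; case: (ltnP i (size r0)) => ir; last by exists 0.
  by have [[x Px xh] _] := N2 (Ordinal ir); exists x.
(* Both lists are increasing with the same members, so the numbering of the roots is preserved. *)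
have E : rootsR (sec t) = mkseq g (size r0).
  apply: lt_sorted_eq; first exact: sorted_roots.
    apply/(sortedP 0) => i; rewrite size_mkseq => ir.
    rewrite !nth_mkseq //; last exact: ltnW.
    have [_] := Hg _ ir; have [_] := Hg _ (ltnW ir).
    have := hgap i ir; rewrite /gap !ltr_norml; lra.
  move=> x; rewrite mem_section_roots //; apply/eqP/mapP.
    move=> Px; have [y Py xy] := N1 x Px.
    have yr : y \in r0 by rewrite mem_section_roots //; apply/eqP.
    have ir : (index y r0 < size r0)%N by rewrite index_mem.
    exists (index y r0); first by rewrite mem_iota.
    have [Pg gh] := Hg _ ir; have [_] := N2 (Ordinal ir); apply => //=.
    by rewrite nth_index.
  by move=> [i]; rewrite mem_iota /= => ir ->; have [] := Hg i ir.
rewrite E size_mkseq; split => // i ir.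
by rewrite nth_mkseq //; have [_ /lt_le_trans] := Hg i ir; apply.
Unshelve. all: by end_near. Qed.

End Roots.
End Bipoly.

Section Branches.
Variable R : realType.
Implicit Types (P Q : {poly {poly R}}) (t x : R).

(* Differentiability in Caratheodory's form. *)
Definition slope (g : R -> R) (t0 d : R) := exists q : R -> R,
  q t @[t --> t0] --> d /\ \forall t \near t0, g t - g t0 = q t * (t - t0).

Lemma slope_is_derive g t0 d : slope g t0 d -> is_derive t0 1 g d.
Proof.
move=> [q [qd gq]].
have H : h^-1 *: (g (h *: 1 + t0) - g t0) @[h --> 0^'] --> d.
  have shift : h + t0 @[h --> (0 : R)] --> t0.
    rewrite -{2}[t0]add0r; apply: cvgD; [exact: cvg_id|exact: cvg_cst].
  have qs : q (h + t0) @[h --> 0^'] --> d.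
    apply: cvg_trans (@cvg_comp _ _ _ (fun h : R => h + t0) q _ _ _ shift qd).
    by apply: cvg_app; exact: cvg_within.
  apply: cvg_trans qs; apply: near_eq_cvg.
  have g0 : \forall h \near 0^', g (h + t0) - g t0 = q (h + t0) * (h + t0 - t0).
    by apply: cvg_within; exact: (shift _ gq).
  have n0 : \forall h \near 0^', h != (0 : R) by exact: nbhs_dnbhs_neq.
  near=> h; rewrite scaler1.
  have -> : g (h + t0) - g t0 = q (h + t0) * (h + t0 - t0) by near: h.
  have h0 : h != 0 by near: h.
  by rewrite addrK /GRing.scale /= mulrC mulfK.
by apply: DeriveDef; [apply/cvg_ex; exists d|exact: cvg_lim].
Unshelve. all: by end_near. Qed.

Lemma slope_continuous g t0 d : slope g t0 d -> g t @[t --> t0] --> g t0.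
Proof.
move=> /slope_is_derive [dg _]; apply: differentiable_continuous.
exact/derivable1_diffP.
Qed.

Lemma horner_deriv_coef P x :
  (map_poly (@deriv R) P).[x%:P] = (P.[x%:P])^`().
Proof.
rewrite (horner_coef_wide _ (size_poly _ _)) horner_coef raddf_sum /=.
apply: eq_bigr => i _; rewrite coef_map_id0 ?deriv0 // derivM -rmorphXn /=.
by rewrite derivC mulr0 addr0.
Qed.

(** Write P(t, x) = A(t, x) (x - x0) + b(t) (t - t0). On the zero set the difference quotient is
    [- b / A], and at the base point [A] and [b] are the two partial derivatives. *)
Lemma implicit_slope P (xi : R -> R) t0 :
  (\forall t \near t0, P.[(xi t)%:P].[t] = 0) ->
  P^`().[(xi t0)%:P].[t0] != 0 -> xi t @[t --> t0] --> xi t0 ->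
  slope xi t0 (- (map_poly (@deriv R) P).[(xi t0)%:P].[t0] /
                 P^`().[(xi t0)%:P].[t0]).
Proof.
move=> near0 P'0 xi_cont; set x0 := xi t0.
have P0 : P.[x0%:P].[t0] = 0 by exact: nbhs_singleton near0.
have [A AE] : exists A, P - (P.[x0%:P])%:P = A * ('X - (x0%:P)%:P).
  by apply/factor_theorem; rewrite rootE hornerD hornerN hornerC subrr.
have [b bE] : exists b, P.[x0%:P] = b * ('X - t0%:P).
  by apply/factor_theorem; rewrite rootE P0.
have A0 : A.[x0%:P] = P^`().[x0%:P].
  have /(congr1 (fun Q => Q^`().[x0%:P])) := AE.
  rewrite /= derivB derivC subr0 => ->.
  by rewrite derivM derivXsubC hornerD !hornerM !hornerE subrr mulr0 add0r ?mulr1.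
have b0 : b.[t0] = (map_poly (@deriv R) P).[x0%:P].[t0].
  by rewrite horner_deriv_coef bE derivM derivXsubC !hornerE subrr mulr0 add0r.
have PE t x : P.[x%:P].[t] = A.[x%:P].[t] * (x - x0) + b.[t] * (t - t0).
  rewrite -[P in LHS](subrK (P.[x0%:P])%:P) AE bE.
  by rewrite hornerD hornerC hornerM hornerXsubC -polyCB hornerD !hornerM hornerC hornerXsubC.
have Alim : A.[(xi t)%:P].[t] @[t --> t0] --> A.[x0%:P].[t0].
  by apply: bipoly_cvg => //; exact: cvg_id.
exists (fun t => - b.[t] / A.[(xi t)%:P].[t]); split.
  rewrite -b0 -A0; apply: cvgM.
    by apply: cvgN; apply: horner_cvg; exact: cvg_id.
  by apply: cvgV => //; rewrite A0.
have An0 : \forall t \near t0, A.[(xi t)%:P].[t] != 0.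
  by apply: (cvgr_neq0 _ Alim); rewrite A0.
near=> t.
have : P.[(xi t)%:P].[t] = 0 by near: t.
have A1 : A.[(xi t)%:P].[t] != 0 by near: t.
rewrite PE => E; apply: (mulfI A1).
have -> : A.[(xi t)%:P].[t] * (- b.[t] / A.[(xi t)%:P].[t] * (t - t0)) =
    - (b.[t] * (t - t0)) by field.
by apply/eqP; rewrite -subr_eq0 opprK E.
Unshelve. all: by end_near. Qed.

Lemma poly_neq0_near (c : {poly R}) : c != 0 ->
  exists2 e : R, 0 < e & forall t, 0 < t < e -> c.[t] != 0.
Proof.
move=> c0; have [k [q]] := multiplicity_XsubC c 0; rewrite c0 /= => q0 ->.
have qc : q.[t] @[t --> (0 : R)] --> q.[0] by apply: horner_cvg; exact: cvg_id.
have : \forall t \near (0 : R), q.[t] != 0 by apply: (cvgr_neq0 _ qc).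
move=> /nbhs_ballP[e e0 He]; exists e => // t /andP[t0 te].
rewrite hornerM mulf_neq0 //.
  by apply: He; rewrite /ball /= sub0r normrN gtr0_norm.
by rewrite horner_exp hornerXsubC subr0 expf_neq0 // gt_eqF.
Qed.

(** [sg i] is the direction in which the [i]-th branch moves. Branches may coincide, so those of two
    factors can be put into one list. *)
Record branches (P : {poly {poly R}}) (e : R) (m : nat) (xi : nat -> R -> R)
    (sg : nat -> R) : Prop := Branches {
  branch_slope : forall i t, (i < m)%N -> 0 < t < e ->
    exists2 d, slope (xi i) t d & 0 <= sg i * d;
  branch_root : forall i t, (i < m)%N -> 0 < t < e -> P.[(xi i t)%:P].[t] = 0;
  branch_sign : forall i, sg i = 1 \/ sg i = -1;
  branch_mono : forall i s t, (i < m)%N -> 0 < s -> s <= t -> t < e ->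
    sg i * xi i s <= sg i * xi i t;
  branch_complete : forall t x, 0 < t < e -> P.[x%:P].[t] = 0 ->
    exists2 i, (i < m)%N & xi i t = x }.

Lemma branches_sub P e e' m xi sg : e' <= e -> branches P e m xi sg ->
  branches P e' m xi sg.
Proof.
move=> le [H1 H0 H2 H3 H4]; split => //.
- by move=> i t im /andP[t0 te]; apply: H1 => //; rewrite t0 (lt_le_trans te).
- by move=> i t im /andP[t0 te]; apply: H0 => //; rewrite t0 (lt_le_trans te).
- by move=> i s t im s0 st te; apply: H3 => //; exact: lt_le_trans te le.
- by move=> t x /andP[t0 te]; apply: H4; rewrite t0 (lt_le_trans te).
Qed.

(** Factorisations come from pseudo-division, with a factor [c] that has no zeros just to the right
    of 0. *)
Lemma branches_split P P1 P2 (c : {poly R}) e1 e2 m1 m2 xi1 xi2 sg1 sg2 : c != 0 ->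
  c *: P = P1 * P2 -> 0 < e1 -> 0 < e2 ->
  branches P1 e1 m1 xi1 sg1 -> branches P2 e2 m2 xi2 sg2 ->
  exists e m xi sg, 0 < e /\ branches P e m xi sg.
Proof.
move=> c0 cP e10 e20 B1 B2; have [e0 e00 He0] := poly_neq0_near c0.
pose e := Num.min e0 (Num.min e1 e2).
have [le0 le1 le2] : [/\ e <= e0, e <= e1 & e <= e2].
  by rewrite /e !ge_min !lexx !orbT.
have [H1 H0 H2 H3 H4] := branches_sub le1 B1.
have [K1 K0 K2 K3 K4] := branches_sub le2 B2.
have sub i : (i < m1 + m2)%N -> ~~ (i < m1)%N -> (i - m1 < m2)%N by lia.
have ct t : 0 < t < e -> c.[t] != 0.
  by move=> /andP[t0 te]; apply: He0; rewrite t0 (lt_le_trans te).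
exists e, (m1 + m2)%N, (fun i => if (i < m1)%N then xi1 i else xi2 (i - m1)%N),
  (fun i => if (i < m1)%N then sg1 i else sg2 (i - m1)%N).
split; first by rewrite /e !lt_min e00 e10.
split.
- move=> i t im te; case: ifPn => i1; first exact: H1.
  by apply: K1 => //; exact: sub.
- move=> i t im te; apply: (mulfI (ct t te)); rewrite mulr0.
  have /(congr1 (fun Q => Q.[((if (i < m1)%N then xi1 i else xi2 (i - m1)%N) t)%:P].[t])) := cP.
  rewrite hornerZ !hornerM => ->; case: ifPn => i1.
    by rewrite (H0 i t i1 te) mul0r.
  by rewrite (K0 _ t (sub _ im i1) te) mulr0.
- by move=> i; case: ifPn.
- move=> i s t im s0 st te; case: ifPn => i1; first exact: H3.
  by apply: K3 => //; exact: sub.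
move=> t x te Px.
have : P1.[x%:P].[t] * P2.[x%:P].[t] = 0.
  by rewrite -hornerM -hornerM -cP hornerZ hornerM Px mulr0.
move/eqP; rewrite mulf_eq0 => /orP[] /eqP.
  by move=> /(H4 t x te)[i im <-]; exists i; rewrite ?im ?(leq_trans im) ?leq_addr.
move=> /(K4 t x te)[i im <-]; exists (i + m1)%N; first by rewrite addnC ltn_add2l.
by rewrite ltnNge leq_addl /= addnK.
Qed.

(** [D] is the slope given by implicit differentiation. As it vanishes at all roots or at none, its
    sign is constant along each branch, which is therefore monotone. *)
Lemma simple_branches P e (D := fun t x =>
    - (map_poly (@deriv R) P).[x%:P].[t] / P^`().[x%:P].[t]) : 0 < e ->
  (forall t, 0 < t < e -> (lead_coef P).[t] != 0) ->
  (forall t x, 0 < t < e -> P.[x%:P].[t] = 0 -> P^`().[x%:P].[t] != 0) ->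
  (forall t x, 0 < t < e -> P.[x%:P].[t] = 0 -> D t x = 0) \/
  (forall t x, 0 < t < e -> P.[x%:P].[t] = 0 -> D t x != 0) ->
  exists m xi sg, branches P e m xi sg.
Proof.
move=> e0 lcP simpleP Dsign.
pose r t := rootsR (map_poly (horner_eval t) P).
pose xi i t := (r t)`_i.
have he : 0 < e / 2 < e by lra.
pose m := size (r (e / 2)).
have sz t : 0 < t < e -> size (r t) = m.
  move=> te; apply: (@locally_constant_itv _ _ (fun t => size (r t)) e) te he.
  move=> t1 te; have := section_roots_continuous lcP simpleP te ltr01.
  by apply: filterS => s [].
have xiP i t : (i < m)%N -> 0 < t < e -> P.[(xi i t)%:P].[t] = 0.
  by move=> im te; apply/eqP; rewrite -(mem_section_roots lcP) // mem_nth // sz.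
have xic i t : (i < m)%N -> 0 < t < e -> xi i s @[s --> t] --> xi i t.
  move=> im te; apply/cvgrPdist_lt => eta eta0.
  have := section_roots_continuous lcP simpleP te eta0; rewrite -/(r t) (sz _ te).
  by apply: filterS => s [_ /(_ i im)]; rewrite distrC.
have near_e t : 0 < t < e -> \forall s \near t, 0 < s < e.
  move=> te.
  have lt0 : \forall s \near t, 0 < s by apply: lt_nbhsr; lra.
  have lte : \forall s \near t, s < e by apply: lt_nbhsl; lra.
  by near=> s; apply/andP; split; near: s.
have slo i t : (i < m)%N -> 0 < t < e -> slope (xi i) t (D t (xi i t)).
  move=> im te; apply: implicit_slope; last exact: xic.
    by apply: filterS (near_e t te) => s; exact: xiP.
  by apply: simpleP => //; exact: xiP.
have sgn i : exists s : R, (s = 1 \/ s = -1) /\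
    ((i < m)%N -> forall t, 0 < t < e -> 0 <= s * D t (xi i t)).
  case: (ltnP i m) => im; last by exists 1; split; [left|].
  case: Dsign => HD.
    exists 1; split; [by left|move=> _ t te].
    by rewrite HD ?mulr0 //; exact: xiP.
  have Dc t : 0 < t < e -> D s (xi i s) @[s --> t] --> D t (xi i t).
    move=> te; apply: cvgM.
      by apply: cvgN; apply: bipoly_cvg; [exact: cvg_id|exact: xic].
    apply: cvgV; first by apply: simpleP => //; exact: xiP.
    by apply: bipoly_cvg; [exact: cvg_id|exact: xic].
  have cst t : 0 < t < e -> (0 < D t (xi i t)) = (0 < D (e / 2) (xi i (e / 2))).
    move=> te; apply: (@locally_constant_itv _ _ (fun t => 0 < D t (xi i t)) e) te he.
    move=> t1 te1; have := HD t1 _ te1 (xiP i t1 im te1).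
    case: (ltrgt0P (D t1 (xi i t1))) => // h _.
      by apply: filterS (cvgr_gt _ (Dc t1 te1) _ h) => s ->.
    apply: filterS (cvgr_lt _ (Dc t1 te1) _ h) => s hs.
    by rewrite ltNge (ltW hs).
  case: (boolP (0 < D (e / 2) (xi i (e / 2)))) => h.
    exists 1; split; [by left|move=> _ t te].
    by rewrite mul1r ltW // cst.
  exists (- 1); split; [by right|move=> _ t te].
  by rewrite mulN1r oppr_ge0 leNgt cst.
have /choice[sg Hsg] := sgn.
exists m, xi, sg; split.
- move=> i t im te; exists (D t (xi i t)); first exact: slo.
  by have [_] := Hsg i; apply.
- exact: xiP.
- by move=> i; have [] := Hsg i.
- move=> i s t im s0 st te; have [sg1 Hd] := Hsg i.
  case: (ltgtP s t) st => // [st _|-> _]; last exact: lexx.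
  have der x : x \in `]s, t[ -> is_derive x 1 (xi i) (D x (xi i x)).
    by rewrite in_itv /= => xst; apply/slope_is_derive/slo => //; lra.
  have ct : {within `[s, t], continuous (xi i)}.
    apply: continuous_in_subspaceT => x; rewrite inE /= in_itv /= => xst.
    by apply: xic => //; lra.
  have [c] := MVT st der ct; rewrite in_itv /= => cst E.
  rewrite -subr_ge0 -mulrBr E mulrA mulr_ge0 //; last by rewrite subr_ge0 ltW.
  by apply: Hd => //; lra.
- move=> t x te Px.
  have xr : x \in r t by rewrite (mem_section_roots lcP) //; apply/eqP.
  by exists (index x (r t)); [rewrite -(sz _ te) index_mem|rewrite /xi nth_index].
Unshelve. all: by end_near. Qed.

(** A Bezout identity holds up to a nonzero polynomial in [t], which excludes common zeros wherever
    it does not vanish. *)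
Lemma coprime_neq0_near P Q : coprimep P Q -> exists2 e : R, 0 < e &
  forall t x, 0 < t < e -> P.[x%:P].[t] = 0 -> Q.[x%:P].[t] != 0.
Proof.
move=> /Bezout_coprimepP[[u v] /= /eqpP[[c1 c2] /= /andP[c10 c20] E]].
have [e e0 He] := poly_neq0_near c20; exists e => // t x te Px.
apply: contra (He t te) => /eqP Qx; apply/eqP.
have /(congr1 (fun Q => Q.[x%:P].[t])) := E.
by rewrite !hornerZ !hornerM !hornerD !hornerM Px Qx hornerC hornerC !mulr0 addr0 mulr0 mulr1.
Qed.

Lemma gcdp_split P Q : P != 0 -> (1 < size (gcdp P Q) < size P)%N ->
  exists (c : {poly R}) (P1 P2 : {poly {poly R}}), [/\ c != 0, c *: P = P1 * P2, P1 != 0, P2 != 0 &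
    (size P1 < size P)%N /\ (size P2 < size P)%N].
Proof.
move=> P0 /andP[g1 gP]; have := dvdp_gcdl P Q; set g := gcdp P Q in g1 gP *.
move=> /Pdiv.Idomain.dvdpP[[c q] /= c0 cP].
have qg0 : q * g != 0 by rewrite -cP -size_poly_eq0 size_scale // size_poly_eq0.
have [q0 g0] : q != 0 /\ g != 0 by move: qg0; rewrite mulf_eq0 negb_or => /andP.
exists c, q, g; split => //; split => //.
have := size_mul q0 g0; rewrite -cP size_scale //.
by move: g1 gP; move: (size g) (size q) (size P) => a b c'; lia.
Qed.

(** Induction on the degree in [x]. A nontrivial gcd with the [x]-derivative, or a nontrivial proper
    one with the [t]-derivative, splits [P]; what remains has simple roots, and slopes vanishing
    everywhere or nowhere. *)
Lemma branches_exist P : P != 0 ->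
  exists e m xi sg, 0 < e /\ branches P e m xi sg.
Proof.
have [k Pk] := ubnP (size P); elim: k P Pk => // k IH P Pk P0.
have split_case Q : (1 < size (gcdp P Q) < size P)%N ->
    exists e m xi sg, 0 < e /\ branches P e m xi sg.
  move=> /(gcdp_split P0)[c [P1 [P2 [c0 cP P10 P20 [s1 s2]]]]].
  have [|e1 [m1 [xi1 [sg1 [e10 B1]]]]] := IH P1 _ P10; first by lia.
  have [|e2 [m2 [xi2 [sg2 [e20 B2]]]]] := IH P2 _ P20; first by lia.
  exact: branches_split c0 cP e10 e20 B1 B2.
have lc0 : lead_coef P != 0 by rewrite lead_coef_eq0.
have [e1 e10 He1] := poly_neq0_near lc0.
have [sP|sP] := leqP (size P) 1.
  exists e1, 0%N, (fun _ => id), (fun=> 1); split => //; split => //; first by left.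
  move=> t x te; have := size1_polyC sP => PE.
  move: (He1 t te); rewrite PE lead_coefC hornerC => + Px.
  by rewrite Px eqxx.
have P'0 : P^`() != 0.
  apply/eqP => /(congr1 (fun p : {poly {poly R}} => p`_(size P).-2)).
  rewrite coef_deriv coef0 prednK; last by case: (size P) sP => [|[]].
  move/eqP; rewrite -lead_coefE -mulr_natr mulf_eq0 lead_coef_eq0 (negPf P0) /=.
  by rewrite -polyC_natr polyC_eq0 pnatr_eq0; case: (size P) sP => [|[]].
have gle (Q : {poly {poly R}}) : (size (gcdp P Q) <= size P)%N.
  by apply: Pdiv.Idomain.leq_gcdpl.
have [cop|ncop] := boolP (coprimep P P^`()); last first.
  apply: (split_case P^`()); apply/andP; split.
    have : gcdp P P^`() != 0 by rewrite gcdp_eq0 (negPf P0).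
    by move: ncop; rewrite /coprimep -size_poly_eq0; case: (size _) => [|[]].
  exact: leq_ltn_trans (Pdiv.Idomain.leq_gcdpr _ P'0) (lt_size_deriv P0).
have [e2 e20 He2] := coprime_neq0_near cop.
set Pt := map_poly (@deriv R) P.
have finish e3 : 0 < e3 ->
  (forall t x, 0 < t < e3 -> P.[x%:P].[t] = 0 -> Pt.[x%:P].[t] = 0) \/
  (forall t x, 0 < t < e3 -> P.[x%:P].[t] = 0 -> Pt.[x%:P].[t] != 0) ->
    exists e m xi sg, 0 < e /\ branches P e m xi sg.
  move=> e30 H; pose e := Num.min e1 (Num.min e2 e3).
  have [le1 le2 le3] : [/\ e <= e1, e <= e2 & e <= e3].
    by rewrite /e !ge_min !lexx !orbT.
  have e0 : 0 < e by rewrite /e !lt_min e10 e20.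
  have up t e' : 0 < t < e -> e <= e' -> 0 < t < e'.
    by move=> /andP[-> te] /(lt_le_trans te).
  have S t x : 0 < t < e -> P.[x%:P].[t] = 0 -> P^`().[x%:P].[t] != 0.
    by move=> te; apply: He2; exact: up te _.
  have [||m [xi [sg B]]] := @simple_branches P e e0 _ S.
  - by move=> t te; apply: He1; exact: up te _.
  - case: H => H; [left|right] => t x te Px.
      by rewrite (H t x (up _ _ te le3) Px) oppr0 mul0r.
    rewrite mulf_neq0 ?oppr_eq0 ?invr_eq0 ?(S t x te Px) //.
    exact: H (up _ _ te le3) Px.
  by exists e, m, xi, sg.
have [copt|ncopt] := boolP (coprimep P Pt).
  by have [e3 e30 He3] := coprime_neq0_near copt; apply: (finish e3) => //; right.
have g1 : (1 < size (gcdp P Pt))%N.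
  have : gcdp P Pt != 0 by rewrite gcdp_eq0 (negPf P0).
  by move: ncopt; rewrite /coprimep -size_poly_eq0; case: (size _) => [|[]].
have [gl|] := ltnP (size (gcdp P Pt)) (size P).
  by apply: (split_case Pt); rewrite g1.
(* If [P] divides its [t]-derivative, all slopes vanish and the branches are constant. *)
move=> ge; have : P %| Pt.
  have /eqp_dvdl <- : gcdp P Pt %= P.
    by rewrite -dvdp_size_eqp ?dvdp_gcdl // eqn_leq gle.
  exact: dvdp_gcdr.
move=> /Pdiv.Idomain.dvdpP[[c q] /= c0 cP].
have [e3 e30 He3] := poly_neq0_near c0.
apply: (finish e3) => //; left => t x te Px.
have /(congr1 (fun Q => Q.[x%:P].[t])) := cP.
rewrite hornerZ !hornerM Px mulr0 => /eqP; rewrite mulf_eq0 (negPf (He3 t te)) /=.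
by move/eqP.
Qed.

End Branches.

(** * Growth of the branches near level zero *)

Section Bounded.
Variable R : realType.

Lemma poly_bounded (c : {poly R}) : exists2 B : R, 0 <= B &
  forall t, 0 <= t <= 1 -> `|c.[t]| <= B.
Proof.
elim/poly_ind: c => [|c k [B B0 IH]].
  by exists 0 => // t _; rewrite horner0 normr0.
exists (B + `|k|) => [|t /[dup] t01 /IH ct]; first exact: addr_ge0.
rewrite hornerMXaddC (le_trans (ler_normD _ _)) // lerD2r normrM.
by rewrite -[leRHS]mulr1 ler_pM // ger0_norm; case/andP: t01.
Qed.

(** The difference is divisible by [t], with a quotient bounded on the given rectangle. *)
Lemma section_at0_close (P : {poly {poly R}}) (rho : R) : 0 <= rho ->
  exists2 B : R, 0 <= B & forall t x, 0 <= t <= 1 -> `|x| <= rho ->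
    `|P.[x%:P].[t] - (map_poly (horner_eval 0) P).[x]| <= B * t.
Proof.
move=> rho0; elim/poly_ind: P => [|P c [B B0 IH]].
  by exists 0 => // t x _ _; rewrite rmorph0 !horner0 subrr normr0 mul0r.
have [c' cE] : exists c' : {poly R}, c - (c.[0])%:P = c' * 'X.
  have [c' E] : exists c', c - (c.[0])%:P = c' * ('X - 0%:P).
    by apply/factor_theorem; rewrite rootE hornerD hornerN hornerC subrr.
  by exists c'; rewrite E subr0.
have [C C0 HC] := poly_bounded c'.
exists (B * rho + C) => [|t x t01 xr]; first by rewrite addr_ge0 // mulr_ge0.
rewrite !horner_section !hornerMXaddC !hornerD !hornerM !hornerC.
have -> : c.[t] = c'.[t] * t + c.[0].
  rewrite -[c in LHS](subrK (c.[0])%:P) cE hornerD hornerM hornerX hornerC.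
  by [].
have := IH t x t01 xr; rewrite horner_section => IHx.
rewrite (_ : _ - _ = (P.[x%:P].[t] - P.[x%:P].[0]) * x + c'.[t] * t); last by ring.
have t0 : 0 <= t by case/andP: t01.
rewrite [leRHS]mulrDl (le_trans (ler_normD _ _)) // lerD // normrM.
  by rewrite mulrAC ler_pM.
by rewrite [`|t|]ger0_norm // ler_wpM2r // HC.
Qed.

(** Since the branch moves away from its limit [a] in the direction [sg], the product
    [sg * (xi t - a)] is its distance to [a], in a form that is plainly differentiable. *)
Record small_branch (K : nat) (e C : R) (xi : R -> R) (a sg : R) : Prop :=
  SmallBranch {
  small_slope : forall t, 0 < t < e -> exists2 d, slope xi t d & 0 <= sg * d;
  small_sign : sg = 1 \/ sg = -1;
  small_ge0 : forall t, 0 < t < e -> 0 <= sg * (xi t - a);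
  small_power : forall t, 0 < t < e -> (sg * (xi t - a)) ^+ K <= C * t }.

Lemma small_branch_sub K e e' C C' xi a sg : e' <= e -> C <= C' ->
  small_branch K e C xi a sg -> small_branch K e' C' xi a sg.
Proof.
move=> ee CC [H1 H2 H3 H4].
have up t : 0 < t < e' -> 0 < t < e by move=> /andP[-> /lt_le_trans]; apply.
split=> // t te; [exact: H1 (up t te)|exact: H3 (up t te)|].
apply: le_trans (H4 t (up t te)) _; case/andP: te => t0 _.
by rewrite ler_wpM2r // ltW.
Qed.

Lemma small_branch_cst K e C : (0 < K)%N -> 0 <= C ->
  small_branch K e C (fun=> 0) 0 1.
Proof.
move=> K0 C0; split=> [t _||t _|t /andP[t0 _]]; [|by left|by rewrite subrr mulr0|].
  exists 0; last by rewrite mulr0.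
  exists (fun=> 0); split; first exact: cvg_cst.
  by near=> s; rewrite subrr mul0r.
by rewrite subrr mulr0 expr0n; case: (K) K0 => // K' _; rewrite mulr_ge0 // ltW.
Unshelve. all: by end_near. Qed.

(* A branch staying below [- rho] is replaced by a constant one. *)
Lemma branch_is_small (P : {poly {poly R}}) K (rho e : R) (xi : R -> R) sg :
  (0 < K)%N -> (size P <= K.+1)%N -> map_poly (horner_eval 0) P != 0 ->
  0 < e -> 0 <= rho ->
  (forall t, 0 < t < e -> exists2 d, slope xi t d & 0 <= sg * d) ->
  sg = 1 \/ sg = -1 ->
  (forall s t, 0 < s -> s <= t -> t < e -> sg * xi s <= sg * xi t) ->
  (forall t, 0 < t < e -> P.[(xi t)%:P].[t] = 0) ->
  exists e' C xi' a sg', [/\ 0 < e', small_branch K e' C xi' a sg' &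
    forall t, 0 < t < e' -> `|xi t| <= rho -> xi' t = xi t].
Proof.
move=> K0 PK P0 e0 rho0 slo sg1 mono zero.
have sgn : `|sg| = 1 by case: sg1 => ->; rewrite ?normrN normr1.
have sgsg : sg * sg = 1 by case: sg1 => ->; rewrite ?mulrNN mulr1.
have [[e' [e'0 He']]|H] := pselect (exists e', 0 < e' /\
    forall t, 0 < t < e' -> sg * xi t < - rho).
  exists e', 0, (fun=> 0), 0, 1; split => //.
    exact: small_branch_cst.
  move=> t te; have := He' t te; rewrite -(mul1r `|_|) -sgn -normrM => h.
  by rewrite leNgt ltr0_norm; lra.
have lb t : 0 < t < e -> - rho <= sg * xi t.
  move=> /andP[t0 te]; rewrite leNgt; apply/negP => h; apply: H.
  exists t; split=> // s /andP[s0 st].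
  exact: le_lt_trans (mono s t s0 (ltW st) te) h.
(* By monotonicity the infimum of [sg * xi] is its limit at 0; it is finite because of the lower
   bound [- rho]. *)
pose A := [set sg * xi t | t in [set t | 0 < t < e]].
have infA : has_inf A.
  split; first by exists (sg * xi (e / 2)), (e / 2) => //=; lra.
  by exists (- rho) => _ [t te <-]; exact: lb.
pose L := inf A; pose a := sg * L.
have ge_L t : 0 < t < e -> L <= sg * xi t.
  by move=> te; apply: ge_inf; [case: infA|exists t].
have lim (h : R) : 0 < h -> exists2 s, 0 < s < e & forall t, 0 < t <= s ->
    sg * xi t < L + h.
  move=> h0; have [_ [s se <-]] := inf_adherent h0 infA; rewrite -/L => sL.
  exists s => // t /andP[t0 ts]; apply: le_lt_trans sL; apply: mono => //.
  by case/andP: se.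
have wE t : sg * (xi t - a) = sg * xi t - L by rewrite mulrBr /a mulrA sgsg mul1r.
have xiE t : `|xi t - a| = `|sg * xi t - L| by rewrite -wE normrM sgn mul1r.
pose P0x := map_poly (horner_eval 0) P.
have [s0 s0e Hs0] := lim 1 ltr01.
have [B B0 HB] := @section_at0_close P (`|a| + 1) (addr_ge0 (normr_ge0 _) ler01).
have P0small t : 0 < t <= s0 -> t <= 1 -> `|P0x.[xi t]| <= B * t.
  move=> ts0 t1; have te : 0 < t < e by lra.
  have := HB t (xi t); rewrite zero // sub0r normrN; apply.
    by apply/andP; split; lra.
  rewrite -[xi t](subrK a) (le_trans (ler_normD _ _)) // addrC lerD2l xiE.
  by have := ge_L t te; have := Hs0 t ts0 => *; rewrite ger0_norm; lra.
(* With [k <= K] the multiplicity of [a] in P(0, x), the value |P(0, x)| is at least a multiple of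
   |x - a|^k near [a], and along the branch at most [B * t]. The distance being below 1, [k] may be
   raised to [K]. *)
have [k [q]] := multiplicity_XsubC P0x a; rewrite P0 /= => qa qE.
have q0 : q.[a] != 0 by [].
have kK : (k <= K)%N.
  have : (size P0x <= K.+1)%N by apply: leq_trans (size_poly _ _) PK.
  have q0' : q != 0 by apply: contra_neq q0 => ->; rewrite horner0.
  rewrite qE size_mul ?expf_neq0 ?polyXsubC_eq0 // size_exp_XsubC.
  have : (0 < size q)%N by rewrite size_poly_gt0.
  by move: (size q) => l; lia.
have qc : `|q.[x]| @[x --> a] --> `|q.[a]|.
  by apply: cvg_norm; apply: horner_cvg; exact: cvg_id.
have : \forall x \near a, `|q.[a]| / 2 < `|q.[x]|.
  by apply: (cvgr_gt _ qc); rewrite ltr_pdivrMr // ltr_pMr ?normr_gt0 // ltr1n.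
move=> /nbhs_ballP[h h0 Hh].
have h10 : 0 < Num.min h 1 by rewrite lt_min h0 ltr01.
have [s1 s1e Hs1] := lim _ h10.
pose e' := Num.min 1 (Num.min s0 s1).
have c0 : 0 < `|q.[a]| / 2 by rewrite divr_gt0 ?normr_gt0.
have small t : 0 < t < e' -> [/\ 0 < t <= s0, t <= 1, 0 < t <= s1 & 0 < t < e].
  rewrite /e' !lt_min => /and3P[t0 t1 /andP[ts0 ts1]].
  by split; [lra|exact: ltW|lra|lra].
exists e', (B / (`|q.[a]| / 2)), xi, a, sg; split => //.
  by rewrite /e' !lt_min ltr01 /=; lra.
split => //.
- by move=> t /small[_ _ _]; exact: slo.
- by move=> t /small[_ _ _ te]; rewrite wE subr_ge0 ge_L.
move=> t /small[ts0 t1 ts1 te].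
have w0 : 0 <= sg * (xi t - a) by rewrite wE subr_ge0 ge_L.
have := Hs1 t ts1; rewrite -ltrBlDl -wE lt_min => /andP[wh w1].
have xia : `|xi t - a| = sg * (xi t - a).
  by rewrite xiE -wE ger0_norm.
have qx : `|q.[a]| / 2 < `|q.[xi t]|.
  by apply: Hh; rewrite /ball /= distrC xia.
have := P0small t ts0 t1; rewrite qE hornerM horner_exp hornerXsubC normrM normrX xia.
move=> Hq; rewrite mulrAC ler_pdivlMr // mulrC; apply: le_trans Hq.
apply: ler_pM; rewrite ?exprn_ge0 ?(ltW c0) ?(ltW qx) //.
by apply: ler_wiXn2l => //; exact: ltW.
Qed.

Lemma small_branches_exist (P : {poly {poly R}}) K (rho : R) :
  (0 < K)%N -> (size P <= K.+1)%N -> map_poly (horner_eval 0) P != 0 -> 0 <= rho ->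
  exists e C m (xi : nat -> R -> R) (a sg : nat -> R), [/\ 0 < e, 0 <= C,
    (forall i, small_branch K e C (xi i) (a i) (sg i)) &
    forall t x, 0 < t < e -> `|x| <= rho -> P.[x%:P].[t] = 0 ->
      exists2 i, (i < m)%N & xi i t = x].
Proof.
move=> K0 PK P0 rho0.
have Pn0 : P != 0 by apply: contra_neq P0 => ->; rewrite rmorph0.
have [e0 [m [xi0 [sg0 [e00 [H1 H2 H3 H4 H5]]]]]] := branches_exist Pn0.
have /choice[F HF] : forall i : nat, exists F : R * R * (R -> R) * R * R,
    0 < F.1.1.1.1 /\ 0 <= F.1.1.1.2 /\
    small_branch K F.1.1.1.1 F.1.1.1.2 F.1.1.2 F.1.2 F.2 /\
    ((i < m)%N -> forall t, 0 < t < F.1.1.1.1 -> `|xi0 i t| <= rho ->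
       t < e0 /\ F.1.1.2 t = xi0 i t).
  move=> i; case: (ltnP i m) => im; last first.
    exists (1, 0, fun=> 0, 0, 1); split=> //; split=> //; split.
      exact: small_branch_cst.
    by [].
  have [||||e' [C [xi [a [sg [e'0 SB HE]]]]]] :=
    @branch_is_small P K rho e0 (xi0 i) (sg0 i) K0 PK P0 e00 rho0.
  - by move=> t te; exact: H1.
  - exact: H3.
  - by move=> s t s0 st te; exact: H4.
  - by move=> t te; exact: H2.
  exists (Num.min e0 e', Num.max 0 C, xi, a, sg) => /=.
  split; [|split; [|split]] => [||| _ t /andP[t0]].
  - by rewrite lt_min e00.
  - by rewrite le_max lexx.
  - by apply: small_branch_sub SB; rewrite ?ge_min ?le_max lexx orbT.
  - by rewrite lt_min => /andP[te0 te'] xr; split => //; apply: HE; rewrite ?t0.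
pose e := \big[Num.min/e0]_(i < m) (F i).1.1.1.1.
pose C := \sum_(i < m) (F i).1.1.1.2.
have C0 : 0 <= C by apply: sumr_ge0 => i _; have [_ []] := HF i.
have ei (i : 'I_m) : e <= (F i).1.1.1.1 by exact: bigmin_le.
exists e, C, m, (fun i => if (i < m)%N then (F i).1.1.2 else fun=> 0),
  (fun i => if (i < m)%N then (F i).1.2 else 0), (fun i => if (i < m)%N then (F i).2 else 1).
split => //.
- by apply: lt_bigmin => // i _; have [] := HF i.
- move=> i; case: ifP => im; last exact: small_branch_cst.
  have [_ [_ [SB _]]] := HF i; apply: small_branch_sub SB; first exact: (ei (Ordinal im)).
  rewrite /C (bigD1 (Ordinal im)) //= lerDl sumr_ge0 // => k _.
  by have [_ []] := HF k.
move=> t x /andP[t0 te] xr Px.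
have te0 : t < e0 by apply: lt_le_trans te _; exact: bigmin_le_id.
have [|i im xit] := H5 t x _ Px; first by rewrite t0.
exists i => //; rewrite im; have [_ [_ [_ HE]]] := HF i.
have [||_ ->] := HE im t; rewrite ?xit //.
by rewrite t0 (lt_le_trans te) //; exact: (ei (Ordinal im)).
Qed.

Lemma slope_sum (I : Type) (r : seq I) (g : I -> R -> R) (d : I -> R) t0 :
  (forall i, slope (g i) t0 (d i)) ->
  slope (fun t => \sum_(i <- r) g i t) t0 (\sum_(i <- r) d i).
Proof.
move=> /choice[q Hq]; exists (fun t => \sum_(i <- r) q i t); split.
  by apply: cvg_sumr => i; have [] := Hq i.
elim: r => [|i r IH].
  by near=> t; rewrite !big_nil subrr mul0r.
have [_ Hi] := Hq i; near=> t; rewrite !big_cons opprD addrACA mulrDl.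
by congr (_ + _); near: t.
Unshelve. all: by end_near. Qed.

Lemma slope_affine (g : R -> R) (b a d : R) t0 : slope g t0 d ->
  slope (fun t => b * (g t - a)) t0 (b * d).
Proof.
move=> [q [qd Hq]]; exists (fun t => b * q t); split.
  by apply: cvgM => //; exact: cvg_cst.
by apply: filterS Hq => t E; rewrite -mulrA -E; ring.
Qed.

(* [V t] is twice the total distance between the branches at [t] and their
   limits at [0]; the branches being monotone, it is differentiable. *)
Lemma level_gauge (I : finType) (P : I -> {poly {poly R}}) K (rho : R) :
  (0 < K)%N -> 0 <= rho ->
  (forall q, (size (P q) <= K.+1)%N /\ map_poly (horner_eval 0) (P q) != 0) ->
  exists e C m (xi : I -> 'I_m -> R -> R) (V : R -> R), [/\ 0 < e, 0 <= C,
    forall t, 0 < t < e -> 0 <= V t /\ V t ^+ K <= C * t,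
    forall t, 0 < t < e -> exists (dV : R) (d : I -> 'I_m -> R),
      [/\ slope V t dV, forall q i, slope (xi q i) t (d q i) &
         2 * (\sum_q \sum_i `|d q i|) <= dV] &
    forall q t x, 0 < t < e -> `|x| <= rho -> (P q).[x%:P].[t] = 0 ->
      exists i, xi q i t = x].
Proof.
move=> K0 rho0 HP.
have /choice[F HF] : forall q : I, exists F : R * R * nat * (nat -> R -> R) *
    (nat -> R) * (nat -> R), [/\ 0 < F.1.1.1.1.1, 0 <= F.1.1.1.1.2,
    (forall i, small_branch K F.1.1.1.1.1 F.1.1.1.1.2 (F.1.1.2 i) (F.1.2 i) (F.2 i)) &
    forall t x, 0 < t < F.1.1.1.1.1 -> `|x| <= rho -> (P q).[x%:P].[t] = 0 ->
      exists2 i, (i < F.1.1.1.2)%N & F.1.1.2 i t = x].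
  move=> q; have [PK P0] := HP q.
  have [e [C [m [xi [a [sg H]]]]]] := small_branches_exist K0 PK P0 rho0.
  by exists (e, C, m, xi, a, sg).
pose e := \big[Num.min/1]_q (F q).1.1.1.1.1.
pose C := \sum_q (F q).1.1.1.1.2.
pose m := \max_q (F q).1.1.1.2.
pose xi q (i : 'I_m) := (F q).1.1.2 i.
pose w q (i : 'I_m) t := (F q).2 i * (xi q i t - (F q).1.2 i).
have C0 : 0 <= C by apply: sumr_ge0 => q _; have [] := HF q.
have SB q i : small_branch K e C (xi q i) ((F q).1.2 i) ((F q).2 i).
  have [_ _ /(_ i) + _] := HF q; apply: small_branch_sub; first exact: bigmin_le.
  by rewrite /C (bigD1 q) //= lerDl sumr_ge0 // => k _; have [] := HF k.
have e0 : 0 < e by apply: lt_bigmin => // q _; have [] := HF q.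
pose W t := \sum_q \sum_i w q i t.
(* Each of the [#|I| * m] summands is at most the largest one, whose [K]-th power is at most
   [C * t]. The factor 2 in [V] provides the strict margin that the descent argument will
   consume. *)
exists e, ((2 * (#|I| * m)%:R) ^+ K * C), m, xi,
  (fun t => \sum_q \sum_(i < m) (2 * (F q).2 i) * (xi q i t - (F q).1.2 i)).
have VE (t : R) : \sum_q \sum_(i < m) (2 * (F q).2 i) * (xi q i t - (F q).1.2 i) = 2 * W t.
  rewrite /W mulr_sumr; apply: eq_bigr => q _; rewrite mulr_sumr.
  by apply: eq_bigr => i _; rewrite mulrA.
split => //.
- by rewrite mulr_ge0 // exprn_ge0 // mulr_ge0.
- move=> t te; rewrite VE.
  have w0 q i : 0 <= w q i t by have [_ _ H _] := SB q i; exact: H.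
  have W0 : 0 <= W t by apply: sumr_ge0 => q _; apply: sumr_ge0.
  split; first by rewrite mulr_ge0.
  pose b := \big[Num.max/0]_q \big[Num.max/0]_i w q i t.
  have t0 : 0 <= t by case/andP: te => /ltW.
  have Ct0 : 0 <= 0 :> R /\ 0 ^+ K <= C * t.
    by split=> //; rewrite expr0n; case: (K) K0 => // k _; rewrite mulr_ge0.
  have maxP (x y : R) : 0 <= x /\ x ^+ K <= C * t -> 0 <= y /\ y ^+ K <= C * t ->
      0 <= Num.max x y /\ (Num.max x y) ^+ K <= C * t.
    by move=> Hx Hy; rewrite /Num.max; case: ifP.
  have [b0 bC] : 0 <= b /\ b ^+ K <= C * t.
    apply: (big_ind (fun x => 0 <= x /\ x ^+ K <= C * t)) => // q _.
    apply: (big_ind (fun x => 0 <= x /\ x ^+ K <= C * t)) => // i _.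
    by split => //; have [_ _ _ H] := SB q i; exact: H.
  have wb q i : w q i t <= b.
    apply: le_trans (le_bigmax 0 (fun i => w q i t) i) _.
    exact: (le_bigmax 0 (fun q => \big[Num.max/0]_i w q i t) q).
  have Wb : W t <= (#|I| * m)%:R * b.
    rewrite natrM -mulrA mulr_natl -sumr_const; apply: ler_sum => q _.
    by rewrite -[m in leRHS]card_ord mulr_natl -sumr_const; apply: ler_sum.
  apply: le_trans (_ : (2 * (#|I| * m)%:R * b) ^+ K <= _).
    apply: lerXn2r; rewrite ?nnegrE ?mulr_ge0 // -mulrA ler_wpM2l //.
  by rewrite exprMn -mulrA ler_wpM2l // exprn_ge0 // mulr_ge0.
- move=> t te.
  have /choice[d Hd] : forall qi : I * 'I_m, exists d, slope (xi qi.1 qi.2) t d /\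
      0 <= (F qi.1).2 qi.2 * d.
    by move=> [q i] /=; have [H _ _ _] := SB q i; have [d d1 d2] := H t te; exists d.
  exists (\sum_q \sum_(i < m) (2 * (F q).2 i) * d (q, i)), (fun q i => d (q, i)); split.
  + apply: slope_sum => q; apply: slope_sum => i; apply: slope_affine.
    by have [] := Hd (q, i).
  + by move=> q i; have [] := Hd (q, i).
  + rewrite mulr_sumr; apply: ler_sum => q _; rewrite mulr_sumr; apply: ler_sum => i _.
    rewrite -mulrA ler_wpM2l //; have [_ /= d0] := Hd (q, i).
    have [_ s1 _ _] := SB q i; rewrite -(ger0_norm d0) normrM.
    by case: s1 => ->; rewrite ?normrN normr1 mul1r.
move=> q t x te xr Px; have [_ _ _ H] := HF q.
have [|i im xit] := H t x _ xr Px.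
  by case/andP: te => -> te; rewrite (lt_le_trans te) //; exact: bigmin_le.
have im' : (i < m)%N by apply: leq_trans im _; exact: (leq_bigmax q).
by exists (Ordinal im').
Qed.

End Bounded.

(** * The local Lojasiewicz inequality *)

Section LevelSets.
Variables (R : realType) (n : nat).
Implicit Types (f : mpoly n R) (x y v : 'rV[R]_n).

Lemma restrict_line f y v : exists g : {poly R},
  forall s, g.[s] = peval f (y + s *: v).
Proof.
elim/mpoly_algebra_ind: f => [c|i|p q [g Hg] [h Hh]|p q [g Hg] [h Hh]].
- by exists c%:P => s; rewrite pevalC hornerC.
- exists ((y ord0 i)%:P + (v ord0 i)%:P * 'X) => s.
  by rewrite pevalX !mxE hornerD hornerM !hornerC hornerX mulrC.
- by exists (g + h) => s; rewrite hornerD pevalD Hg Hh.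
- by exists (g * h) => s; rewrite hornerM pevalM Hg Hh.
Qed.

(** A nonconstant polynomial in one variable takes each value at isolated points only. Thus
    increments of the level along the line are nonzero and can be divided out. *)
Lemma line_leaves_level f y u : peval f u != peval f y ->
  \forall s \near 0^', peval f (y + s *: (u - y)) != peval f y.
Proof.
move=> uy; have [g Hg] := restrict_line f y (u - y).
pose h := g - (peval f y)%:P.
have h0 : h != 0.
  apply: contra_neq uy => /(congr1 (horner^~ 1)); rewrite /h hornerD hornerN hornerC Hg.
  by rewrite scale1r [y + _]addrC subrK horner0 => /eqP; rewrite subr_eq0 => /eqP.
have [k [q]] := multiplicity_XsubC h 0; rewrite h0 /= => q0 hE.
have qc : q.[s] @[s --> (0 : R)] --> q.[0] by apply: horner_cvg; exact: cvg_id.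
have n1 : \forall s \near 0^', q.[s] != 0.
  by apply: cvg_within; apply: (cvgr_neq0 _ qc).
have n2 : \forall s \near 0^', s != (0 : R) by exact: nbhs_dnbhs_neq.
near=> s; rewrite -subr_eq0 -Hg.
have -> : g.[s] - peval f y = h.[s] by rewrite /h hornerD hornerN hornerC.
rewrite hE hornerM horner_exp hornerXsubC subr0 mulf_neq0 //; first by near: s.
by rewrite expf_neq0 //; near: s.
Unshelve. all: by end_near. Qed.

Lemma sqgradE f x : peval (sqgrad f) x = \sum_i peval (mderiv i f) x ^+ 2.
Proof.
rewrite /peval /sqgrad raddf_sum; apply: eq_bigr => i _.
by rewrite /= expr2 mevalM -expr2.
Qed.

Lemma sqgrad_ge f x i : `|peval (mderiv i f) x| <= Num.sqrt (peval (sqgrad f) x).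
Proof.
rewrite -sqrtr_sqr ler_wsqrtr // sqgradE (bigD1 i) //= lerDl.
by apply: sumr_ge0 => j _; exact: sqr_ge0.
Qed.

Section GradientBound.
Variables (f : mpoly n R) (rho e : R) (m : nat).
Variable face : finType.
Variables (P : face -> 'I_n -> {poly {poly R}}) (V : R -> R).
Variable xi : face * 'I_n -> 'I_m -> R -> R.
Hypothesis talwegP : forall y, (forall i, `|y ord0 i| <= rho) -> peval f y != 0 ->
  exists x, [/\ forall i, `|x ord0 i| <= rho, peval f x = peval f y,
    peval (sqgrad f) x <= peval (sqgrad f) y &
    exists sigma, forall j, (P sigma j).[(x ord0 j)%:P].[peval f y] = 0].
Hypothesis gauge_slope : forall t : R, 0 < t < e ->
  exists (dV : R) (d : face * 'I_n -> 'I_m -> R),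
    [/\ slope V t dV, forall q i, slope (xi q i) t (d q i) &
       2 * (\sum_q \sum_i `|d q i|) <= dV].
Hypothesis gauge_complete : forall q (t x : R), 0 < t < e -> `|x| <= rho ->
  (P q.1 q.2).[x%:P].[t] = 0 -> exists i, xi q i t = x.

(* As the level [t] varies, the points of least gradient move along a branch
   [xi], so that the chain rule bounds the gradient by the speed of [V]. *)
Lemma gradient_bound y u : (forall i, `|y ord0 i| < rho) -> 0 < peval f y < e ->
  peval f u != peval f y -> exists2 dV, slope V (peval f y) dV &
    2 <= dV * Num.sqrt (peval (sqgrad f) y).
Proof.
move=> yB fye uy; set t0 := peval f y.
have [dV [d [sV sxi dVle]]] := gauge_slope fye; exists dV => //.
(* Moving on a line towards [u] changes the level even if the gradient at [y] is not yet known to be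
   nonzero. *)
pose v := u - y; pose ys s := y + s *: v; pose ts s := peval f (ys s).
have ysc : ys s @[s --> (0 : R)] --> y.
  have : y + s *: v @[s --> (0 : R)] --> y + 0 *: v.
    apply: cvgD; first exact: cvg_cst.
    by apply: cvgZ; [exact: cvg_id|exact: cvg_cst].
  by rewrite scale0r addr0.
have tsc : ts s @[s --> (0 : R)] --> t0 by apply: peval_cvg.
pose good s := (forall i, `|ys s ord0 i| <= rho) /\ 0 < ts s < e.
have good0 : \forall s \near 0^', good s.
  have g1 : \forall s \near (0 : R), forall i, `|ys s ord0 i| <= rho.
    have g1i i : \forall s \near (0 : R), `|ys s ord0 i| <= rho.
      by apply: (cvgr_le _ (cvg_norm (coord_cvg _ ysc (i := i)))).
    exact: (filter_forall _ g1i).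
  have g2 : \forall s \near (0 : R), 0 < ts s.
    by apply: (cvgr_gt _ tsc); case/andP: fye.
  have g3 : \forall s \near (0 : R), ts s < e.
    by apply: (cvgr_lt _ tsc); case/andP: fye.
  apply: cvg_within; near=> s; split; first by near: s.
  by apply/andP; split; near: s.
(* For each level on the line, record a point of least gradient, its face and the branch carrying
   each coordinate; the ultrafilter [U] will keep face and branches constant. *)
have /choice[xo Hxo] : forall s, exists xo : 'rV[R]_n * option (face * {ffun 'I_n -> 'I_m}),
    good s -> [/\ forall i, `|xo.1 ord0 i| <= rho, peval f xo.1 = ts s,
      peval (sqgrad f) xo.1 <= peval (sqgrad f) (ys s) &
      exists2 q, xo.2 = Some q & forall j, xi (q.1, j) (q.2 j) (ts s) = xo.1 ord0 j].
  move=> s; have [[yb te]|ng] := pselect (good s); last by exists (0, None).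
  have [|x [xB fx phix [sigma Hs]]] := talwegP yb.
    by rewrite gt_eqF //; case/andP: te.
  have /fin_all_exists[b Hb] : forall j, exists i, xi (sigma, j) i (ts s) = x ord0 j.
    by move=> j; apply: gauge_complete => //=; exact: Hs.
  exists (x, Some (sigma, [ffun j => b j])) => _; split => //=.
  by exists (sigma, [ffun j => b j]) => //= j; rewrite ffunE.
have [U [UU FU]] := @ultraFilterLemma _ (0 : R)^' _.
have toU (Q : R -> Prop) : (\forall s \near 0^', Q s) -> U Q by exact: FU.
have Uc : s @[s --> U] --> (0 : R).
  move=> A A0; have h : \forall s \near 0^', A s by apply: cvg_within.
  exact: FU h.
have tsU : ts s @[s --> U] --> t0 by apply: cvg_comp Uc tsc.
have ysU : ys s @[s --> U] --> y by apply: cvg_comp Uc ysc.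
have Ugood := toU _ good0.
have Une := toU _ (line_leaves_level uy).
have [ o Uo] := ultra_finite UU (fun s => (xo s).2).
have [[sigma b] oE] : exists q, o = Some q.
  have [s [/= os gs]] := filter_ex (filterI Uo Ugood).
  by have [_ _ _ [q qE _]] := Hxo s gs; exists q; rewrite -os.
have /choice[q Hq] : forall j, exists q : R -> R, q t @[t --> t0] --> d (sigma, j) (b j) /\
    \forall t \near t0, xi (sigma, j) (b j) t - xi (sigma, j) (b j) t0 = q t * (t - t0).
  by move=> j; exact: sxi.
pose xs := \row_j xi (sigma, j) (b j) t0 : 'rV[R]_n.
pose x s := (xo s).1.
have qU j : q j (ts s) @[s --> U] --> d (sigma, j) (b j).
  by have [qd _] := Hq j; apply: cvg_comp tsU qd.
have xE : U [set s | forall j, x s ord0 j - xs ord0 j = q j (ts s) * (ts s - t0)].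
  apply: filter_forall => j; have [_ Hj] := Hq j.
  have Uj : U [set s | xi (sigma, j) (b j) (ts s) - xi (sigma, j) (b j) t0 =
      q j (ts s) * (ts s - t0)] by exact: (tsU _ Hj).
  apply: (filterS _ (filterI Uj (filterI Uo Ugood))) => s [/= Es [os gs]].
  have [_ _ _ [q' qE Hj']] := Hxo s gs; move: os; rewrite /= qE oE => -[qq].
  by rewrite /x -Hj' qq mxE.
have xU j : x s ord0 j @[s --> U] --> xs ord0 j.
  have : xs ord0 j + q j (ts s) * (ts s - t0) @[s --> U] -->
      xs ord0 j + d (sigma, j) (b j) * (t0 - t0).
    apply: cvgD; first exact: cvg_cst.
    by apply: cvgM => //; apply: cvgB => //; exact: cvg_cst.
  rewrite subrr mulr0 addr0; apply: cvg_trans; apply: near_eq_cvg.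
  by apply: filterS xE => s /(_ j) <-; rewrite addrC subrK.
have pU p : peval p (x s) @[s --> U] --> peval p xs by apply: meval_cvg => j; exact: xU.
have fxs : peval f xs = t0.
  have E : peval f (x s) @[s --> U] --> t0.
    apply: cvg_trans tsU; apply: near_eq_cvg; apply: filterS Ugood => s gs.
    by have [_ -> _ _] := Hxo s gs.
  exact: (cvg_unique (@Rhausdorff R) (pU f) E).
have xsB i : `|xs ord0 i| <= rho.
  apply: (ler_cvg_to (cvg_norm (xU i)) (cvg_cst rho)); apply: filterS Ugood => s gs.
  by have [xB _ _ _] := Hxo s gs.
have phixs : peval (sqgrad f) xs <= peval (sqgrad f) y.
  have yU : peval (sqgrad f) (ys s) @[s --> U] --> peval (sqgrad f) y by apply: peval_cvg.
  apply: (ler_cvg_to (pU (sqgrad f)) yU); apply: filterS Ugood => s gs.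
  by have [_ _ h _] := Hxo s gs.
have [B B0 HB] := peval_taylor f rho.
pose D := \sum_j `|d (sigma, j) (b j)| + 1.
have D0 : 0 <= D by rewrite addr_ge0 // sumr_ge0.
have qD : U [set s | forall j, `|q j (ts s)| <= D].
  apply: filter_forall => j; apply: (cvgr_le _ (cvg_norm (qU j))).
  by rewrite /D (bigD1 j) //= -addrA ltrDl ltr_wpDl // sumr_ge0.
pose S s := \sum_j peval (mderiv j f) xs * q j (ts s).
(* Taylor at [xs], divided by the increment [Delta] of the level: [f] itself increases by [Delta],
   so the linear term [S s] tends to 1. *)
have key : U [set s | `|1 - S s| <= B * D ^+ 2 * `|ts s - t0|].
  apply: filterS3 (filterI xE Ugood) qD Une => s [xEs gs] qDs tne.
  set Delta := ts s - t0.
  have Delta0 : Delta != 0 by rewrite subr_eq0.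
  have [xB fx _ _] := Hxo s gs.
  have [_ _] := HB xs (x s) xsB xB; rewrite fxs fx -/Delta.
  have -> : gradient_form f xs (x s - xs) = Delta * S s.
    rewrite /gradient_form /S mulr_sumr; apply: eq_bigr => j _.
    by rewrite !mxE; have := xEs j; rewrite mxE => ->; rewrite mulrA mulrC.
  have xxs : `|x s - xs| <= D * `|Delta|.
    apply: sup_norm_le => [|i]; first by rewrite mulr_ge0.
    by rewrite !mxE; have := xEs i; rewrite mxE => ->; rewrite normrM ler_wpM2r.
  have -> : Delta - Delta * S s = Delta * (1 - S s) by ring.
  rewrite normrM => h.
  have : `|Delta| * `|1 - S s| <= `|Delta| * (B * D ^+ 2 * `|Delta|).
    have E2 (N : R) : N * (B * D ^+ 2 * N) = B * (D * N) ^+ 2 by ring.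
    apply: le_trans h _; rewrite E2.
    by rewrite ler_wpM2l // lerXn2r // nnegrE ?normr_ge0 ?mulr_ge0.
  by rewrite ler_pM2l // normr_gt0.
pose S0 := \sum_j peval (mderiv j f) xs * d (sigma, j) (b j).
have SU : `|1 - S s| @[s --> U] --> `|1 - S0|.
  apply: cvg_norm; apply: cvgB; first exact: cvg_cst.
  by apply: cvg_sumr => j; apply: cvgM => //; exact: cvg_cst.
have DU : B * D ^+ 2 * `|ts s - t0| @[s --> U] --> B * D ^+ 2 * `|t0 - t0|.
  apply: cvgM; first exact: cvg_cst.
  by apply: cvg_norm; apply: cvgB => //; exact: cvg_cst.
have S01 : 1 = S0.
  have : `|1 - S0| <= B * D ^+ 2 * `|t0 - t0| by apply: (ler_cvg_to SU DU).
  rewrite subrr normr0 mulr0 normr_le0.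
  by rewrite subr_eq0 => /eqP.
set ga := Num.sqrt _.
have ga0 : 0 <= ga by exact: sqrtr_ge0.
(* Each partial derivative at [xs] is bounded by the gradient there, hence by the gradient at
   [y]. *)
have le1 : 1 <= ga * (\sum_j `|d (sigma, j) (b j)|).
  rewrite {1}S01 mulr_sumr; apply: ler_sum => j _.
  rewrite (le_trans (ler_norm _)) // normrM ler_wpM2r //.
  by rewrite (le_trans (sqgrad_ge _ _ _)) // ler_wsqrtr.
have le2 : \sum_j `|d (sigma, j) (b j)| <= \sum_q \sum_i `|d q i|.
  have -> : \sum_q \sum_i `|d q i| = \sum_s \sum_j \sum_i `|d (s, j) i|.
    by rewrite [RHS]pair_bigA /=; apply: eq_bigr => -[].
  rewrite (bigD1 sigma) //=.
  apply: ler_wpDr; first by apply: sumr_ge0 => s _; apply: sumr_ge0 => j _; apply: sumr_ge0.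
  apply: ler_sum => j _; rewrite (bigD1 (b j)) //= lerDl; exact: sumr_ge0.
have : ga * (\sum_j `|d (sigma, j) (b j)|) <= ga * (\sum_q \sum_i `|d q i|) by rewrite ler_wpM2l.
have : ga * (2 * (\sum_q \sum_i `|d q i|)) <= ga * dV by rewrite ler_wpM2l.
by rewrite [dV * _]mulrC; lra.
Unshelve. all: by end_near. Qed.

End GradientBound.
End LevelSets.

Section LocalLojasiewicz.
Variables (R : realType) (n : nat).
Implicit Types (f : mpoly n R) (x y v : 'rV[R]_n).

(** For positive levels the slopes give continuity, at 0 the bound [V t ^+ K <= C * t] does. The
    extension by 0 lets zeros of [f] compete in the minimisation. *)
Lemma gauge_continuous (e C : R) K (V : R -> R) : (0 < K)%N -> 0 < e -> 0 <= C ->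
  (forall t, 0 < t < e -> 0 <= V t /\ V t ^+ K <= C * t) ->
  (forall t, 0 < t < e -> exists dV, slope V t dV) ->
  let V0 t := if 0 < t then V t else 0 in
  forall t, t < e -> V0 t' @[t' --> t] --> V0 t.
Proof.
move=> K0 e0 C0 HV slo V0 t te; have [t0|t0|t0] := ltgtP t 0.
- rewrite /V0 ltNge (ltW t0) /=; apply: cvg_near_cst.
  have : \forall s \near t, s < 0 by apply: lt_nbhsl.
  by apply: filterS => s s0; rewrite ltNge (ltW s0).
- rewrite {2}/V0 t0; have [|dV sV] := slo t; first by rewrite t0.
  apply: cvg_trans (slope_continuous sV); apply: near_eq_cvg.
  have : \forall s \near t, 0 < s by apply: lt_nbhsr.
  by apply: filterS => s s0; rewrite /V0 s0.
rewrite t0 {2}/V0 ltxx; apply/cvgrPdist_lt => eta eta0.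
have h0 : 0 < Num.min e (eta ^+ K / (C + 1)).
  by rewrite lt_min e0 divr_gt0 ?exprn_gt0 // ltr_wpDl.
have : \forall s \near (0 : R), s < Num.min e (eta ^+ K / (C + 1)) by apply: lt_nbhsl.
apply: filterS => s; rewrite lt_min => /andP[se sh]; rewrite sub0r normrN /V0.
case: ifP => s0; last by rewrite normr0.
have [|V1 V2] := HV s; first by rewrite s0.
rewrite ger0_norm //; rewrite ltNge; apply/negP => etaV.
have h : eta ^+ K <= C * s.
  by apply: le_trans V2; rewrite lerXn2r // nnegrE // ltW.
move: sh; rewrite ltr_pdivlMr ?ltr_wpDl // => sh; nra.
Qed.

Lemma sublevel_compact f (rho c : R) :
  compact [set x : 'rV[R]_n | (forall i, `|x ord0 i| <= rho) /\ peval f x <= c].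
Proof.
have -> : [set x : 'rV[R]_n | (forall i, `|x ord0 i| <= rho) /\ peval f x <= c] =
    [set x : 'rV[R]_n | forall i, `|x ord0 i| <= rho] `&` (peval f @^-1` [set t | t <= c]).
  by [].
apply: compact_closedI; first exact: box_compact.
apply: closed_comp; last exact: closed_le.
by move=> x _; exact: peval_continuous.
Qed.

Theorem local_lojasiewicz f D (rho : R) : (0 < n)%N -> (1 < D)%N ->
  (msize f <= D.+1)%N -> (forall x, 0 <= peval f x) -> 0 <= rho ->
  exists2 c : R, 0 < c & forall x, (forall i, `|x ord0 i| <= rho) ->
    (exists2 z, peval f z = 0 &
       c * `|x - z| ^+ (D * (3 * D - 3) ^ (n - 1)) <= peval f x) \/
    c <= peval f x.
Proof.
move=> n0 D1 fD f0 rho0; set K := (D * _)%N.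
have K0 : (0 < K)%N by rewrite muln_gt0 expn_gt0; lia.
have [fcst|/existsNP[u1 /existsNP[u2 u12]]] := pselect (forall x y, peval f x = peval f y).
  have [f00|f00] := eqVneq (peval f 0) 0.
    exists 1 => // x _; left; exists x; first by rewrite (fcst x 0).
    by rewrite subrr normr0 expr0n gtn_eqF // mulr0 f0.
  exists (peval f 0); first by rewrite lt_def f00 f0.
  by move=> x _; right; rewrite (fcst x 0).
have f1 : (1 < msize f)%N.
  rewrite ltnNge; apply/negP => fs; apply: u12.
  by rewrite (msize1_polyC fs) !pevalC.
(* The larger box leaves room: the minimiser will be at distance less than 1 from [x], hence in the
   interior. *)
pose r := rho + 1.
have r0 : 0 < r by rewrite ltr_wpDl.
have [P [HP tal]] := talweg r0 n0 D1 f1 fD.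
pose P' q := P q.1 q.2.
have [||e [C [m [xi [V [e0 C0 HV slo compl]]]]]] := @level_gauge R _ P' K r K0.
- exact: ltW.
- by move=> q; exact: HP.
have slo' t : 0 < t < e -> exists dV, slope V t dV.
  by move=> /slo[dV [d [sV _ _]]]; exists dV.
have Vc := gauge_continuous K0 e0 C0 HV slo'.
set V0 := fun t => _ in Vc.
(* Below this level [V ^ K <= C * f < 1], so that [V < 1]. *)
pose e1 := Num.min e (C + 1)^-1.
have C1 : 0 < C + 1 by rewrite ltr_wpDl.
have e10 : 0 < e1 by rewrite lt_min e0 invr_gt0.
exists (Num.min e1 (C + 1)^-1); first by rewrite lt_min e10 invr_gt0.
move=> x xB; set c := Num.min _ _.
have c0 : 0 <= c by rewrite le_min (ltW e10) invr_ge0 ltW.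
have [fx|fx] := leP e1 (peval f x); first by right; rewrite ge_min fx.
left; have [fx0|fx0] := eqVneq (peval f x) 0.
  by exists x => //; rewrite subrr normr0 expr0n gtn_eqF // mulr0 fx0.
have fx_gt0 : 0 < peval f x by rewrite lt_def fx0 f0.
have [fxe fxC] : peval f x < e /\ peval f x < (C + 1)^-1.
  by move: fx; rewrite lt_min => /andP.
pose A := [set y : 'rV[R]_n | (forall i, `|y ord0 i| <= r) /\ peval f y <= peval f x].
(* At a minimiser of [Xi] with [f > 0], a step against the gradient of [f] would
   decrease [V0 (f y)] by at least twice its length. *)
pose Xi y := V0 (peval f y) + `|y - x|.
have A0 : A !=set0.
  by exists x; split => // i; rewrite (le_trans (xB i)) // lerDl.
have distc : continuous (fun z : 'rV[R]_n => `|z - x|).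
  move=> z; apply: (@cvg_norm _ 'rV[R]_n _ (nbhs z) _ (fun w : 'rV[R]_n => w - x)).
  exact: (@cvgB _ 'rV[R]_n _ (nbhs z) _ id (cst x) z x cvg_id (cvg_cst x)).
have XiC : {within A, continuous Xi}.
  apply: continuous_in_subspaceT => y; rewrite inE => -[_ fy].
  have h1 : peval f z @[z --> y] --> peval f y by exact: peval_continuous.
  have h2 := Vc (peval f y) (le_lt_trans fy fxe).
  have h3 : V0 (peval f z) @[z --> y] --> V0 (peval f y) by apply: cvg_comp h1 h2.
  exact: cvgD h3 (distc y).
have [y /set_mem[yB fyx] ymin] := EVT_min_rV A0 (@sublevel_compact f r (peval f x)) XiC.
have Vx : V0 (peval f x) = V (peval f x) by rewrite /V0 fx_gt0.
have [V1 V2] : 0 <= V (peval f x) /\ V (peval f x) ^+ K <= C * peval f x.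
  by apply: HV; rewrite fx_gt0.
have V0_ge0 t : t < e -> 0 <= V0 t.
  by move=> te; rewrite /V0; case: ifP => // t0; have [] := HV t; rewrite ?t0.
have yx : `|y - x| <= V (peval f x).
  have Ax : A x by split => // i; rewrite (le_trans (xB i)) // lerDl.
  have := ymin x (mem_set Ax); rewrite /Xi subrr normr0 addr0 Vx.
  by have := V0_ge0 _ (le_lt_trans fyx fxe); lra.
have V_lt1 : V (peval f x) < 1.
  have CK : V (peval f x) ^+ K < 1.
    apply: le_lt_trans V2 _; move: fxC; rewrite -[(C + 1)^-1]mul1r ltr_pdivlMr //.
    by nra.
  rewrite ltNge; apply/negP => V_ge1; move: CK.
  by rewrite ltNge exprn_ege1.
suff fy0 : peval f y = 0.
  exists y => //; rewrite distrC.
  apply: le_trans (_ : c * V (peval f x) ^+ K <= _).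
    by rewrite ler_wpM2l // lerXn2r // nnegrE.
  apply: le_trans (_ : (C + 1)^-1 * (C * peval f x) <= _).
    apply: ler_pM => //; first exact: exprn_ge0.
    by rewrite ge_min lexx orbT.
  by rewrite mulrC ler_pdivrMr // mulrC ler_wpM2l ?f0 // lerDl.
apply/eqP/negPn/negP => fy0.
have fy_gt0 : 0 < peval f y by rewrite lt_def fy0 f0.
have fye : 0 < peval f y < e by rewrite fy_gt0 (le_lt_trans fyx).
have yB' i : `|y ord0 i| < r.
  have := sup_norm_ge (y - x) i; rewrite !mxE => h.
  rewrite -[y ord0 i](subrK (x ord0 i)) (le_lt_trans (ler_normD _ _)) // /r addrC.
  by apply: ler_ltD (xB i) _; apply: le_lt_trans h (le_lt_trans yx V_lt1).
have [u uy] : exists u, peval f u != peval f y.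
  have [E|ne] := eqVneq (peval f u1) (peval f y); last by exists u1.
  by exists u2; apply/eqP => E2; apply: u12; rewrite E E2.
have [dV sV dVga] := gradient_bound tal slo compl yB' fye uy.
set ga := Num.sqrt _ in dVga.
have ga0 : 0 < ga.
  rewrite lt_def sqrtr_ge0 andbT; apply/eqP => E.
  by move: dVga; rewrite E mulr0; lra.
have phi0 : 0 <= peval (sqgrad f) y.
  by rewrite sqgradE sumr_ge0 // => i _; exact: sqr_ge0.
have gaE : peval (sqgrad f) y = ga ^+ 2 by rewrite sqr_sqrtr.
pose g : 'rV[R]_n := \row_i peval (mderiv i f) y.
pose ys s := y - s *: g.
have gle : `|g| <= ga.
  by apply: sup_norm_le => [|i]; [exact: ltW|rewrite mxE sqgrad_ge].
have [B B0 HB] := peval_taylor f r.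
have ysc : ys s @[s --> 0^'+] --> y.
  have : y - s *: g @[s --> (0 : R)] --> y - 0 *: g.
    apply: cvgB; first exact: cvg_cst.
    by apply: cvgZ; [exact: cvg_id|exact: cvg_cst].
  by rewrite scale0r subr0 => h; exact: cvg_at_right_filter.
have fysc : peval f (ys s) @[s --> 0^'+] --> peval f y by apply: peval_cvg.
have ysB : \forall s \near 0^'+, forall i, `|ys s ord0 i| <= r.
  have h i : \forall s \near 0^'+, `|ys s ord0 i| <= r.
    by apply: (cvgr_le _ (cvg_norm (coord_cvg _ ysc (i := i)))).
  exact: (filter_forall _ h).
have s0 : \forall s \near 0^'+, (0 : R) < s by exact: nbhs_right_gt.
have dec : \forall s \near 0^'+,
    `|peval f (ys s) - peval f y + s * ga ^+ 2| <= B * ga ^+ 2 * s ^+ 2.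
  near=> s.
  have sp : 0 < s by near: s.
  have yb : forall i, `|ys s ord0 i| <= r by near: s.
  have [_ _] := HB y (ys s) yB yb.
  have -> : ys s - y = - s *: g by rewrite /ys addrAC subrr add0r scaleNr.
  have -> : gradient_form f y (- s *: g) = - (s * ga ^+ 2).
    rewrite -gaE sqgradE mulr_sumr -sumrN; apply: eq_bigr => i _.
    by rewrite !mxE; ring.
  rewrite opprK => /le_trans; apply; rewrite -mulrA ler_wpM2l //.
  rewrite normrZ normrN (gtr0_norm sp) mulrC -exprMn.
  by rewrite lerXn2r ?nnegrE ?mulr_ge0 ?(ltW sp) ?(ltW ga0) // ler_wpM2r // ltW.
have [q [qd Hq]] := sV.
have qc : q (peval f (ys s)) @[s --> 0^'+] --> dV by apply: cvg_comp fysc qd.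
have Hqs : \forall s \near 0^'+, V (peval f (ys s)) - V (peval f y) =
    q (peval f (ys s)) * (peval f (ys s) - peval f y) by exact: (fysc _ Hq).
have fpos : \forall s \near 0^'+, 0 < peval f (ys s) by apply: (cvgr_gt _ fysc).
(* The difference quotient of [f] in the direction opposite to the gradient; times [q], it is the
   rate of change of [V] at the level of [f]. *)
pose quo s := (peval f (ys s) - peval f y) / s.
have quoc : quo s @[s --> 0^'+] --> - ga ^+ 2.
  apply/cvgrPdist_le => eta eta0.
  have ssm : \forall s \near 0^'+, B * ga ^+ 2 * s <= eta.
    have h : B * ga ^+ 2 * s @[s --> 0^'+] --> B * ga ^+ 2 * 0.
      apply: cvgM; first exact: cvg_cst.
      by apply: cvg_at_right_filter; exact: cvg_id.
    by rewrite mulr0 in h; apply: (cvgr_le _ h).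
  near=> s; have sp : 0 < s by near: s.
  have -> : - ga ^+ 2 - quo s = - (peval f (ys s) - peval f y + s * ga ^+ 2) / s.
    by rewrite /quo; field; rewrite gt_eqF.
  rewrite normrM normrN normfV (gtr0_norm sp) ler_pdivrMr //.
  apply: le_trans (_ : B * ga ^+ 2 * s * s <= _).
    by rewrite -mulrA -expr2; near: s.
  by rewrite ler_wpM2r ?(ltW sp) //; near: s.
have small : \forall s \near 0^'+, quo s < 0.
  by apply: (cvgr_lt _ quoc); rewrite oppr_lt0 exprn_gt0.
have ineq : \forall s \near 0^'+, 0 <= q (peval f (ys s)) * quo s + ga.
  near=> s; have sp : 0 < s by near: s.
  have yb : forall i, `|ys s ord0 i| <= r by near: s.
  have quo0 : quo s < 0 by near: s.
  have fys : peval f (ys s) <= peval f y.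
    by rewrite -subr_le0; move: quo0; rewrite /quo pmulr_llt0 ?invr_gt0 // => /ltW.
  have As : A (ys s) by split => //; exact: le_trans fys fyx.
  have := ymin _ (mem_set As); rewrite /Xi /V0 fy_gt0.
  have -> : 0 < peval f (ys s) by near: s.
  have E : V (peval f (ys s)) - V (peval f y) =
    q (peval f (ys s)) * (peval f (ys s) - peval f y) by near: s.
  have tri : `|ys s - x| <= s * ga + `|y - x|.
    have -> : ys s - x = - s *: g + (y - x) by rewrite /ys scaleNr addrAC addrC.
    rewrite (le_trans (ler_normD _ _)) // lerD2r normrZ normrN (gtr0_norm sp).
    by rewrite ler_wpM2l // ltW.
  move=> h; have : 0 <= s * (q (peval f (ys s)) * quo s + ga).
    have -> : s * (q (peval f (ys s)) * quo s + ga) =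
       q (peval f (ys s)) * (peval f (ys s) - peval f y) + s * ga.
      by rewrite /quo; field; rewrite gt_eqF.
    by rewrite -E; lra.
  by rewrite pmulr_rge0.
(* In the limit, minimality reads [0 <= ga * (1 - dV * ga)], contradicting [2 <= dV * ga]. *)
have lim : q (peval f (ys s)) * quo s + ga @[s --> 0^'+] --> dV * (- ga ^+ 2) + ga.
  by apply: cvgD; [exact: cvgM|exact: cvg_cst].
have : 0 <= dV * (- ga ^+ 2) + ga by apply: (cvgr_to_ge lim).
have -> : dV * (- ga ^+ 2) + ga = ga * (1 - dV * ga) by ring.
by rewrite pmulr_rge0 //; lra.
Unshelve. all: by end_near. Qed.

End LocalLojasiewicz.

(** * From the cube to the whole space *)

Section MonomialSubstitution.
Variables (R : realType) (n k : nat).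
Variables (tau : multinom n -> multinom k) (c : multinom n -> R).
Implicit Types p : mpoly n R.

(** One linear, in general not multiplicative, operation covers adding variables, homogenising and
    passing to a chart. *)
Definition mono_subst p : mpoly k R :=
  \sum_(m <- msupp p) (mcoeff m p * c m) *: mpolyX R (tau m).

Lemma meval_mono_subst p (w : 'I_k -> R) (v : 'I_n -> R) (om : R) :
  (forall m, m \in msupp p ->
     c m * meval w (mpolyX R (tau m)) = om * meval v (mpolyX R m)) ->
  meval w (mono_subst p) = om * meval v p.
Proof.
move=> H; rewrite {2}[p]mpolyE /mono_subst !raddf_sum /= mulr_sumr.
rewrite big_seq [RHS]big_seq; apply: eq_bigr => m mp.
by rewrite !mevalZ -mulrA H // mulrCA.
Qed.

Lemma msize_mono_subst p d :
  (forall m, m \in msupp p -> (mdeg (tau m) <= d)%N) ->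
  (msize (mono_subst p) <= d.+1)%N.
Proof.
move=> H; rewrite /mono_subst big_seq_cond; apply: msize_sum_le => m /andP[mp _].
by rewrite (leq_trans (msizeZ_le _ _)) // msizeX ltnS H.
Qed.

End MonomialSubstitution.

Section Extend.
Variables (R : realType) (N r : nat).
Implicit Types (p : mpoly N R).

Definition extend_mnm (j : 'I_r -> nat) (m : multinom N) : multinom (N + r) :=
  Multinom (mktuple (fun k => match fintype.split k with inl i => m i | inr l => j l end)).

Lemma extend_mnm_l j m i : extend_mnm j m (lshift r i) = m i.
Proof. by rewrite mnmE (unsplitK (inl i)). Qed.

Lemma extend_mnm_r j m l : extend_mnm j m (rshift N l) = j l.
Proof. by rewrite mnmE (unsplitK (inr l)). Qed.

Lemma mdeg_extend j m : mdeg (extend_mnm j m) = (mdeg m + \sum_l j l)%N.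
Proof.
rewrite !mdegE big_split_ord /=; congr addn; apply: eq_bigr => i _.
  by rewrite extend_mnm_l.
by rewrite extend_mnm_r.
Qed.

Lemma meval_extend j m (u : 'rV[R]_N) (t : 'rV[R]_r) :
  meval (fun k => row_mx u t ord0 k) (mpolyX R (extend_mnm j m)) =
  meval (fun i => u ord0 i) (mpolyX R m) * \prod_l t ord0 l ^+ j l.
Proof.
rewrite !mevalX big_split_ord /=; congr (_ * _); apply: eq_bigr => i _.
  by rewrite extend_mnm_l row_mxEl.
by rewrite extend_mnm_r row_mxEr.
Qed.

Definition extend p : mpoly (N + r) R := mono_subst (extend_mnm (fun=> 0%N)) (fun=> 1) p.

Lemma peval_extend p (u : 'rV[R]_N) (t : 'rV[R]_r) :
  peval (extend p) (row_mx u t) = peval p u.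
Proof.
rewrite /peval /extend (@meval_mono_subst _ _ _ _ _ _ _ (fun i => u ord0 i) 1) ?mul1r //.
by move=> m _; rewrite meval_extend big1 ?mulr1.
Qed.

Lemma msize_extend p d : (msize p <= d.+1)%N -> (msize (extend p) <= d.+1)%N.
Proof.
move=> pd; apply: msize_mono_subst => m /msize_mdeg_lt mp.
by rewrite mdeg_extend big1 // addn0 -ltnS (leq_trans mp).
Qed.

End Extend.

(** Homogenised in degree [d] by one more variable, [p] is evaluated at [(x / rho, 1 / rho)] in the
    unit cube, where one Lipschitz constant serves; scaling back costs [rho ^ d]. *)
Lemma poly_growth (R : realType) N (p : mpoly N R) d : (msize p <= d.+1)%N ->
  exists2 B : R, 0 <= B & forall (x y : 'rV[R]_N) (rho : R), 1 <= rho ->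
    `|x| <= rho -> `|y| <= rho -> `|peval p x - peval p y| <= B * rho ^+ d * `|x - y|.
Proof.
move=> pd; pose tau (m : multinom N) : multinom (N + 1) :=
  extend_mnm (fun=> (d - mdeg m)%N) m.
pose H := mono_subst tau (fun=> (1 : R)) p.
have [B B0 HB] := peval_taylor H 1.
exists B => // x y rho rho1 xr yr; have rho0 : 0 < rho by exact: lt_le_trans rho1.
pose w (x : 'rV[R]_N) : 'rV[R]_(N + 1) := row_mx (rho^-1 *: x) (const_mx rho^-1).
have pE x' : peval p x' = rho ^+ d * peval H (w x').
  rewrite /H /peval (@meval_mono_subst _ _ _ _ _ _ _ (fun i => x' ord0 i) (rho ^- d)).
    by rewrite mulrA mulfV ?mul1r // expf_neq0 // gt_eqF.
  move=> m /msize_mdeg_lt mp; rewrite mul1r meval_extend big_ord1 mxE mulrC.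
  have md : (mdeg m <= d)%N by rewrite -ltnS (leq_trans mp).
  rewrite -{2}(subnK md) exprD invfM -exprVn -mulrA; congr (_ * _).
  rewrite !mevalX -exprVn mdegE expr_sum -big_split /=; apply: eq_bigr => i _.
  by rewrite !mxE exprMn.
have wB (x' : 'rV[R]_N) : `|x'| <= rho -> forall k, `|w x' ord0 k| <= 1.
  move=> xr' k; rewrite mxE; case: fintype.split => i; rewrite !mxE.
    rewrite normrM normfV (gtr0_norm rho0) mulrC ler_pdivrMr // mul1r.
    exact: le_trans (sup_norm_ge _ _) xr'.
  by rewrite normfV (gtr0_norm rho0) invf_le1.
have [_ Hlip _] := HB (w y) (w x) (wB y yr) (wB x xr).
rewrite !pE -mulrBr normrM normrX (gtr0_norm rho0) [B * _]mulrC -mulrA.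
rewrite ler_wpM2l ?exprn_ge0 ?(ltW rho0) // (le_trans Hlip) // ler_wpM2l //.
apply: sup_norm_le => // k; rewrite !mxE; case: fintype.split => i; rewrite !mxE; last first.
  by rewrite subrr normr0.
rewrite -mulrBr normrM normfV (gtr0_norm rho0).
have h := sup_norm_ge (x - y) i; rewrite !mxE in h.
by apply: le_trans h; rewrite ler_piMl // invf_le1.
Qed.

(** The least value, over all slacks t, of the sum of squares of the equations: the minimum of (g -
    t^2)^2 over t is max(0, -g)^2. *)
Definition violation (R : realType) N (gs hs : seq (mpoly N R)) (x : 'rV[R]_N) : R :=
  \sum_(h <- hs) peval h x ^+ 2 + \sum_(g <- gs) Num.max 0 (- peval g x) ^+ 2.

(* An inequality [g >= 0] is turned into an equation [g = t ^ 2] in one more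
   variable; [gs] is padded with zero polynomials. *)
Lemma basic_local_lojasiewicz (R : realType) N r d (gs hs : seq (mpoly N R)) :
  (0 < N)%N -> (1 < d)%N -> (size gs <= r)%N ->
  (forall p, p \in gs ++ hs -> (msize p <= d.+1)%N) ->
  exists2 c : R, 0 < c & forall u : 'rV[R]_N, `|u| <= 1 ->
    (exists z : 'rV[R]_N, [/\ forall g, g \in gs -> 0 <= peval g z,
       forall h, h \in hs -> peval h z = 0 &
       c * (`|u - z| ^+ (d * (6 * d - 3) ^ (N + r - 1))) ^+ 2 <= violation gs hs u]) \/
    c <= violation gs hs u.
Proof.
move=> N0 d1 gr degs.
pose slack (j : 'I_r) : mpoly (N + r) R :=
  extend r (nth 0 gs j) - mpolyX R (mnm1 (rshift N j)) ^+ 2.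
pose F : mpoly (N + r) R := \sum_(h <- hs) extend r h ^+ 2 + \sum_j slack j ^+ 2.
have FE u t : peval F (row_mx u t) = \sum_(h <- hs) peval h u ^+ 2 +
    \sum_(j < r) (peval (nth 0 gs j) u - t ord0 j ^+ 2) ^+ 2.
  rewrite /F pevalD; congr (_ + _); rewrite /peval raddf_sum; apply: eq_bigr => i _ /=.
    by rewrite expr2 mevalM -expr2 -[X in X ^+ 2]/(peval _ _) peval_extend.
  rewrite expr2 mevalM -expr2 mevalB -[X in X - _]/(peval _ _) peval_extend.
  by rewrite expr2 mevalM !mevalXU row_mxEr -expr2.
have FD : (msize F <= (2 * d).+1)%N.
  apply: msizeD_leS.
    rewrite big_seq_cond; apply: msize_sum_le => h /andP[hh _]; rewrite mulnC.
    by apply/msizeX_leS/msize_extend/degs; rewrite mem_cat hh orbT.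
  apply: msize_sum_le => j _; rewrite mulnC; apply: msizeX_leS; apply: msizeD_leS.
    apply: msize_extend; case: (ltnP j (size gs)) => jg.
      by apply: degs; rewrite mem_cat mem_nth.
    by rewrite nth_default // msize0.
  rewrite msizeN (leq_trans (_ : _ <= 3)%N) //; apply: (@msizeX_leS _ _ _ 1 2).
  by rewrite msizeU.
have F_ge0 (w : 'rV[R]_(N + r)) : 0 <= peval F w.
  by rewrite -[w]hsubmxK FE addr_ge0 // sumr_ge0 // => *; exact: sqr_ge0.
have /choice[B HB] : forall j : 'I_r, exists B : R, 0 <= B /\
    forall u : 'rV[R]_N, `|u| <= 1 -> `|peval (nth 0 gs j) u| <= B.
  move=> j; have [B B0 HB] := peval_taylor (nth 0 gs j) 1; exists B; split=> // u u1.
  have ub i : `|u ord0 i| <= 1 by exact: le_trans (sup_norm_ge _ _) u1.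
  by have [] := HB u u ub ub.
(* Large enough for the optimal slacks: their squares are at most [rho], and [rho <= rho ^ 2]. *)
pose rho := 1 + \sum_j B j.
have rhoB j : B j <= rho.
  rewrite /rho (bigD1 j) //= addrCA lerDl addr_ge0 // sumr_ge0 // => i _.
  by have [] := HB i.
have rho1 : 1 <= rho by rewrite lerDl sumr_ge0 // => i _; have [] := HB i.
have [|||c c0 Hc] := @local_lojasiewicz R (N + r) F (2 * d) rho _ _ FD F_ge0.
- by rewrite addn_gt0 N0.
- lia.
- exact: le_trans rho1.
exists c => // u u1.
pose t : 'rV[R]_r := \row_j Num.sqrt (Num.max 0 (peval (nth 0 gs j) u)).
have Fv : peval F (row_mx u t) = violation gs hs u.
  rewrite FE /violation; congr (_ + _).
  have term (g : R) : (g - Num.sqrt (Num.max 0 g) ^+ 2) ^+ 2 = Num.max 0 (- g) ^+ 2.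
    rewrite sqr_sqrtr ?le_max ?lexx //; have [g0|g0] := leP 0 g.
      by rewrite subrr max_l // oppr_le0.
    by rewrite subr0 max_r ?sqrrN // oppr_ge0 ltW.
  under eq_bigr do rewrite mxE term.
  rewrite (big_nth 0) big_mkord [RHS](big_ord_widen _
    (fun i => Num.max 0 (- peval (nth 0 gs i) u) ^+ 2) gr) big_mkcond /=.
  rewrite [RHS]big_mkcond; apply: eq_bigr => j _; case: ltnP => // jg.
  by rewrite nth_default // /peval meval0 oppr0 maxxx expr0n.
have wB k : `|row_mx u t ord0 k| <= rho.
  rewrite mxE; case: fintype.split => i.
    exact: le_trans (sup_norm_ge _ _) (le_trans u1 rho1).
  rewrite mxE ger0_norm ?sqrtr_ge0 //.
  have g1 : Num.max 0 (peval (nth 0 gs i) u) <= rho.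
    rewrite ge_max (le_trans ler01 rho1) /= (le_trans (ler_norm _)) //.
    by apply: le_trans (rhoB i); have [_ ->] := HB i.
  rewrite -(ger0_norm (le_trans ler01 rho1)) -sqrtr_sqr ler_wsqrtr //.
  by apply: le_trans g1 _; rewrite expr2 ler_peMl // (le_trans ler01).
have := Hc (row_mx u t) wB; rewrite Fv => -[[z Fz Hz]|]; [left|by right].
rewrite -[z]hsubmxK in Fz Hz.
set z1 := lsubmx z in Fz Hz; set z2 := rsubmx z in Fz Hz.
move: Fz; rewrite FE => /eqP; rewrite paddr_eq0; last 2 first.
- by rewrite sumr_ge0 // => *; exact: sqr_ge0.
- by rewrite sumr_ge0 // => *; exact: sqr_ge0.
rewrite !psumr_eq0 => [/andP[/allP hz /allP gz]|*|*]; try exact: sqr_ge0.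
exists z1; split.
- move=> g gg; have jg : (index g gs < r)%N by rewrite (leq_trans _ gr) // index_mem.
  have := gz (Ordinal jg) (mem_index_enum _); rewrite /= nth_index // sqrf_eq0 subr_eq0.
  by move=> /eqP ->; exact: sqr_ge0.
- by move=> h hh; have := hz h hh; rewrite /= sqrf_eq0 => /eqP.
(* The exponent for degree [2 * d] is twice the claimed one; the outer square absorbs this. *)
apply: le_trans Hz; rewrite ler_wpM2l ?(ltW c0) // -exprM mulnC.
rewrite (_ : 2 * (d * (6 * d - 3) ^ (N + r - 1)) =
  2 * d * (3 * (2 * d) - 3) ^ (N + r - 1))%N; last by rewrite mulnA mulnA.
rewrite lerXn2r ?nnegrE //; apply: sup_norm_le => // i.
rewrite -[(u - z1) ord0 i](row_mxEl (u - z1) (t - z2)) -add_row_mx -opp_row_mx.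
exact: sup_norm_ge.
Qed.

Section Charts.
Variables (R : realType) (N : nat).
Implicit Types (p g h : mpoly N R) (x y z u : 'rV[R]_N).

Lemma poly_growth_all (ps : seq (mpoly N R)) d :
  (forall p, p \in ps -> (msize p <= d.+1)%N) ->
  exists2 B : R, 0 <= B & forall p x y (rho : R), p \in ps -> 1 <= rho ->
    `|x| <= rho -> `|y| <= rho -> `|peval p x - peval p y| <= B * rho ^+ d * `|x - y|.
Proof.
elim: ps => [|p ps IH] H; first by exists 0.
have [|B B0 HB] := IH; first by move=> q qps; apply: H; rewrite inE qps orbT.
have [|C C0 HC] := @poly_growth _ _ p d; first by apply: H; rewrite mem_head.
exists (B + C) => [|q x y rho]; first exact: addr_ge0.
rewrite inE => /orP[/eqP ->|qps] rho1 xr yr.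
  apply: le_trans (HC x y rho rho1 xr yr) _.
  by rewrite !ler_wpM2r ?exprn_ge0 ?(le_trans ler01 rho1) // lerDr.
apply: le_trans (HB q x y rho qps rho1 xr yr) _.
by rewrite !ler_wpM2r ?exprn_ge0 ?(le_trans ler01 rho1) // lerDl.
Qed.

Lemma sum_seq_le (T : eqType) (s : seq T) (F : T -> R) (b : R) :
  (forall i, i \in s -> F i <= b) -> \sum_(i <- s) F i <= (size s)%:R * b.
Proof.
elim: s => [|i s IH] H; first by rewrite big_nil mul0r.
rewrite big_cons /= -natr1 mulrDl mul1r addrC lerD ?H ?mem_head //.
by apply: IH => j js; rewrite H // inE js orbT.
Qed.

Lemma violation_le (gs hs : seq (mpoly N R)) x (L : R) : 0 <= L ->
  (forall g, g \in gs -> - peval g x <= L) ->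
  (forall h, h \in hs -> `|peval h x| <= L) ->
  violation gs hs x <= (size gs + size hs)%:R * L ^+ 2.
Proof.
move=> L0 Hg Hh; rewrite addnC natrD mulrDl /violation; apply: lerD.
  apply: sum_seq_le => h hh; rewrite -real_normK ?num_real //.
  by rewrite lerXn2r ?nnegrE ?Hh.
apply: sum_seq_le => g hg; rewrite lerXn2r ?nnegrE ?le_max ?lexx //.
by rewrite ge_max L0 Hg.
Qed.

(** Homogenise in degree [d], set the [k]-th variable to a constant, and let its slot hold the
    homogenising variable. *)
Definition chart_mnm (k : 'I_N) (d : nat) (m : multinom N) : multinom N :=
  Multinom (mktuple (fun i => if i == k then (d - mdeg m)%N else m i)).

(* The chart [u] of projective space in which [u_k] is the homogeneous
   coordinate: [u] stands for the point with coordinates [u_i / u_k], except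
   for the [k]-th one, which is [eps / u_k]. *)
Definition chart_poly (k : 'I_N) (d : nat) (eps : R) p : mpoly N R :=
  mono_subst (chart_mnm k d) (fun m => eps ^+ m k) p.

Definition chart_point (k : 'I_N) (eps : R) u : 'rV[R]_N :=
  \row_i ((if i == k then eps else u ord0 i) / u ord0 k).

Lemma peval_chart k d eps p u : (msize p <= d.+1)%N -> u ord0 k != 0 ->
  peval (chart_poly k d eps p) u = u ord0 k ^+ d * peval p (chart_point k eps u).
Proof.
move=> pd uk; apply: meval_mono_subst => m /msize_mdeg_lt mp.
have md : (mdeg m <= d)%N by rewrite -ltnS (leq_trans mp).
have -> : u ord0 k ^+ d = u ord0 k ^+ (d - mdeg m) * \prod_i u ord0 k ^+ m i.
  by rewrite -expr_sum -mdegE -exprD subnK.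
rewrite !mevalX -mulrA -big_split /= (bigD1 k) //= mnmE eqxx mulrCA; congr (_ * _).
rewrite [RHS](bigD1 k) //= /chart_point mxE eqxx exprMn exprVn [u _ _ ^+ _ * _]mulrCA.
rewrite mulfV ?expf_neq0 // mulr1; congr (_ * _).
apply: eq_bigr => i ik; rewrite mnmE mxE (negPf ik) exprMn exprVn.
by rewrite mulrCA mulfV ?expf_neq0 // mulr1.
Qed.

Lemma msize_chart k d eps p : (msize p <= d.+1)%N ->
  (msize (chart_poly k d eps p) <= d.+1)%N.
Proof.
move=> pd; apply: msize_mono_subst => m /msize_mdeg_lt mp.
have md : (mdeg m <= d)%N by rewrite -ltnS (leq_trans mp).
rewrite mdegE (bigD1 k) //= mnmE eqxx -leq_subRL ?leq_subr // subKn //.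
rewrite mdegE [leqRHS](bigD1 k) //=; apply: leq_trans (leq_addl _ _).
by apply: leq_sum => i ik; rewrite mnmE (negPf ik).
Qed.

Lemma sup_norm_attained x : (0 < N)%N -> exists k, `|x| = `|x ord0 k|.
Proof.
move=> N0; have [x0|] := eqVneq (mx_norm x) 0.
  exists (Ordinal N0); apply/eqP; rewrite eq_le sup_norm_ge andbT.
  by rewrite [leLHS]x0.
by move=> /mx_norm_neq0[[i k] /= E]; exists k; rewrite [LHS]E ord1.
Qed.

(* [T] is the passage to a chart, [om] the corresponding scaling factor. *)
Lemma chart_inequality r d (gs hs : seq (mpoly N R)) (T : mpoly N R -> mpoly N R) (b : R) :
  (0 < N)%N -> (1 < d)%N -> (size gs <= r)%N -> 0 <= b ->
  (forall p, p \in gs ++ hs -> (msize (T p) <= d.+1)%N) ->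
  exists2 C : R, 0 < C <= 1 & forall u x (om a : R), `|u| <= 1 -> 0 <= a -> 0 <= om ->
    (forall p, p \in gs ++ hs -> peval (T p) u = om * peval p x) ->
    (forall g, g \in gs -> om * - peval g x <= b * a) ->
    (forall h, h \in hs -> om * `|peval h x| <= b * a) ->
    (exists z, [/\ forall g, g \in gs -> 0 <= peval (T g) z,
       forall h, h \in hs -> peval (T h) z = 0 &
       C * `|u - z| ^+ (d * (6 * d - 3) ^ (N + r - 1)) <= a]) \/ C <= a.
Proof.
move=> N0 d1 gr b0 degs; set E := (d * _)%N.
have [||c c0 Hc] := @basic_local_lojasiewicz R N r d (map T gs) (map T hs) N0 d1.
- by rewrite size_map.
- by move=> p; rewrite -map_cat => /mapP[q qgh ->]; exact: degs.
pose M := (size gs + size hs)%:R * b ^+ 2 + 1.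
have M0 : 0 < M by rewrite ltr_wpDl // mulr_ge0 // sqr_ge0.
(* As [C <= 1], also [C ^ 2 * M <= c]; this allows taking square roots in the inequality between
   squares. *)
pose C := Num.min 1 (c / M).
have C0 : 0 < C by rewrite lt_min ltr01 divr_gt0.
have C1 : C <= 1 by rewrite ge_min lexx.
have CM : C ^+ 2 * M <= c.
  rewrite -ler_pdivlMr //; apply: le_trans (_ : C <= _); last by rewrite ge_min lexx orbT.
  by rewrite expr2 ler_piMl // ltW.
exists C => [|u x om a u1 a0 om0 TE Hg Hh]; first by rewrite C0.
have vle : violation (map T gs) (map T hs) u <= M * a ^+ 2.
  apply: le_trans (@violation_le _ _ u (b * a) _ _ _) _.
  - exact: mulr_ge0.
  - move=> _ /mapP[g gg ->]; rewrite TE ?mem_cat ?gg // -mulrN; exact: Hg.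
  - move=> _ /mapP[h hh ->]; rewrite TE ?mem_cat ?hh ?orbT // normrM (ger0_norm om0).
    exact: Hh.
  rewrite !size_map exprMn mulrA /M mulrDl mul1r lerDl; exact: sqr_ge0.
have root X : 0 <= X -> c * X ^+ 2 <= violation (map T gs) (map T hs) u -> C * X <= a.
  move=> X0 cX; rewrite -(@ler_pXn2r _ 2) ?nnegrE ?mulr_ge0 ?(ltW C0) // exprMn.
  rewrite -(ler_pM2l M0) mulrA; apply: le_trans (le_trans cX vle).
  by rewrite ler_wpM2r ?sqr_ge0 // mulrC.
have [[z [gz hz Hz]]|cv] := Hc u u1; [left|right].
  exists z; split.
  - by move=> g gg; apply: gz; exact: map_f.
  - by move=> h hh; apply: hz; exact: map_f.
  - by apply: root Hz; exact: exprn_ge0.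
by rewrite -[C]mulr1; apply: root => //; rewrite expr1n mulr1.
Qed.

Lemma closed_basicP (s : system R N) x : closed_basic s x <->
  (forall g, g \in ineqs s -> 0 <= peval g x) /\
  (forall h, h \in eqns s -> peval h x = 0).
Proof.
split; first by move=> /andP[/allP gx /allP hx]; split => // h /hx /eqP.
move=> [gx hx]; apply/andP; split; apply/allP => // h /hx ->; exact/eqxx.
Qed.

(** By the Lipschitz estimate, nearby [p] and [q] bound the violation at [x], and the local
    inequality applies in a chart where [x] is represented by some [u] in the unit cube. Returning
    from the chart costs a factor of order [|x| ^ 2]; a solution too close to the hyperplane at
    infinity leads to the second alternative. *)
Lemma pair_separation r d (sX sY : system R N) : (0 < N)%N -> (1 < d)%N ->
  (size (ineqs sX) + size (ineqs sY) <= r)%N ->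
  (forall p, p \in ineqs sX ++ eqns sX -> (msize p <= d.+1)%N) ->
  (forall p, p \in ineqs sY ++ eqns sY -> (msize p <= d.+1)%N) ->
  let E := (d * (6 * d - 3) ^ (N + r - 1))%N in
  exists2 C : R, 0 < C & forall x (p q : 'rV[R]_N), closed_basic sX p -> closed_basic sY q ->
    (exists z, [/\ closed_basic sX z, closed_basic sY z &
       C * (`|x - z| / (1 + `|x| ^+ 2)) ^+ E <= `|x - p| + `|x - q|]) \/
    C * (1 + `|x|)^-1 ^+ E <= `|x - p| + `|x - q|.
Proof.
move=> N0 d1 sr degX degY E.
pose gs := ineqs sX ++ ineqs sY; pose hs := eqns sX ++ eqns sY.
have degs p : p \in gs ++ hs -> (msize p <= d.+1)%N.
  rewrite !mem_cat => /orP[/orP[]|/orP[]] h.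
  - by apply: degX; rewrite mem_cat h.
  - by apply: degY; rewrite mem_cat h.
  - by apply: degX; rewrite mem_cat h orbT.
  - by apply: degY; rewrite mem_cat h orbT.
have gsr : (size gs <= r)%N by rewrite size_cat.
have S_of z : (forall g, g \in gs -> 0 <= peval g z) ->
    (forall h, h \in hs -> peval h z = 0) -> closed_basic sX z /\ closed_basic sY z.
  move=> gz hz; split; apply/closed_basicP; split=> f ff.
  - by apply: gz; rewrite mem_cat ff.
  - by apply: hz; rewrite mem_cat ff.
  - by apply: gz; rewrite mem_cat ff orbT.
  - by apply: hz; rewrite mem_cat ff orbT.
have [B B0 HB] := poly_growth_all degs.
pose b := B * 2 ^+ d.
have b0 : 0 <= b by rewrite mulr_ge0 // exprn_ge0.
have bounds x (p q : 'rV[R]_N) : closed_basic sX p -> closed_basic sY q ->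
    `|x - p| + `|x - q| <= 1 ->
    (forall g, g \in gs -> - peval g x <= B * (1 + `|x|) ^+ d * (`|x - p| + `|x - q|)) /\
    (forall h, h \in hs -> `|peval h x| <= B * (1 + `|x|) ^+ d * (`|x - p| + `|x - q|)).
  move=> /closed_basicP[gp hp] /closed_basicP[gq hq] a1.
  have rho1 : 1 <= 1 + `|x| by rewrite lerDl.
  have xr : `|x| <= 1 + `|x| by rewrite lerDr.
  have far y : `|x - y| <= 1 -> `|y| <= 1 + `|x|.
    by move=> xy; rewrite -[y](subrK x) (le_trans (ler_normD _ _)) // lerD2r distrC.
  have pr : `|p| <= 1 + `|x|.
    by apply: far; apply: le_trans a1; rewrite lerDl.
  have qr : `|q| <= 1 + `|x|.
    by apply: far; apply: le_trans a1; rewrite lerDr.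
  have c0 : 0 <= B * (1 + `|x|) ^+ d by rewrite mulr_ge0 // exprn_ge0 // addr_ge0.
  have grow f : f \in gs ++ hs ->
      `|peval f x - peval f p| <= B * (1 + `|x|) ^+ d * (`|x - p| + `|x - q|)
      /\ `|peval f x - peval f q| <= B * (1 + `|x|) ^+ d * (`|x - p| + `|x - q|).
    move=> ff; split; (apply: le_trans (HB f x _ _ ff rho1 xr _) _; first by []);
      by rewrite ler_wpM2l // ?lerDl ?lerDr.
  split=> f ff.
    have [|h1 h2] := grow f; first by rewrite mem_cat ff.
    move: ff; rewrite mem_cat => /orP[] ff.
      by have := gp f ff; move: h1 => /ler_normlP[h1 _]; lra.
    by have := gq f ff; move: h2 => /ler_normlP[h2 _]; lra.
  have [|h1 h2] := grow f; first by rewrite mem_cat ff orbT.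
  move: ff; rewrite mem_cat => /orP[] ff.
    by move: h1; rewrite (hp f ff) subr0.
  by move: h2; rewrite (hq f ff) subr0.
(* [None] is the affine chart, for [|x| <= 1]; otherwise a coordinate of largest modulus and its
   sign select the chart. *)
pose T (kappa : option ('I_N * bool)) :=
  if kappa is Some kb then chart_poly kb.1 d ((-1) ^+ kb.2) else id.
have /fin_all_exists[C0 /all_and2[C0_gt0 HC]] : forall kappa, exists C : R, 0 < C <= 1 /\
    forall u x (om a : R), `|u| <= 1 -> 0 <= a -> 0 <= om ->
    (forall p, p \in gs ++ hs -> peval (T kappa p) u = om * peval p x) ->
    (forall g, g \in gs -> om * - peval g x <= b * a) ->
    (forall h, h \in hs -> om * `|peval h x| <= b * a) ->
    (exists z, [/\ forall g, g \in gs -> 0 <= peval (T kappa g) z,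
       forall h, h \in hs -> peval (T kappa h) z = 0 & C * `|u - z| ^+ E <= a]) \/ C <= a.
  move=> kappa; have [|C c01 HC] := @chart_inequality r d gs hs (T kappa) b N0 d1 gsr b0.
    move=> p /degs pd; case: kappa => [[k bb]|] //=; exact: msize_chart.
  by exists C.
pose C := \big[Num.min/1]_kappa C0 kappa.
have C_gt0 : 0 < C by apply: lt_bigmin => // k _; have /andP[] := C0_gt0 k.
have C_le k : C <= C0 k by exact: bigmin_le.
have C1 : C <= 1 by exact: bigmin_le_id.
(* Distances compared through a chart lose a factor 4, which is raised to the power [E]. *)
pose C4 := C * 4 ^- E.
have C4_gt0 : 0 < C4 by rewrite divr_gt0 // exprn_gt0.
have C4C : C4 <= C by rewrite ler_piMr ?(ltW C_gt0) // invf_le1 ?exprn_gt0 // exprn_ege1 // ler1n.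
exists C4 => // x p q Xp Yq; set a := `|x - p| + `|x - q|.
have a0 : 0 <= a by rewrite addr_ge0.
have x1 : 1 <= 1 + `|x| by rewrite lerDl.
have inv1 : 0 <= (1 + `|x|)^-1 <= 1.
  by rewrite invr_ge0 addr_ge0 //= invf_le1 // (lt_le_trans ltr01).
have crude : C <= a -> C4 * (1 + `|x|)^-1 ^+ E <= a.
  move=> Ca; apply: le_trans Ca; apply: le_trans C4C; rewrite ler_piMr ?(ltW C4_gt0) //.
  by apply: exprn_ile1; case/andP: inv1.
have [a1|a1] := leP a 1; last by right; apply: crude; apply: le_trans C1 (ltW a1).
have [Hg Hh] := bounds x p q Xp Yq a1; rewrite -/a in Hg Hh.
have scaled (om : R) : 0 <= om -> om * (1 + `|x|) <= 2 ->
    (forall g, g \in gs -> om ^+ d * - peval g x <= b * a) /\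
    (forall h, h \in hs -> om ^+ d * `|peval h x| <= b * a).
  move=> om0 om2.
  have key : om ^+ d * (B * (1 + `|x|) ^+ d * a) <= b * a.
    rewrite !mulrA ler_wpM2r // mulrAC -exprMn mulrC ler_wpM2l //.
    by rewrite lerXn2r ?nnegrE ?ler0n ?mulr_ge0 ?addr_ge0.
  by split=> f ff; apply: le_trans key; rewrite ler_wpM2l ?exprn_ge0 ?Hg ?Hh.
have [xle|xgt] := leP `|x| 1.
  have [||sg sh] := scaled 1; rewrite ?ler01 //; first by rewrite mul1r; lra.
  rewrite expr1n in sg sh.
  have [|[z [gz hz Hz]]|Ca] := HC None x x 1 a xle a0 ler01 _ sg sh.
  - by move=> f _; rewrite mul1r.
  - have [zX zY] := S_of z gz hz; left; exists z; split => //.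
    apply: le_trans Hz; apply: ler_pM; rewrite ?(ltW C4_gt0) //.
    + exact: le_trans C4C (C_le _).
    + rewrite lerXn2r // ?nnegrE ?divr_ge0 ?addr_ge0 ?sqr_ge0 //.
      by rewrite ler_pdivrMr ?ltr_pwDl ?sqr_ge0 // ler_peMr // lerDl sqr_ge0.
  - by right; apply: crude; exact: le_trans Ca.
have [k xk] := sup_norm_attained x N0.
have X0 : 0 < `|x| by exact: lt_trans xgt.
(* The sign is put into the chart so that [u_k = 1 / |x|] is positive and rescaling preserves the
   inequalities. *)
pose bb := x ord0 k < 0; pose eps : R := (-1) ^+ bb.
have epsE : eps * `|x| = x ord0 k.
  rewrite xk /eps /bb; case: (ltP (x ord0 k) 0) => h; rewrite ?expr1 ?expr0.
    by rewrite ltr0_norm // mulN1r opprK.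
  by rewrite ger0_norm // mul1r.
pose om := `|x|^-1.
have om0 : 0 < om by rewrite invr_gt0.
have om1 : om <= 1 by rewrite invf_le1 // ltW.
have omx : om * `|x| = 1 by rewrite mulVf // gt_eqF.
pose u : 'rV[R]_N := \row_i if i == k then om else x ord0 i / `|x|.
have uk : u ord0 k = om by rewrite mxE eqxx.
have u1 : `|u| <= 1.
  apply: sup_norm_le => // i; rewrite mxE; case: eqP => _; first by rewrite gtr0_norm.
  by rewrite normrM normfV normr_id ler_pdivrMr // mul1r sup_norm_ge.
have ux : chart_point k eps u = x.
  apply/rowP => i; rewrite !mxE eqxx; case: eqP => [->|_]; first by rewrite invrK epsE.
  by rewrite invrK mulfVK // gt_eqF.
have [||sg sh] := scaled om; first exact: ltW.
  by rewrite mulrDr mulr1 omx; lra.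
have omd0 : 0 <= om ^+ d by rewrite exprn_ge0 // ltW.
have [|[z [gz hz Hz]]|Ca] := HC (Some (k, bb)) u x (om ^+ d) a u1 a0 omd0 _ sg sh.
- move=> f ff; rewrite /T /= -/eps peval_chart ?degs // ?uk ?ux // gt_eqF //.
- set be := `|u - z| in Hz.
  have be0 : 0 <= be by exact: normr_ge0.
  have coord i : `|u ord0 i - z ord0 i| <= be.
    by have := sup_norm_ge (u - z) i; rewrite !mxE.
  have Hz' (w : R) : 0 <= w -> w <= 4 * be -> C4 * w ^+ E <= a.
    move=> w0 wb; apply: le_trans Hz; rewrite /C4 -mulrA.
    apply: ler_pM; rewrite ?(ltW C_gt0) ?C_le //.
      by rewrite mulr_ge0 ?invr_ge0 ?exprn_ge0.
    rewrite mulrC ler_pdivrMr ?exprn_gt0 // -exprMn lerXn2r ?nnegrE ?mulr_ge0 //.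
    by rewrite mulrC.
  have zk := coord k; rewrite uk in zk.
  (* As [u_k = om], either [z] is at distance at least [om / 2] from [u], or [z_k] is positive and
     [z] represents an actual point. *)
  have [zsmall|zbig] := leP (z ord0 k) (om / 2).
    right; apply: Hz'; first by case/andP: inv1.
    apply: le_trans (_ : om <= _).
      by rewrite /om lef_pV2 ?posrE ?lerDr // (lt_le_trans ltr01).
    by move: zk => /ler_normlP[_ zk]; lra.
  have zk0 : 0 < z ord0 k by lra.
  have zkn : z ord0 k != 0 by rewrite gt_eqF.
  pose y := chart_point k eps z.
  have [yX yY] : closed_basic sX y /\ closed_basic sY y.
    apply: S_of => f ff.
      have fgh : f \in gs ++ hs by rewrite mem_cat ff.
      have := gz f ff; rewrite /T /= -/eps peval_chart ?degs //.
      by rewrite pmulr_rge0 // exprn_gt0.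
    have fgh : f \in gs ++ hs by rewrite mem_cat ff orbT.
    have := hz f ff; rewrite /T /= -/eps peval_chart ?degs //.
    by move/eqP; rewrite mulf_eq0 expf_eq0 (negPf zkn) andbF /= => /eqP.
  left; exists y; split => //; apply: Hz'.
    by rewrite divr_ge0 // addr_ge0 // sqr_ge0.
  rewrite ler_pdivrMr ?ltr_pwDl ?sqr_ge0 //.
  apply: le_trans (_ : 4 * be * `|x| ^+ 2 <= _); last first.
    by rewrite ler_wpM2l ?mulr_ge0 // lerDr.
  have den : 0 < om * z ord0 k by rewrite mulr_gt0.
  apply: sup_norm_le => [|i]; first by rewrite !mulr_ge0 // sqr_ge0.
  (* Over a common denominator, the numerator is at most [2 * be] and the denominator exceeds
     [om ^ 2 / 2]. *)
  have num (v w : R) : `|v| <= 1 -> `|v - w| <= be ->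
      `|v / om - w / z ord0 k| <= 4 * be * `|x| ^+ 2.
    move=> v1 vw.
    have -> : v / om - w / z ord0 k = (v * (z ord0 k - om) + om * (v - w)) / (om * z ord0 k).
      by field; rewrite zkn gt_eqF.
    rewrite normrM normfV (gtr0_norm den) ler_pdivrMr //.
    apply: le_trans (_ : 2 * be <= _).
      apply: le_trans (ler_normD _ _) _; rewrite !normrM (gtr0_norm om0).
      have -> : 2 * be = be + be by ring.
      apply: lerD; last by rewrite -[leRHS]mul1r ler_pM // ltW.
      by rewrite -[leRHS]mul1r ler_pM // distrC.
    have xom : `|x| * om = 1 by rewrite mulrC.
    have h : 1 <= 2 * `|x| ^+ 2 * (om * z ord0 k).
      rewrite (_ : 2 * `|x| ^+ 2 * (om * z ord0 k) =
        (`|x| * om) * (2 * `|x| * z ord0 k)); last by ring.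
      rewrite xom mul1r; rewrite -{1}xom; nra.
    rewrite (_ : 4 * be * `|x| ^+ 2 * (om * z ord0 k) =
      (2 * be) * (2 * `|x| ^+ 2 * (om * z ord0 k))); last by ring.
    by rewrite ler_peMr // mulr_ge0.
  have -> : (x - y) ord0 i = (chart_point k eps u) ord0 i - y ord0 i by rewrite ux !mxE.
  rewrite /y /chart_point !mxE eqxx.
  case: (eqVneq i k) => [_|ik].
    apply: num; last by rewrite subrr normr0.
    by rewrite /eps normrX normrN1 expr1n.
  have := coord i; rewrite mxE (negPf ik) => ci; apply: num => //.
  by have := sup_norm_ge u i; rewrite mxE (negPf ik) => /le_trans; apply.
- by right; apply: crude; exact: le_trans Ca.
Qed.

End Charts.

(** * Degree one *)

Section Hoffman.
Variable R : realType.

(** Equal to [max 0 (- t)]; in this form continuity follows from that of the absolute value. *)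
Definition negpart (t : R) : R := (`|t| - t) / 2.

Lemma negpart_ge0 t : 0 <= negpart t.
Proof. by rewrite divr_ge0 // subr_ge0 ler_norm. Qed.

Lemma negpart_pos t : 0 <= t -> negpart t = 0.
Proof. by move=> t0; rewrite /negpart ger0_norm // subrr mul0r. Qed.

Lemma negpart_neg t : t <= 0 -> negpart t = - t.
Proof. by move=> t0; rewrite /negpart ler0_norm //; field. Qed.

Lemma negpart_le t s : 0 <= s -> negpart t <= `|t - s|.
Proof.
move=> s0; case: (lerP 0 t) => t0; first by rewrite negpart_pos.
rewrite (negpart_neg (ltW t0)) ler0_norm; first lra.
by rewrite subr_le0 (le_trans (ltW t0)).
Qed.

Definition dot m (a w : 'rV[R]_m) : R := \sum_i a ord0 i * w ord0 i.

Lemma dotDr m (a w w' : 'rV[R]_m) : dot a (w + w') = dot a w + dot a w'.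
Proof. by rewrite -big_split; apply: eq_bigr => i _; rewrite mxE mulrDr. Qed.

Lemma dotZr m (a w : 'rV[R]_m) s : dot a (s *: w) = s * dot a w.
Proof. by rewrite mulr_sumr; apply: eq_bigr => i _; rewrite mxE mulrCA. Qed.

Lemma dot_continuous m (a : 'rV[R]_m) : continuous (dot a).
Proof.
move=> w; apply: (@cvg_sumr _ _ (nbhs w) _) => i.
apply: (@cvgM _ _ (nbhs w) _ (fun=> a ord0 i) (fun x : 'rV[R]_m => x ord0 i)).
  exact: cvg_cst.
exact: coord_continuous.
Qed.

Section Cone.
Variables (m k : nat) (a : 'I_k -> 'rV[R]_m).

Definition cone_violation (w : 'rV[R]_m) : R := \sum_j negpart (dot (a j) w).

Definition sign_pattern (w : 'rV[R]_m) : {ffun 'I_k -> bool * bool} :=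
  [ffun j => (dot (a j) w < 0, 0 < dot (a j) w)].

(* When [w] and [y] violate the same forms, so does [w - t *: y] for small [t],
   hence the violation is linear along this segment. *)
Lemma violation_decrease w y : sign_pattern w = sign_pattern y ->
  \forall t \near 0^'+,
    cone_violation (w - t *: y) = cone_violation w - t * cone_violation y.
Proof.
move=> E.
have term j : \forall t \near 0^'+, negpart (dot (a j) (w - t *: y)) =
    negpart (dot (a j) w) - t * negpart (dot (a j) y).
  have [] : (dot (a j) w < 0) = (dot (a j) y < 0) /\ (0 < dot (a j) w) = (0 < dot (a j) y).
    by have /ffunP /(_ j) := E; rewrite !ffunE => -[].
  have dotE t : dot (a j) (w - t *: y) = dot (a j) w - t * dot (a j) y.
    by rewrite dotDr -scaleNr dotZr mulNr.
  have dc : dot (a j) w - t * dot (a j) y @[t --> 0^'+] --> dot (a j) w.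
    have : dot (a j) w - t * dot (a j) y @[t --> (0 : R)] --> dot (a j) w - 0 * dot (a j) y.
      apply: cvgB; first exact: cvg_cst.
      by apply: cvgM; [exact: cvg_id|exact: cvg_cst].
    by rewrite mul0r subr0 => h; exact: cvg_at_right_filter.
  case: (ltrgt0P (dot (a j) w)) => hw => [+ /esym hy|+ _|+ +]; last 1 first.
  - move=> /esym/negbT; rewrite -leNgt => y1 /esym/negbT; rewrite -leNgt => y2.
    have y0 : dot (a j) y = 0 by apply/eqP; rewrite eq_le y1 y2.
    by near=> t; rewrite dotE hw y0 mulr0 subr0 negpart_pos // mulr0 subr0.
  - move=> _; have pos : \forall t \near 0^'+, 0 < dot (a j) w - t * dot (a j) y.
      by apply: (cvgr_gt _ dc).
    near=> t; rewrite dotE negpart_pos; last by apply: ltW; near: t.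
    by rewrite !negpart_pos ?(ltW hw) ?(ltW hy) // mulr0 subr0.
  - move=> /esym hy; have neg : \forall t \near 0^'+, dot (a j) w - t * dot (a j) y < 0.
      by apply: (cvgr_lt _ dc).
    near=> t; rewrite dotE negpart_neg; last by apply: ltW; near: t.
    by rewrite !negpart_neg ?(ltW hw) ?(ltW hy) //; ring.
have all : \forall t \near 0^'+, forall j, negpart (dot (a j) (w - t *: y)) =
    negpart (dot (a j) w) - t * negpart (dot (a j) y) by exact: (filter_forall _ term).
apply: filterS all => t H; rewrite /cone_violation mulr_sumr -sumrB.
by apply: eq_bigr => j _.
Unshelve. all: by end_near. Qed.

(* A minimiser [y] of [cone_violation y + c * `|y - w|] satisfies all constraints:
   otherwise moving against a point of the same sign pattern improves it, and
   there are finitely many patterns. *)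
Lemma conical_hoffman : exists2 c : R, 0 < c & forall w, exists z,
  (forall j, 0 <= dot (a j) z) /\ c * `|w - z| <= cone_violation w.
Proof.
have v_ge0 w : 0 <= cone_violation w.
  by apply: sumr_ge0 => j _; exact: negpart_ge0.
(* One violating representative is chosen per sign pattern; [c] stays below the ratios of violation
   to norm of these finitely many points. *)
have /fin_all_exists[ys Hys] : forall s, exists y : 'rV[R]_m,
    (exists2 w, sign_pattern w = s & 0 < cone_violation w) ->
    sign_pattern y = s /\ 0 < cone_violation y.
  move=> s; have [[w ws wv]|h] := pselect (exists2 w, sign_pattern w = s & 0 < cone_violation w).
    by exists w.
  by exists 0.
pose cs s := if 0 < cone_violation (ys s) then cone_violation (ys s) / (`|ys s| + 1) else 1.
have cs0 s : 0 < cs s.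
  by rewrite /cs; case: ifP => // h; rewrite divr_gt0 // ltr_wpDl.
pose c := \big[Num.min/1]_s cs s.
have c0 : 0 < c by apply: lt_bigmin.
exists c => // w.
(* Comparison with [w] confines the minimiser to distance [cone_violation w / c] from [w]; the extra
   1 makes it interior, so that it can be moved. *)
pose rho := `|w| + cone_violation w / c + 1.
pose g y := cone_violation y + c * `|y - w|.
have vc : continuous cone_violation.
  move=> y; apply: (@cvg_sumr _ _ (nbhs y) _) => j.
  have nc : negpart t @[t --> dot (a j) y] --> negpart (dot (a j) y).
    apply: cvgM; last exact: cvg_cst.
    by apply: cvgB; [apply: cvg_norm|]; exact: cvg_id.
  exact: (@cvg_comp _ _ _ (dot (a j)) negpart (nbhs y) _ _ (@dot_continuous m (a j) y) nc).
have distc : continuous (fun z : 'rV[R]_m => `|z - w|).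
  move=> z; apply: (@cvg_norm _ 'rV[R]_m _ (nbhs z) _ (fun x : 'rV[R]_m => x - w)).
  exact: (@cvgB _ 'rV[R]_m _ (nbhs z) _ id (cst w) z w cvg_id (cvg_cst w)).
have gc : continuous g.
  move=> y; apply: (cvgD (vc y)).
  exact: (@cvgM _ _ (nbhs y) _ (fun=> c) _ c _ (cvg_cst c) (distc y)).
have [||y /set_mem yB ymin] :=
  @EVT_min_rV R m g [set x | forall i, `|x ord0 i| <= rho] _ (@box_compact R m rho).
- by exists 0 => i /=; rewrite mxE normr0 !addr_ge0 // divr_ge0 // ltW.
- exact: continuous_subspaceT.
have wB : [set x : 'rV[R]_m | forall i, `|x ord0 i| <= rho] w.
  move=> i; rewrite (le_trans (sup_norm_ge w i)) // /rho -addrA lerDl addr_ge0 //.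
  by rewrite divr_ge0 // ltW.
have gy : g y <= cone_violation w.
  by have := ymin w (mem_set wB); rewrite /g subrr normr0 mulr0 addr0.
have yw : c * `|y - w| <= cone_violation w.
  by apply: le_trans gy; rewrite lerDr.
have [vy|vy] := eqVneq (cone_violation y) 0.
  exists y; split; last by rewrite distrC.
  move=> j; rewrite leNgt; apply/negP => dj; move/eqP: vy; apply/negP.
  rewrite gt_eqF // /cone_violation (bigD1 j) //=; apply: ltr_wpDr.
    by apply: sumr_ge0 => i _; exact: negpart_ge0.
  by rewrite negpart_neg ?(ltW dj) // oppr_gt0.
exfalso.
have vy0 : 0 < cone_violation y by rewrite lt_def vy v_ge0.
set s := sign_pattern y.
have [ss sv] := Hys s (ex_intro2 _ _ y erefl vy0).
have cy : c * `|ys s| < cone_violation (ys s).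
  have cle : c <= cone_violation (ys s) / (`|ys s| + 1).
    have : c <= cs s by exact: bigmin_le.
    by rewrite /cs sv.
  rewrite ler_pdivlMr ?ltr_wpDl // in cle; lra.
have yB' i : `|y ord0 i| < rho.
  have yw' : `|y - w| <= cone_violation w / c by rewrite ler_pdivlMr // mulrC.
  have h := sup_norm_ge (y - w) i; have hw := sup_norm_ge w i; rewrite !mxE in h.
  rewrite -[y ord0 i](subrK (w ord0 i)) (le_lt_trans (ler_normD _ _)) // /rho.
  by lra.
pose yt t := y - t *: ys s.
have ytc : yt t @[t --> 0^'+] --> y.
  have : y - t *: ys s @[t --> (0 : R)] --> y - 0 *: ys s.
    apply: cvgB; first exact: cvg_cst.
    by apply: cvgZ; [exact: cvg_id|exact: cvg_cst].
  by rewrite scale0r subr0 => h; exact: cvg_at_right_filter.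
have n1 : \forall t \near 0^'+, forall i, `|yt t ord0 i| <= rho.
  have h i : \forall t \near 0^'+, `|yt t ord0 i| <= rho.
    by apply: (cvgr_le _ (cvg_norm (coord_cvg _ ytc (i := i)))).
  exact: (filter_forall _ h).
have n2 : \forall t \near 0^'+, cone_violation (yt t) =
    cone_violation y - t * cone_violation (ys s) by apply: violation_decrease.
have n3 : \forall t \near 0^'+, (0 : R) < t by exact: nbhs_right_gt.
have : \forall t \near (0 : R)^'+, False.
  near=> t; have t0 : 0 < t by near: t.
  have tB : forall i, `|yt t ord0 i| <= rho by near: t.
  have vt : cone_violation (yt t) = cone_violation y - t * cone_violation (ys s) by near: t.
  have := ymin (yt t) (mem_set (tB : [set x : 'rV[R]_m | forall i, `|x ord0 i| <= rho] (yt t))).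
  rewrite /g vt; have tri : `|yt t - w| <= `|y - w| + t * `|ys s|.
    rewrite /yt addrAC (le_trans (ler_normB _ _)) // lerD2l normrZ.
    by rewrite (gtr0_norm t0).
  have : c * `|yt t - w| <= c * (`|y - w| + t * `|ys s|) by rewrite ler_wpM2l // ltW.
  have : t * (c * `|ys s|) < t * cone_violation (ys s) by rewrite ltr_pM2l.
  lra.
by move=> /filter_ex[].
Unshelve. all: by end_near. Qed.

End Cone.

Lemma hoffman_seq m (fs : seq 'rV[R]_m) : exists2 c, 0 < c & forall w, exists z,
  (forall f, f \in fs -> 0 <= dot f z) /\
  c * `|w - z| <= \sum_(f <- fs) negpart (dot f w).
Proof.
have [c c0 H] := conical_hoffman (tnth (in_tuple fs)).
exists c => // w; have [z [zge zle]] := H w; exists z; split; last by rewrite big_tnth.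
by move=> f /(tnthP (in_tuple fs))[j ->].
Qed.

Section Affine.
Variable N : nat.
Implicit Types (f : mpoly N R) (x y z : 'rV[R]_N).

Definition linear_part f := \row_(i < N) mcoeff (mnm1 i) f.

Lemma affineE f x : (msize f <= 2)%N ->
  peval f x = dot (linear_part f) x + mcoeff mnm0 f.
Proof.
move=> f2.
have fE : f = \sum_i mcoeff (mnm1 i) f *: mpolyX R (mnm1 i) + mpolyC N (mcoeff mnm0 f).
  apply/mpolyP => m; rewrite mcoeffD raddf_sum mcoeffC /=.
  under eq_bigr do rewrite mcoeffZ mcoeffX.
  have [m1|m1] := ltnP 1 (mdeg m).
    have -> : mcoeff m f = 0.
      by apply: memN_msupp_eq0; apply/negP => /msize_mdeg_lt; lia.
    have -> : (m == mnm0) = false by apply/negbTE; rewrite -mdeg_eq0; lia.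
    rewrite mulr0 addr0 big1 // => i _; case: eqP => [e|_]; last by rewrite mulr0.
    by move: m1; rewrite -e mdeg1.
  have [m0|m0] := eqVneq (mdeg m) 0.
    move/eqP: m0; rewrite mdeg_eq0 => /eqP ->; rewrite eqxx mulr1 big1 ?add0r //.
    by move=> i _; case: eqP => [e|_]; rewrite ?mulr0 //; have := mdeg1 i; rewrite e mdeg0.
  have /eqP : mdeg m = 1%N by lia.
  rewrite mdeg_eq1 => /existsP[j /eqP ->].
  have -> : (mnm1 j == mnm0) = false by apply/negbTE; rewrite -mdeg_eq0 mdeg1.
  rewrite mulr0 addr0 (bigD1 j) //= eqxx mulr1 big1 ?addr0 // => i ij.
  by rewrite (_ : (_ == _) = false) ?mulr0 //; apply/negbTE; rewrite eq_mnm1.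
rewrite {1}fE /peval mevalD mevalC raddf_sum; congr (_ + _).
by apply: eq_bigr => i _; rewrite /= mevalZ mevalXU mxE.
Qed.

Definition homogenize f : 'rV[R]_(N + 1) :=
  row_mx (linear_part f) (const_mx (mcoeff mnm0 f)).

Lemma dot_homogenize f (v : 'rV[R]_(N + 1)) :
  dot (homogenize f) v = dot (linear_part f) (lsubmx v) + mcoeff mnm0 f * v ord0 (rshift N ord0).
Proof.
rewrite /dot big_split_ord /= big_ord1 /homogenize row_mxEr mxE; congr (_ + _).
by apply: eq_bigr => i _; rewrite row_mxEl mxE [RHS in _ = _ * RHS]mxE.
Qed.

Lemma dot_le m (u v : 'rV[R]_m) : `|dot u v| <= (\sum_i `|u ord0 i|) * `|v|.
Proof.
rewrite mulr_suml (le_trans (ler_norm_sum _ _ _)) //; apply: ler_sum => i _.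
by rewrite normrM ler_wpM2l // sup_norm_ge.
Qed.

Lemma affine_separation (ps qs : seq (mpoly N R)) :
  (forall f, f \in ps ++ qs -> (msize f <= 2)%N) ->
  exists2 C : R, 0 < C & forall x p q,
    (forall f, f \in ps -> 0 <= peval f p) ->
    (forall f, f \in qs -> 0 <= peval f q) ->
    (exists z, (forall f, f \in ps ++ qs -> 0 <= peval f z) /\
               C * (`|x - z| / (1 + `|x|)) <= `|x - p| + `|x - q|) \/
    C <= `|x - p| + `|x - q|.
Proof.
move=> deg.
pose last_form : 'rV[R]_(N + 1) := row_mx 0 (const_mx 1).
have [c c0 hoff] := hoffman_seq (last_form :: map homogenize (ps ++ qs)).
pose B := \sum_(f <- ps ++ qs) \sum_i `|linear_part f ord0 i|.
pose M := ((size (ps ++ qs))%:R * B + 1) / c.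
have B0 : 0 <= B by apply: sumr_ge0 => f _; exact: sumr_ge0.
have M0 : 0 < M by rewrite divr_gt0 // ltr_wpDl // mulr_ge0.
exists (2 * M)^-1 => [|x p q Hp Hq]; first by rewrite invr_gt0 mulr_gt0.
set a := `|x - p| + `|x - q|.
have a0 : 0 <= a by rewrite addr_ge0.
have lastE v : dot last_form v = v ord0 (rshift N ord0).
  rewrite /dot big_split_ord /= big_ord1 row_mxEr mxE mul1r big1 ?add0r // => i _.
  by rewrite row_mxEl mxE mul0r.
pose w : 'rV[R]_(N + 1) := row_mx x (const_mx 1).
have w1 : w ord0 (rshift N ord0) = 1 by rewrite row_mxEr mxE.
have wE f : f \in ps ++ qs -> dot (homogenize f) w = peval f x.
  by move=> ff; rewrite dot_homogenize row_mxKl w1 mulr1 affineE ?deg.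
have lip f y : f \in ps ++ qs -> `|x - y| <= a -> 0 <= peval f y ->
    negpart (dot (homogenize f) w) <= B * a.
  move=> ff ya fy; rewrite wE //; apply: le_trans (negpart_le _ fy) _.
  rewrite !affineE ?deg // opprD addrACA subrr addr0.
  have -> : dot (linear_part f) x - dot (linear_part f) y = dot (linear_part f) (x - y).
    by rewrite dotDr -[- y]scaleN1r dotZr mulN1r.
  apply: le_trans (dot_le _ _) _; apply: ler_pM => //; first exact: sumr_ge0.
  by rewrite /B (big_rem f ff) /= lerDl sumr_ge0 // => g _; exact: sumr_ge0.
have ap : `|x - p| <= a by rewrite /a lerDl.
have aq : `|x - q| <= a by rewrite /a lerDr.
have viol : \sum_(f <- last_form :: map homogenize (ps ++ qs)) negpart (dot f w)
    <= (size (ps ++ qs))%:R * B * a.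
  rewrite big_cons lastE w1 negpart_pos // add0r big_map -mulrA.
  apply: sum_seq_le => f ff; have := ff; rewrite mem_cat => /orP[fp|fq].
    by apply: (lip f p ff); [exact: ap|exact: Hp].
  by apply: (lip f q ff); [exact: aq|exact: Hq].
have [v [vge vle]] := hoff w.
have vM : `|w - v| <= M * a.
  rewrite /M mulrAC ler_pdivlMr // mulrC (le_trans vle) // (le_trans viol) //.
  by rewrite ler_wpM2r // lerDl.
have wv i : (w - v) ord0 i = w ord0 i - v ord0 i by rewrite mxE [X in _ + X]mxE.
set t := v ord0 (rshift N ord0).
have tM : `|1 - t| <= M * a.
  by have := sup_norm_ge (w - v) (rshift N ord0); rewrite wv w1 => /le_trans; apply.
have [tsmall|tbig] := leP t 2^-1.
  right; rewrite invfM ler_pdivrMr // mulrC; move: tM => /ler_normlP[_]; lra.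
left; have t0 : 0 < t by apply: lt_trans tbig.
have tn : t != 0 by rewrite gt_eqF.
exists (t^-1 *: lsubmx v); split=> [f ff|].
  rewrite affineE ?deg // dotZr -(pmulr_rge0 _ t0) mulrDr mulVKf // [t * _]mulrC.
  have := vge (homogenize f); rewrite dot_homogenize; apply.
  by rewrite inE map_f ?orbT.
have x1 : 0 < 1 + `|x| by rewrite ltr_pwDl.
rewrite [leLHS]mulrC ler_pdivrMr; last exact: mulr_gt0.
rewrite ler_pdivrMr //.
have Ma0 : 0 <= M * a by exact: mulr_ge0 (ltW M0) a0.
apply: sup_norm_le => [|i].
  exact: mulr_ge0 (mulr_ge0 a0 (mulr_ge0 (ler0n _ 2) (ltW M0))) (ltW x1).
have h : `|x ord0 i - v ord0 (lshift 1 i)| <= M * a.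
  by have := sup_norm_ge (w - v) (lshift 1 i); rewrite wv row_mxEl => /le_trans; apply.
have -> : (x - t^-1 *: lsubmx v) ord0 i =
    (x ord0 i * (t - 1) + (x ord0 i - v ord0 (lshift 1 i))) / t.
  by rewrite !mxE; field.
rewrite normrM normfV (gtr0_norm t0) ler_pdivrMr //.
have xi := sup_norm_ge x i.
have num : `|x ord0 i * (t - 1) + (x ord0 i - v ord0 (lshift 1 i))| <= (1 + `|x|) * (M * a).
  rewrite (le_trans (ler_normD _ _)) // mulrDl mul1r addrC lerD // normrM.
  by rewrite ler_pM // distrC.
apply: le_trans num _.
rewrite [leRHS](_ : _ = (1 + `|x|) * (M * a) * (2 * t)); last by ring.
by rewrite ler_peMr; [|exact: mulr_ge0 (ltW x1) Ma0|lra].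
Qed.

End Affine.
End Hoffman.

(** * Euclidean distances *)

Section Euclidean.
Variables (R : realType) (N : nat).
Implicit Types (x y z p q : 'rV[R]_N) (A X Y : set 'rV[R]_N).

Lemma eucl_norm_ge x : `|x| <= eucl_norm x.
Proof.
apply: sup_norm_le => [|i]; first exact: sqrtr_ge0.
rewrite -sqrtr_sqr ler_wsqrtr // (bigD1 i) //= lerDl.
by apply: sumr_ge0 => j _; exact: sqr_ge0.
Qed.

Lemma eucl_norm_le x : eucl_norm x <= N%:R * `|x|.
Proof.
rewrite -[leRHS]ger0_norm ?mulr_ge0 // -sqrtr_sqr ler_wsqrtr //.
apply: le_trans (_ : \sum_(i < N) `|x| ^+ 2 <= _).
  apply: ler_sum => i _; rewrite -real_normK ?num_real //.
  by rewrite lerXn2r ?nnegrE // sup_norm_ge.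
rewrite sumr_const card_ord exprMn -[_ ^+ 2 *+ N]mulr_natl ler_wpM2r ?sqr_ge0 //.
by rewrite -natrX ler_nat; case: N => // n; rewrite leq_pmulr.
Qed.

Lemma eucl_dist_le x y A : A y -> eucl_dist x A <= eucl_norm (x - y).
Proof.
move=> Ay; rewrite /eucl_dist ifF; last by apply/negbTE/set0P; exists y.
apply: ge_inf; last by exists y.
by exists 0 => _ [w _ <-]; exact: sqrtr_ge0.
Qed.

Lemma eucl_dist_ge x A (b : R) : A !=set0 ->
  (forall y, A y -> b <= eucl_norm (x - y)) -> b <= eucl_dist x A.
Proof.
move=> A0 H; rewrite /eucl_dist ifF; last exact/negbTE/set0P.
apply: lb_le_inf => [|_ [y Ay <-]]; last exact: H.
by case: A0 => y Ay; exists (eucl_norm (x - y)); exists y.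
Qed.

Lemma eucl_dist_ge0 x A : 0 <= eucl_dist x A.
Proof.
have [->|/set0P A0] := eqVneq A set0; first by rewrite /eucl_dist eqxx.
by apply: eucl_dist_ge => // y _; exact: sqrtr_ge0.
Qed.

Lemma eucl_dist_sum_ge x X Y (b : R) : X !=set0 -> Y !=set0 ->
  (forall p q, X p -> Y q -> b <= `|x - p| + `|x - q|) ->
  b <= eucl_dist x X + eucl_dist x Y.
Proof.
move=> X0 Y0 H; rewrite addrC -lerBlDr; apply: eucl_dist_ge => // q Yq.
rewrite lerBlDr -lerBlDl; apply: eucl_dist_ge => // p Xp.
rewrite lerBlDl (le_trans (H p q Xp Yq)) // addrC lerD // eucl_norm_ge //.
Qed.

Lemma eucl_dist_growth A : exists2 K : R, 1 <= K &
  forall x, eucl_dist x A <= K * (1 + `|x|).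
Proof.
have [->|/set0P[y Ay]] := eqVneq A set0.
  by exists 1 => // x; rewrite /eucl_dist eqxx mul1r lerDl.
exists (1 + N%:R * (1 + `|y|)) => [|x]; first by rewrite lerDl mulr_ge0 // addr_ge0.
apply: le_trans (eucl_dist_le x Ay) _; apply: le_trans (eucl_norm_le _) _.
apply: le_trans (_ : N%:R * (1 + `|y|) * (1 + `|x|) <= _); last first.
  by rewrite ler_wpM2r ?addr_ge0 // lerDr.
rewrite -mulrA ler_wpM2l // (le_trans (ler_normB _ _)) //.
have := mulr_ge0 (normr_ge0 x) (normr_ge0 y); lra.
Qed.

(** Descriptions competing for kappa have at most r(X) inequalities by definition, so a single
    decomposition controls both numbers. *)
Lemma kappa_decomposition X rX kX : is_rnum X rX -> is_kappa X kX ->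
  exists (k : nat) (D : 'I_k.+1 -> system R N),
    [/\ X = \bigcup_(i in [set: 'I_k.+1]) closed_basic (D i),
        forall i, (size (ineqs (D i)) <= rX)%N &
        forall i f, f \in ineqs (D i) ++ eqns (D i) -> (msize f <= kX.+1)%N].
Proof.
move=> [rX1 rXmin] [r0 [r01 r0min] [[k [D [[XE _] sizes kE]]] _]].
have r0E : r0 = rX by apply/eqP; rewrite eqn_leq rXmin // r0min.
exists k, D; split=> // [i|i f]; first by rewrite -r0E.
rewrite mem_cat => ff; have : (pdeg f <= kX)%N; last by rewrite /pdeg; case: (msize f).
rewrite kE; apply: leq_trans (leq_bigmax i); rewrite /system_deg leq_max.
by case/orP: ff => ff; rewrite (leq_bigmax_seq _ ff) ?orbT.
Qed.

End Euclidean.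

(** * Pairs of basic sets and the conclusion *)

Section Main.
Variables (R : realType) (N : nat).

(** [minn d 2] unites the factor [1 + |x|] of degree one with the [1 + |x| ^ 2] of the charts, and
    never exceeds [d]. The second alternative has numerator [1 + |x|] because the distance to a
    fixed set grows at most linearly. *)
Lemma pair_bound r d (sX sY : system R N) : (0 < d)%N ->
    (size (ineqs sX) + size (ineqs sY) <= r)%N ->
    (forall f, f \in ineqs sX ++ eqns sX -> (msize f <= d.+1)%N) ->
    (forall f, f \in ineqs sY ++ eqns sY -> (msize f <= d.+1)%N) ->
  let E := (d * (6 * d - 3) ^ (N + r - 1))%N in
  exists2 C : R, 0 < C & forall x (p q : 'rV[R]_N),
    closed_basic sX p -> closed_basic sY q ->
    (exists z, [/\ closed_basic sX z, closed_basic sY z &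
       C * (`|x - z| / (1 + `|x| ^+ minn d 2)) ^+ E <= `|x - p| + `|x - q|]) \/
    C * ((1 + `|x|) / (1 + `|x| ^+ minn d 2)) ^+ E <= `|x - p| + `|x - q|.
Proof.
move=> d0 sr dX dY E.
have E0 : (0 < E)%N by rewrite muln_gt0 d0 expn_gt0 subn_gt0; lia.
have [N0|N0] := posnP N.
  have single (u v : 'rV[R]_N) : u = v.
    by apply/rowP => i; have := ltn_ord i; rewrite [X in (_ < X)%N]N0.
  exists 1 => // x p q Xp Yq; left; exists p; split => //.
    by rewrite (single p q).
  rewrite (single (x - p) 0).
  by rewrite normr0 mul0r expr0n gtn_eqF // mulr0 addr_ge0.
have [d1|d1] := leqP d 1.
  have dE : d = 1%N by apply/eqP; rewrite eqn_leq d1.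
  (* Each equation becomes two opposite inequalities, to which the linear error bound applies. *)
  pose pos (s : system R N) := ineqs s ++ eqns s ++ map -%R (eqns s).
  have posP (s : system R N) x : (forall f, f \in pos s -> 0 <= peval f x) <-> closed_basic s x.
    split=> [H|/closed_basicP[Hg Hh] f].
      apply/closed_basicP; split=> f ff; first by apply: H; rewrite mem_cat ff.
      apply/eqP; rewrite eq_le -oppr_ge0 -[- _]mevalN !H //.
        by rewrite !mem_cat ff orbT.
      by rewrite !mem_cat (map_f _ ff) !orbT.
    rewrite !mem_cat => /or3P[/Hg //|/Hh -> //|/mapP[h /Hh hx ->]].
    by rewrite /peval mevalN oppr_ge0 [meval _ _]hx.
  have degs f : f \in pos sX ++ pos sY -> (msize f <= 2)%N.
    have deg s : (forall f, f \in ineqs s ++ eqns s -> (msize f <= d.+1)%N) ->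
        f \in pos s -> (msize f <= 2)%N.
      rewrite dE => ds; rewrite !mem_cat orbA => /orP[fs|/mapP[h hs ->]].
        by apply: ds; rewrite mem_cat.
      by rewrite mmeasureN ds // mem_cat hs orbT.
    by rewrite mem_cat => /orP[/(deg _ dX)|/(deg _ dY)].
  have [C C0 H] := affine_separation degs.
  exists C => // x p q /posP Xp /posP Yq.
  have n1 : 1 + `|x| != 0 by rewrite gt_eqF // ltr_pwDl.
  have -> : minn d 2 = 1%N by rewrite dE.
  rewrite expr1 divff // expr1n mulr1.
  have [aC|aC] := leP C (`|x - p| + `|x - q|); first by right.
  have [[z [zpos zle]]|Ca] := H x p q Xp Yq; last by move: aC; rewrite ltNge Ca.
  left; exists z; split.
  - by apply/posP => f ff; apply: zpos; rewrite mem_cat ff.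
  - by apply/posP => f ff; apply: zpos; rewrite mem_cat ff orbT.
  apply: le_trans (zle); rewrite ler_wpM2l ?(ltW C0) //.
  (* Here [C * u] is below [C], so [u <= 1], and raising [u] to the power [E >= 1] only lowers
     it. *)
  set u := _ / _ in zle *.
  have u0 : 0 <= u by rewrite divr_ge0 // addr_ge0.
  have u1 : u <= 1.
    by rewrite -(ler_pM2l C0) mulr1 (le_trans zle) // ltW.
  by rewrite -(prednK E0) exprS ler_piMr // exprn_ile1.
have [C C0 H] := @pair_separation R N r d sX sY N0 d1 sr dX dY.
rewrite -/E in H; rewrite (minn_idPr d1).
(* The 2 comes from [(1 + |x|) ^ 2 <= 2 * (1 + |x| ^ 2)]. *)
exists (C / 2 ^+ E) => [|x p q Xp Yq]; first by rewrite divr_gt0 // exprn_gt0.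
have C2 (u v : R) : 0 <= u -> u <= 2 * v -> C / 2 ^+ E * u ^+ E <= C * v ^+ E.
  move=> u0 uv; rewrite -mulrA ler_wpM2l ?(ltW C0) // mulrC ler_pdivrMr ?exprn_gt0 //.
  by rewrite -exprMn lerXn2r ?nnegrE // 1?mulrC // (le_trans u0) // mulrC.
have x2 : 0 < 1 + `|x| ^+ 2 by rewrite ltr_pwDl // sqr_ge0.
have [[z [Xz Yz Hz]]|Hx] := H x p q Xp Yq.
  left; exists z; split=> //; apply: le_trans (C2 _ _ _ _) Hz.
    by rewrite divr_ge0 // ltW.
  by rewrite ler_peMl // ?ler1n // divr_ge0 // ltW.
right; apply: le_trans (C2 _ _ _ _) Hx; first by rewrite divr_ge0 ?addr_ge0 // ltW.
have x1 : 0 < 1 + `|x| by rewrite ltr_pwDl.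
rewrite ler_pdivrMr // mulrAC ler_pdivlMr //.
have := sqr_ge0 (1 - `|x|); nra.
Qed.

End Main.

Theorem theorem2p2 (R : realType) (N : nat) (X Y : set 'rV[R]_N)
    (closedX : closed X) (semialgX : semialgebraic X)
    (closedY : closed Y) (semialgY : semialgebraic Y)
    (rX rY kX kY r d : nat)
    (rXP : is_rnum X rX) (rYP : is_rnum Y rY)
    (kXP : is_kappa X kX) (kYP : is_kappa Y kY)
    (rE : r = (rX + rY)%N) (dE : d = maxn kX kY) (d_ge1 : (1 <= d)%N) :
  exists2 C : R, 0 < C & forall x : 'rV[R]_N,
    eucl_dist x X + eucl_dist x Y >=
      C * (eucl_dist x (X `&` Y) / (1 + eucl_norm x ^+ d))
            ^+ (d * (6 * d - 3) ^ (N + r - 1))%N.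
Proof.
set E := (d * _)%N.
have den_gt0 (x : 'rV[R]_N) : 0 < 1 + eucl_norm x ^+ d.
  by rewrite ltr_pwDl // exprn_ge0 // sqrtr_ge0.
have base_le1 (x : 'rV[R]_N) : (1 / (1 + eucl_norm x ^+ d)) ^+ E <= 1.
  apply: exprn_ile1; first by rewrite divr_ge0 // ltW.
  by rewrite ler_pdivrMr // mul1r lerDl exprn_ge0 // sqrtr_ge0.
(* If [X] is empty, so is the intersection; both distances are 1 by convention, and the power on the
   other side is at most 1. *)
have [X0|/set0P X0] := eqVneq X set0.
  exists 1 => // x; rewrite mul1r X0 set0I {1 2}/eucl_dist eqxx.
  by rewrite (le_trans (base_le1 x)) // lerDl eucl_dist_ge0.
have [Y0|/set0P Y0] := eqVneq Y set0.
  exists 1 => // x; rewrite mul1r Y0 setI0 {1 3}/eucl_dist eqxx.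
  by rewrite (le_trans (base_le1 x)) // lerDr eucl_dist_ge0.
have [k [D [XE sizeX degX]]] := kappa_decomposition rXP kXP.
have [l [F [YE sizeY degY]]] := kappa_decomposition rYP kYP.
have [kXd kYd] : (kX <= d)%N /\ (kY <= d)%N by rewrite dE leq_maxl leq_maxr.
have sizes i j : (size (ineqs (D i)) + size (ineqs (F j)) <= r)%N by rewrite rE leq_add.
have deg_le n (f : mpoly N R) : (n <= d)%N -> (msize f <= n.+1)%N -> (msize f <= d.+1)%N.
  by move=> nd /leq_trans; apply.
have /fin_all_exists2[C0 C0_gt0 H] (ij : 'I_k.+1 * 'I_l.+1) :=
  @pair_bound R N r d (D ij.1) (F ij.2) d_ge1
    (sizes ij.1 ij.2)
    (fun f ff => deg_le _ f kXd (degX ij.1 f ff))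
    (fun f ff => deg_le _ f kYd (degY ij.2 f ff)).
pose C := \big[Num.min/1]_ij C0 ij.
have C_gt0 : 0 < C by apply: lt_bigmin.
have [K K1 HK] := eucl_dist_growth (X `&` Y).
(* [K] accounts for the growth of the distance, also to an empty intersection, [N] for the change of
   norm, and 2 for [1 + |x| ^ minn d 2 <= 2 * (1 + eucl_norm x ^ d)]. *)
pose L : R := 2 * (K + N%:R).
have L0 : 0 < L by rewrite mulr_gt0 // ltr_wpDr // (lt_le_trans ltr01).
exists (C / L ^+ E) => [|x]; first by rewrite divr_gt0 // exprn_gt0.
(* [p] and [q] lie in some pieces [D i] and [F j], and a point common to these pieces lies in the
   intersection of [X] and [Y]. *)
apply: eucl_dist_sum_ge => // p q.
rewrite {1}XE {1}YE => -[i _ Xp] [j _ Yq].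
set w := eucl_dist x _ / _.
have w0 : 0 <= w by rewrite divr_ge0 ?eucl_dist_ge0 // ltW.
have xk : 0 < 1 + `|x| ^+ minn d 2 by rewrite ltr_pwDl // exprn_ge0.
have scale (t : R) : 0 <= t -> eucl_dist x (X `&` Y) <= (K + N%:R) * t ->
    C / L ^+ E * w ^+ E <= C0 (i, j) * (t / (1 + `|x| ^+ minn d 2)) ^+ E.
  move=> t0 tw; rewrite -mulrA; apply: ler_pM; rewrite ?(ltW C_gt0) //.
  - by rewrite mulr_ge0 ?invr_ge0 ?exprn_ge0 // ltW.
  - exact: bigmin_le.
  rewrite mulrC ler_pdivrMr ?exprn_gt0 // -exprMn lerXn2r ?nnegrE //.
    by rewrite mulr_ge0 ?divr_ge0 // ltW.
  rewrite /w ler_pdivrMr // (le_trans tw) // /L.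
  rewrite [leRHS](_ : _ = (K + N%:R) * t *
    ((2 * (1 + eucl_norm x ^+ d)) / (1 + `|x| ^+ minn d 2))); last by ring.
  have KN : 0 <= K + N%:R by rewrite addr_ge0 // (le_trans ler01).
  rewrite ler_peMr ?mulr_ge0 // ler_pdivlMr // mul1r.
  have xe := eucl_norm_ge x; have e0 : 0 <= eucl_norm x by exact: sqrtr_ge0.
  have low : `|x| ^+ minn d 2 <= eucl_norm x ^+ minn d 2 by rewrite lerXn2r ?nnegrE.
  have : eucl_norm x ^+ minn d 2 <= 1 + eucl_norm x ^+ d; last first.
    by move=> up; have := exprn_ge0 d e0; move: low up; lra.
  have [e1|e1] := leP (eucl_norm x) 1.
    by apply: ler_wpDr; [exact: exprn_ge0|exact: exprn_ile1].
  by apply: ler_wpDl => //; apply: ler_weXn2l; [exact: ltW|exact: geq_minl].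
have [[z [Xz Yz Hz]]|Hx] := H (i, j) x p q Xp Yq.
  apply: le_trans (scale _ _ _) Hz => //.
  have zXY : (X `&` Y) z by rewrite XE YE; split; [exists i|exists j].
  apply: le_trans (eucl_dist_le x zXY) _; apply: le_trans (eucl_norm_le _) _.
  by rewrite ler_wpM2r // lerDr (le_trans ler01).
apply: le_trans (scale _ _ _) Hx; first by rewrite addr_ge0.
by apply: le_trans (HK x) _; rewrite ler_wpM2r ?addr_ge0 // lerDl.
Qed.
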